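(* The probability that a clean random multigraph of excess $r>0$ will not acquire a new bicyclic component when its excess next changes is strictly greater than the limiting value $$\frac{r(r+1)}{(r+\frac16)(r+\frac56)}.$$ Precisely: let $r\ge1$ and $n\ge 2r$ be integers, let $M$ be a random clean multigraph of excess $r$ on $n$ labeled vertices without acyclic components, chosen with probability proportional to $\kappa(M)$, and let $\langle x,y\rangle$ be uniformly distributed over the $n^2$ ordered pairs of vertices, independently of $M$. Then the probability that $x$ and $y$ do not both lie in unicyclic components of $M$ (equivalently, that adding the edge joining $x$ and $y$ does not create a new bicyclic component out of unicyclic components) is strictly greater than $r(r+1)/\bigl((r+\frac16)(r+\frac56)\bigr)$.
   Context: Multigraphs may have self-loops and multiple edges. For a multigraph $M$ on labeled vertices $1,\dots,n$ with $m_{xy}=m_{yx}$ edges between $x$ and $y$, the compensation factor is $\kappa(M)=1\big/\prod_{x=1}^n\bigl(2^{m_{xx}}\prod_{y=x}^n m_{xy}!\bigr)$; it is proportional to the probability of obtaining $M$ by adding edges joining independent uniform ordered pairs of vertices. A component is acyclic if it is a tree, unicyclic if it has equally many edges and vertices, bicyclic if it has exactly one more edge than vertices, and complex if it has more edges than vertices. The excess of a multigraph is the number of edges plus the number of acyclic components minus the number of vertices. Adding an edge changes the excess (increasing it by $1$) exactly when both endpoints lie in the cyclic part, i.e. in non-acyclic components; the multigraph $M$ in the claim represents the cyclic part, having $n$ vertices, of the random multigraph. Deleting repeatedly from the complex part (the union of complex components) any vertex of degree $1$ with its edge, and then repeatedly removing any vertex of degree $2$ and splicing its two edges into one (a self-loop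 contributes $2$ to the degree), yields a reduced multigraph with all degrees at least $3$. The multigraph is clean if every vertex of this reduced multigraph has degree exactly $3$. *)

(* Defs.v *)
From HB Require Import structures.
From mathcomp Require Import all_boot all_order all_algebra.

Set Implicit Arguments.
Unset Strict Implicit.
Unset Printing Implicit Defensive.

Import Order.TTheory GRing.Theory Num.Theory.

Local Open Scope nat_scope.

(** A multigraph whose vertices form a subset [vset] of ['I_n].  [mult x y] is
    the number of edges between [x] and [y], and [mult x x] the number of
    self-loops at [x].  Entries of [mult] outside [vset] are junk: every notion
    below looks only at entries whose two indices lie in [vset], so a vertex is
    deleted together with its edges just by removing it from [vset].  Symmetry
    is required of the multigraphs in [clean_graphs] and preserved by the
    operations below. *)
Record multigraph (n : nat) := Multigraph {
  vset : {set 'I_n};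
  mult : 'M[nat]_n }.

Definition adj n (G : multigraph n) : rel 'I_n :=
  [rel x y | [&& x \in vset G, y \in vset G & 0 < mult G x y]].

(** [mult G x x] is counted twice, as self-loops contribute 2. *)
Definition deg n (G : multigraph n) (x : 'I_n) : nat :=
  \sum_(y in vset G) mult G x y + mult G x x.

Definition nb_edges n (G : multigraph n) (C : {set 'I_n}) : nat :=
  \sum_(x in C) \sum_(y in C | x <= y) mult G x y.

Definition components n (G : multigraph n) : {set {set 'I_n}} :=
  equivalence_partition (connect (adj G)) (vset G).

(** A cycle is a self-loop, a pair of parallel edges, or a closed walk through
    at least three distinct vertices; its length is at most [n]. *)
Definition has_cycle n (G : multigraph n) (C : {set 'I_n}) : bool :=
  [|| [exists x in C, 0 < mult G x x],
      [exists x in C, exists y in C, (x != y) && (1 < mult G x y)]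
    | [exists k : 'I_n.+1, exists c : k.-tuple 'I_n,
        [&& 2 < k, all [in C] c & ucycleb (adj G) c]]].

(** The next three predicates are meant for [C \in components G], so that
    [acyclic_comp] says that [C] is a tree. *)
Definition acyclic_comp n (G : multigraph n) (C : {set 'I_n}) : bool :=
  ~~ has_cycle G C.

Definition unicyclic_comp n (G : multigraph n) (C : {set 'I_n}) : bool :=
  nb_edges G C == #|C|.

Definition complex_comp n (G : multigraph n) (C : {set 'I_n}) : bool :=
  #|C| < nb_edges G C.

Definition nb_acyclic n (G : multigraph n) : nat :=
  #|[set C in components G | acyclic_comp G C]|.

Definition excess n (G : multigraph n) : int :=
  ((nb_edges G (vset G))%:Z + (nb_acyclic G)%:Z - #|vset G|%:Z)%R.

Definition in_unicyclic n (G : multigraph n) (x : 'I_n) : bool :=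
  [exists C in components G, unicyclic_comp G C && (x \in C)].

Definition complex_part n (G : multigraph n) : multigraph n :=
  Multigraph (\bigcup_(C in components G | complex_comp G C) C) (mult G).

Definition prune1 n (G : multigraph n) : multigraph n :=
  if [pick x in vset G | deg G x == 1] is Some x
  then Multigraph (vset G :\ x) (mult G) else G.

(** Removing [x], of degree 2 and without self-loop, and splicing its two edges:
    either they lead to distinct vertices [y], [z], which get one more edge
    between them, or both lead to the same vertex [y], which gets a self-loop. *)
Definition splice n (G : multigraph n) (x : 'I_n) : multigraph n :=
  Multigraph (vset G :\ x)
    (\matrix_(y, z) (mult G y z +
       (if y == z then mult G x y == 2
        else (mult G x y == 1) && (mult G x z == 1)))).

(** A vertex whose only edge is a self-loop also has degree 2, but it has no two
    edges to splice; this never happens inside the complex part. *)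
Definition splice1 n (G : multigraph n) : multigraph n :=
  if [pick x in vset G | (deg G x == 2) && (mult G x x == 0)] is Some x
  then splice G x else G.

(** Each effective step removes one vertex, so [n] iterations exhaust each of
    the two phases; the outcome does not depend on the vertices picked. *)
Definition reduced n (G : multigraph n) : multigraph n :=
  iter n (@splice1 n) (iter n (@prune1 n) (complex_part G)).

Definition clean n (G : multigraph n) : bool :=
  [forall x in vset (reduced G), deg (reduced G) x == 3].

(** A multigraph on the whole of ['I_n], with multiplicities at most [b]; the
    bound makes the type finite. *)
Definition graph_of n b (M : 'M['I_b.+1]_n) : multigraph n :=
  Multigraph [set: 'I_n] (map_mx (@nat_of_ord b.+1) M).

(** Without acyclic components, excess [r] means [n + r] edges, so that the
    bound [n + r] on the multiplicities excludes nothing. *)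
Definition clean_graphs (n r : nat) : {set 'M['I_(n + r).+1]_n} :=
  [set M | [&& M^T == M,
               clean (graph_of M),
               excess (graph_of M) == r%:Z
             & nb_acyclic (graph_of M) == 0%N]]%R.

Local Open Scope ring_scope.

Definition kappa n (G : multigraph n) : rat :=
  (\prod_(x < n) (2 ^ mult G x x * \prod_(y < n | x <= y) (mult G x y)`!))%N%:R^-1.

(** The law of [(M, (x, y))]: [M] has probability proportional to [kappa M] on
    [clean_graphs n r], and [(x, y)] is uniform and independent of [M]. *)
Definition law n r (w : 'M['I_(n + r).+1]_n * ('I_n * 'I_n)) : rat :=
  if w.1 \in clean_graphs n r then
    kappa (graph_of w.1) / (\sum_(M in clean_graphs n r) kappa (graph_of M))
    * ((n ^ 2)%:R)^-1
  else 0.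

Definition Pr n r (E : multigraph n -> 'I_n -> 'I_n -> bool) : rat :=
  \sum_(w : 'M['I_(n + r).+1]_n * ('I_n * 'I_n)
          | E (graph_of w.1) w.2.1 w.2.2) law w.

(* Main.v *)
From HB Require Import structures.
Require Import Defs.
From mathcomp Require Import all_boot all_order all_algebra.
From mathcomp Require Import zify ring lra.
Import Order.TTheory GRing.Theory Num.Theory.

(** Weigh multigraphs by [kappa] and fix the set [C] of the [2r] vertices of the
    cubic reduced multigraph.  A leafless clean multigraph is obtained from a
    cubic one on [C] by subdividing edges and adding cycles; counting the ways of
    inserting one vertex shows that its weight is a constant times
    [rising (3r) v * rising (1/2) u], for [v] further complex and [u] unicyclic
    vertices, i.e. that the generating functions are [X^2r / (1 - X)^3r] and
    [(1 - X)^(-1/2)].  Leaves are handled by inclusion-exclusion, which amounts to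
    the substitution of [X exp (-X)] for the variable: the generating functions
    [p1], [p2] of all clean multigraphs satisfy [p1 (X exp (-X)) = X^2r / (1 - X)^3r]
    and [p2 (X exp (-X)) = (1 - X)^(-1/2)].

    With [theta = X d/dX] and [K] the complement of the limiting probability, the
    claim says that the coefficient of [X^n] in
    [K theta^2 (p1 p2) - p1 theta^2 p2] is positive.  After the substitution
    [theta] becomes [X / (1 - X) d/dX] and the difference becomes
    [X^2r (1 - X)^(-3r - 7/2) (a + b X)] with [a > 0] and [b >= 0], whose
    coefficients are nonnegative; Lagrange inversion transports this positivity
    back to the coefficient of [X^n]. *)

Set Implicit Arguments.
Unset Strict Implicit.
Unset Printing Implicit Defensive.

Local Open Scope nat_scope.

(** * Degrees, components and edges *)

Section Graphs.
Variable n : nat.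
Implicit Types (G : multigraph n) (M : 'M[nat]_n) (A C S : {set 'I_n}).

(** The limiting value comes from two exponents. After the substitution, [theta^2] multiplies (1 -
    X)^(-a) by a factor behaving like a (a + 2) / (1 - X)^4 near 1, and a is 1/2 for the unicyclic
    part and 3r + 1/2 for the whole multigraph; K is the quotient (1/2)(5/2) / ((3r + 1/2)(3r +
    5/2)). The product form of the weights is not obtained by cutting multigraphs apart.
    Inclusion-exclusion gives a triangular system; [e] and [u] are taken as solutions of two systems
    in one variable, and their product solves the system in two variables. The remaining constant,
    the weight of the cubic multigraphs on [C], is never computed: for each [C] it multiplies the
    same sum, so it only has to be nonnegative, and positive for one [C]. Power series are
    polynomials modulo X^N, and fractional powers of 1 - X enter only through their coefficients and
    a first-order differential equation. Two features of the definitions shape the combinatorial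
    part: the reduction picks vertices in an unspecified order, whence the description by a 2-core,
    and entries outside [vset] are junk, whence matrices that vanish there. *)

Definition symmetric_mx M := forall x y, M x y = M y x.

(* By [dsum_edges], [dsum G x] is twice the number of edges in the component of
   [x], so unicyclic, complex and non-acyclic components are told apart by
   comparing [dsum] with twice the number of vertices. *)
Definition component G x := [set y | connect (adj G) x y].
Definition dsum G x := \sum_(y in component G x) deg G y.
Definition is_uni G x := dsum G x == 2 * #|component G x|.
Definition is_complex G x := 2 * #|component G x| < dsum G x.
Definition is_cyclic G x := 2 * #|component G x| <= dsum G x.

Lemma adj_sym G : symmetric_mx (mult G) -> symmetric (adj G).
Proof. by move=> sG x y; rewrite /adj /= sG; case: (x \in _); case: (y \in _). Qed.

Lemma connect_adjC G : symmetric_mx (mult G) -> connect_sym (adj G).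
Proof. by move=> sG; apply: sym_connect_sym; apply: adj_sym. Qed.

Lemma component_id G x : x \in component G x.
Proof. by rewrite inE connect0. Qed.

Lemma connect_vset G x y : x \in vset G -> connect (adj G) x y -> y \in vset G.
Proof.
move=> xG /connectP [p pP ->] {y}; elim: p x xG pP => //= y p IH x xG.
by case/andP=> /and3P [_ yG _]; apply: IH.
Qed.

Lemma connect_notin G x y : x \notin vset G -> connect (adj G) x y -> y = x.
Proof.
move=> xG /connectP [[|z p] //=]; case/andP=> /and3P [xG'].
by rewrite xG' in xG.
Qed.

Lemma component_sub G x : x \in vset G -> component G x \subset vset G.
Proof. by move=> xG; apply/subsetP=> y; rewrite inE; apply: connect_vset. Qed.

Lemma component_eq G x y : symmetric_mx (mult G) -> y \in component G x -> component G y = component G x.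
Proof.
move=> sG; rewrite inE => xy; apply/setP=> z; rewrite !inE.
by apply/esym; apply: (same_connect (connect_adjC sG)).
Qed.

Lemma eq_deg G1 G2 x : vset G1 = vset G2 -> x \in vset G1 ->
  {in vset G1 &, mult G1 =2 mult G2} -> deg G1 x = deg G2 x.
Proof.
move=> eV xG eM; rewrite /deg -eV eM //; congr (_ + _).
by apply: eq_bigr => y yG; rewrite eM.
Qed.

Lemma eq_adj G1 G2 : vset G1 = vset G2 ->
  {in vset G1 &, mult G1 =2 mult G2} -> adj G1 =2 adj G2.
Proof.
move=> eV eM x y; rewrite /adj /= -eV.
by case xG: (x \in _) => //=; case yG: (y \in _) => //=; rewrite eM.
Qed.

Section EqOn.
Variables G1 G2 : multigraph n.
Hypotheses (eV : vset G1 = vset G2) (eM : {in vset G1 &, mult G1 =2 mult G2}).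

Lemma eq_component x : component G1 x = component G2 x.
Proof. by apply/setP=> y; rewrite !inE (eq_connect (eq_adj eV eM)). Qed.

Lemma eq_dsum x : x \in vset G1 -> dsum G1 x = dsum G2 x.
Proof.
move=> xG; rewrite /dsum -eq_component; apply: eq_bigr => y yx.
by apply: eq_deg => //; apply: (subsetP (component_sub xG)).
Qed.

Lemma eq_is_uni x : x \in vset G1 -> is_uni G1 x = is_uni G2 x.
Proof. by move=> xG; rewrite /is_uni eq_component eq_dsum. Qed.

Lemma eq_is_complex x : x \in vset G1 -> is_complex G1 x = is_complex G2 x.
Proof. by move=> xG; rewrite /is_complex eq_component eq_dsum. Qed.

Lemma eq_is_cyclic x : x \in vset G1 -> is_cyclic G1 x = is_cyclic G2 x.
Proof. by move=> xG; rewrite /is_cyclic eq_component eq_dsum. Qed.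

End EqOn.

Lemma handshake C M : symmetric_mx M ->
  \sum_(x in C) deg (Multigraph C M) x = 2 * nb_edges (Multigraph C M) C.
Proof.
move=> sM; rewrite /deg /nb_edges /= big_split /= mul2n -addnn.
have -> : \sum_(x in C) \sum_(y in C) M x y =
  \sum_(x in C) \sum_(y in C | x <= y) M x y + \sum_(x in C) \sum_(y in C | y < x) M x y.
  rewrite -big_split /=; apply: eq_bigr => x xC.
  rewrite (bigID (fun y : 'I_n => x <= y)) /=; congr (_ + _).
  by apply: eq_bigl => y; rewrite ltnNge.
rewrite -addnA; congr (_ + _).
rewrite (exchange_big_dep (fun y => y \in C)) /=; last by move=> x y _ /andP [].
rewrite -big_split /=; apply: eq_bigr => x xC.
rewrite [in RHS](bigD1 x) /=; last by rewrite xC leqnn.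
rewrite addnC; congr (_ + _); apply: eq_big => [y|y _]; last by rewrite sM.
by rewrite xC /= -andbA; congr (_ && _); rewrite ltn_neqAle andbC eq_sym.
Qed.

Lemma deg_closed G S x : x \in S -> S \subset vset G ->
  (forall y, adj G x y -> y \in S) -> deg (Multigraph S (mult G)) x = deg G x.
Proof.
move=> xS sS cl; rewrite /deg /=; congr (_ + _).
rewrite [RHS](bigID (mem S)) /= [X in _ = _ + X]big1 ?addn0; last first.
  move=> y /andP [yG yS]; apply/eqP; rewrite eqn0Ngt; apply/negP=> xy.
  by move/negP: yS; apply; apply: cl; rewrite /adj /= (subsetP sS) // yG.
by apply: eq_bigl => y /=; case yS: (y \in S); rewrite ?andbF // andbT (subsetP sS _ yS).
Qed.

Lemma deg_component G x y : x \in vset G -> y \in component G x ->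
  deg (Multigraph (component G x) (mult G)) y = deg G y.
Proof.
move=> xG yx; apply: deg_closed => //; first exact: component_sub.
by move=> z yz; move: yx; rewrite !inE => xy; apply: connect_trans xy (connect1 yz).
Qed.

Lemma dsum_edges G x : symmetric_mx (mult G) -> x \in vset G ->
  dsum G x = 2 * nb_edges G (component G x).
Proof.
move=> sG xG; have := handshake (component G x) sG.
rewrite /dsum (eq_bigr (deg G)); first by move->.
by move=> y yx; rewrite deg_component.
Qed.

Lemma componentsP G C : symmetric_mx (mult G) ->
  reflect (exists2 x, x \in vset G & C = component G x) (C \in components G).
Proof.
move=> sG; apply: (iffP imsetP) => [[x xG ->]|[x xG ->]]; exists x => //;
  apply/setP=> y; rewrite !inE; case E: (connect _ x y); rewrite ?andbF ?andbT //;
  by rewrite ?(connect_vset xG E).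
Qed.

Lemma in_unicyclicE G x : symmetric_mx (mult G) ->
  in_unicyclic G x = (x \in vset G) && is_uni G x.
Proof.
move=> sG; apply/existsP/andP => [[C /andP [/(componentsP _ sG) [y yG ->]] /andP [u xy]]|[xG u]].
  have xG : x \in vset G by apply: (subsetP (component_sub yG)).
  by split => //; rewrite /is_uni dsum_edges // (component_eq sG xy) eqn_mul2l.
exists (component G x); rewrite component_id andbT; apply/andP; split.
  by apply/componentsP => //; exists x.
by move: u; rewrite /is_uni dsum_edges // eqn_mul2l.
Qed.

Lemma vset_complex_part G : symmetric_mx (mult G) ->
  vset (complex_part G) = [set x in vset G | is_complex G x].
Proof.
move=> sG; apply/setP=> x; rewrite !inE /=.
apply/bigcupP/andP => [[C /andP [/(componentsP _ sG) [y yG ->] u] xy]|[xG u]].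
  have xG : x \in vset G by apply: (subsetP (component_sub yG)).
  by split => //; rewrite /is_complex dsum_edges // (component_eq sG xy) ltn_mul2l.
exists (component G x); last exact: component_id; apply/andP; split.
  by apply/componentsP => //; exists x.
by move: u; rewrite /is_complex dsum_edges // ltn_mul2l.
Qed.

End Graphs.

(** * Retracting one vertex onto a vertex connected to it *)

Section Retraction.
Variable n : nat.
Implicit Types (G : multigraph n) (M : 'M[nat]_n) (A C S : {set 'I_n}).

Lemma homo_connect (T : finType) (e e' : rel T) (f : T -> T) :
  (forall a b, e a b -> connect e' (f a) (f b)) ->
  forall a b, connect e a b -> connect e' (f a) (f b).
Proof.
move=> H a b /connectP [p pP ->] {b}; elim: p a pP => [|c p IH] a /=.
  by rewrite connect0.
by case/andP=> ac /IH; apply: connect_trans; apply: H.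
Qed.

Definition retract (x y a : 'I_n) := if a == x then y else a.

(* [G'] is [G] without [x], every path through [x] being redirected to [y].  In
   the last lemmas [k = 1] when [x] is a leaf attached to [y], and [k = 0] when
   [x] subdivides an edge at [y]. *)
Variables (G G' : multigraph n) (x y : 'I_n).
Hypothesis adjW : forall a b, adj G' a b -> connect (adj G) a b.
Hypothesis adjR : forall a b, adj G a b ->
  connect (adj G') (retract x y a) (retract x y b).
Hypothesis conn_xy : connect (adj G) x y.
Hypothesis symM : symmetric_mx (mult G).
Hypothesis symM' : symmetric_mx (mult G').

Lemma connect_retract a b :
  connect (adj G) a b = connect (adj G') (retract x y a) (retract x y b).
Proof.
have cr c : connect (adj G) c (retract x y c).
  by rewrite /retract; case: eqP => [->|].
apply/idP/idP => [|H]; first exact: homo_connect.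
apply: connect_trans (cr a) _; rewrite (connect_adjC symM).
apply: connect_trans (cr b) _; rewrite (connect_adjC symM).
by apply: (homo_connect (f := id)) H.
Qed.

Hypothesis xG' : x \notin vset G'.
Hypothesis yG' : y \in vset G'.

Let xDy : y != x. Proof. by apply: contraNneq xG' => <-. Qed.

Lemma retract_neq a : retract x y a != x.
Proof. by rewrite /retract; case: ifP => [_|/negbT]. Qed.

Lemma retract_vset a : a \in x |: vset G' -> retract x y a \in vset G'.
Proof. by rewrite !inE /retract; case: eqP. Qed.

Lemma notin_component_retract a : x \notin component G' (retract x y a).
Proof.
rewrite inE (connect_adjC symM'); apply/negP=> H; have E := connect_notin xG' H.
by move: (retract_neq a); rewrite E => /eqP.
Qed.

Lemma component_retract a : component G a =
  if y \in component G' (retract x y a) then x |: component G' (retract x y a)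
  else component G' (retract x y a).
Proof.
have xN := notin_component_retract a.
apply/setP=> b; rewrite inE connect_retract.
case: ifP => yS; rewrite ?in_setU1; rewrite inE in yS;
  have [->|bx] := eqVneq b x; rewrite {2}/retract ?eqxx //= ?(negPf bx) ?inE //.
by rewrite yS; rewrite inE in xN; rewrite (negPf xN).
Qed.

Variable k : nat.
Hypothesis deg_x : deg G x + k = 2.
Hypothesis deg_retract : forall a, a \in vset G' -> deg G a = deg G' a + k * (a == y).

(** Degree sum minus twice the number of vertices is invariant, stated here without subtraction: a
    component that gains [x] gains [deg G x] there and [k] at [y], together 2, against one more
    vertex. The three status predicates depend on this difference only. *)
Lemma dsum_retract a : a \in x |: vset G' ->
  dsum G a + 2 * #|component G' (retract x y a)| = dsum G' (retract x y a) + 2 * #|component G a|.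
Proof.
move=> /retract_vset aG'; have xN := notin_component_retract a.
rewrite /dsum component_retract; set S := component G' _ in xN *.
have sS : S \subset vset G' by apply: component_sub.
have dS : \sum_(b in S) deg G b = \sum_(b in S) deg G' b + k * (y \in S).
  rewrite (eq_bigr (fun b => deg G' b + k * (b == y))); last first.
    by move=> b bS; apply: deg_retract; apply: (subsetP sS).
  rewrite big_split /=; congr (_ + _); rewrite -big_distrr /=; congr (_ * _).
  have [yS|yS] := boolP (y \in S).
    rewrite (bigD1 y) //= eqxx big1 ?addn0 // => b /andP [_ /negPf->] //.
  by rewrite big1 // => b bS; case: eqP => // E; rewrite -E bS in yS.
case: ifP => yS; rewrite yS ?muln1 ?muln0 in dS; last by rewrite dS addn0.
rewrite big_setU1 /= ?cardsU1 ?xN ?dS /=; last by [].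
by move: (\sum_(b in S) deg G' b) #|S| deg_x => p q; lia.
Qed.

Lemma is_uni_retract a : a \in x |: vset G' -> is_uni G a = is_uni G' (retract x y a).
Proof. by move=> /dsum_retract; rewrite /is_uni; lia. Qed.

Lemma is_complex_retract a : a \in x |: vset G' ->
  is_complex G a = is_complex G' (retract x y a).
Proof. by move=> /dsum_retract; rewrite /is_complex; lia. Qed.

Lemma is_cyclic_retract a : a \in x |: vset G' ->
  is_cyclic G a = is_cyclic G' (retract x y a).
Proof. by move=> /dsum_retract; rewrite /is_cyclic; lia. Qed.

End Retraction.

(** * Adding edges and vertices *)

Section EdgeOps.
Variable n : nat.
Implicit Types (G : multigraph n) (M : 'M[nat]_n) (A C S : {set 'I_n}).

(** Entries outside the vertex set are junk in a [multigraph]. Setting them to 0 gives each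
    multigraph on [S] exactly one matrix, as counting requires. *)
Definition restrict S M : 'M[nat]_n :=
  \matrix_(a, b) if (a \in S) && (b \in S) then M a b else 0.

(** Added as 0 or 1, so for [y = z] the diagonal entry rises by one only, in agreement with
    [mult x x] counting each self-loop once. *)
Definition is_edge (y z a b : 'I_n) := (a == y) && (b == z) || (a == z) && (b == y).

Definition add_edge M y z : 'M[nat]_n := \matrix_(a, b) (M a b + is_edge y z a b).

Definition supported S M := [forall a, forall b, (M a b != 0) ==> (a \in S) && (b \in S)].

Lemma supportedP S M :
  reflect (forall a b, ~~ ((a \in S) && (b \in S)) -> M a b = 0) (supported S M).
Proof.
apply: (iffP forallP) => [H a b | H a].
  move/forallP/(_ b): (H a) => /implyP H' /negP N; apply/eqP/negPn/negP.
  by move=> /H'.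
by apply/forallP=> b; apply/implyP; apply: contra_neqT => /H.
Qed.

Lemma supported_restrict S M : supported S (restrict S M).
Proof. by apply/supportedP=> a b /negPf N; rewrite mxE N. Qed.

Lemma restrict_id S M : supported S M -> restrict S M = M.
Proof.
by move=> /supportedP sM; apply/matrixP=> a b; rewrite mxE; case: ifP => // /negbT /sM ->.
Qed.

Lemma restrict_sym S M : symmetric_mx M -> symmetric_mx (restrict S M).
Proof. by move=> sM a b; rewrite !mxE andbC sM. Qed.

Lemma is_edgeC y z a b : is_edge y z a b = is_edge z y a b.
Proof. by rewrite /is_edge orbC. Qed.

Lemma is_edge_sym y z a b : is_edge y z a b = is_edge y z b a.
Proof. by rewrite /is_edge orbC; congr (_ || _); rewrite andbC. Qed.

Lemma add_edge_sym M y z : symmetric_mx M -> symmetric_mx (add_edge M y z).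
Proof. by move=> sM a b; rewrite !mxE sM is_edge_sym. Qed.

Lemma add_edgeC M y z : add_edge M y z = add_edge M z y.
Proof. by apply/matrixP=> a b; rewrite !mxE is_edgeC. Qed.

Lemma supported_add_edge S M y z : y \in S -> z \in S -> supported S M ->
  supported S (add_edge M y z).
Proof.
move=> yS zS /supportedP sM; apply/supportedP=> a b N; rewrite mxE sM //.
case E: (is_edge y z a b) => //.
by case/orP: E => /andP [/eqP E1 /eqP E2]; rewrite E1 E2 yS zS in N.
Qed.

Lemma supportedS S (T : {set 'I_n}) M : S \subset T -> supported S M -> supported T M.
Proof.
move=> /subsetP sST /supportedP sM; apply/supportedP=> a b N; apply: sM.
by apply: contra N => /andP [/sST-> /sST].
Qed.

Lemma restrict_add_edge S M x y : x \notin S -> supported S M ->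
  restrict S (add_edge M x y) = M.
Proof.
move=> xS sM; rewrite -[RHS](restrict_id sM); apply/matrixP=> a b; rewrite !mxE.
case: ifP => // /andP [aS bS]; case E: (is_edge x y a b); rewrite ?addn0 //.
by case/orP: E => /andP [/eqP E1 /eqP E2]; move: xS; rewrite -?E1 -?E2 ?aS ?bS.
Qed.

Lemma deg_add_edge S M y z c : y \in S -> z \in S -> c \in S ->
  deg (Multigraph S (add_edge M y z)) c = deg (Multigraph S M) c + (c == y) + (c == z).
Proof.
move=> yS zS cS; rewrite /deg /= (eq_bigr (fun d => M c d + is_edge y z c d)); last first.
  by move=> d _; rewrite mxE.
rewrite big_split /= mxE.
have -> : \sum_(d in S) is_edge y z c d =
    (c == y) + (c == z) - ((c == y) && (c == z)).
  have [cy|cy] := eqVneq c y; have [cz|cz] := eqVneq c z; rewrite /is_edge ?cy ?cz ?eqxx /=.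
  - rewrite cy in cz; rewrite cz; subst; rewrite (bigD1 z) //= eqxx big1 // => d /andP [_ /negPf->].
    by rewrite ?andbF.
  - rewrite (bigD1 z) //= eqxx big1 // => d /andP [_ /negPf->].
    by rewrite -cy (negPf cz).
  - rewrite (bigD1 y) //= -cz (negPf cy) eqxx big1 // => d /andP [_ /negPf->].
    by rewrite ?andbF.
  - by rewrite (negPf cy) (negPf cz) big1.
rewrite /is_edge; case: (c == y); case: (c == z); lia.
Qed.

Section NewVertex.
Variables (A : {set 'I_n}) (M : 'M[nat]_n) (x : 'I_n).
Hypotheses (xA : x \notin A) (sM : supported A M).

Lemma supported_row b : M x b = 0.
Proof. by apply: (supportedP _ _ sM); rewrite (negPf xA). Qed.

Lemma supported_col b : M b x = 0.
Proof. by apply: (supportedP _ _ sM); rewrite (negPf xA) andbF. Qed.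

Lemma deg_setU1 c : deg (Multigraph (x |: A) M) c = deg (Multigraph A M) c.
Proof. by rewrite /deg /= big_setU1 //= supported_col. Qed.

Lemma deg_new : deg (Multigraph A M) x = 0.
Proof. by rewrite /deg /= supported_row big1 // => b _; rewrite supported_row. Qed.

Lemma adj_setU1 a b : adj (Multigraph (x |: A) M) a b = adj (Multigraph A M) a b.
Proof.
rewrite /adj /= !inE; case: (posnP (M a b)) => [_|H]; rewrite ?andbF // !andbT.
have ax : a != x by apply: contraTneq H => ->; rewrite supported_row.
have bx : b != x by apply: contraTneq H => ->; rewrite supported_col.
by rewrite (negPf ax) (negPf bx).
Qed.

End NewVertex.

Lemma adj_add_edge A M y z a b : y \in A -> z \in A ->
  adj (Multigraph A (add_edge M y z)) a b = adj (Multigraph A M) a b || is_edge y z a b.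
Proof.
move=> yA zA; rewrite /adj /= mxE addn_gt0 lt0b.
case E: (is_edge y z a b); rewrite ?orbF // !orbT !andbT.
by case/orP: E => /andP [/eqP-> /eqP->]; rewrite yA zA.
Qed.

End EdgeOps.

(** * Attaching a leaf, subdividing an edge, adding an isolated self-loop *)

Section Surgery.
Variable n : nat.
Implicit Types (G : multigraph n) (M : 'M[nat]_n) (A C S : {set 'I_n}).

Variant same_status G G' x y a : Prop :=
  SameStatus of is_uni G a = is_uni G' (retract x y a)
    & is_complex G a = is_complex G' (retract x y a)
    & is_cyclic G a = is_cyclic G' (retract x y a).

Section Vertex.
Variables (A : {set 'I_n}) (M : 'M[nat]_n) (x : 'I_n).
Hypotheses (xA : x \notin A) (sM : supported A M) (symM : symmetric_mx M).

Let x_neq b : b \in A -> (b == x) = false.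
Proof. by apply: contraTF => /eqP->. Qed.

Let sM' : supported (x |: A) M.
Proof. by apply: supportedS sM; apply: subsetUr. Qed.

Let xA' : x \in x |: A. Proof. exact: setU11. Qed.

Section Leaf.
Variable y : 'I_n.
Hypothesis yA : y \in A.
Let G := Multigraph (x |: A) (add_edge M x y).
Let G' := Multigraph A M.

Let yA' : y \in x |: A. Proof. exact: setU1r. Qed.

Lemma deg_leaf c : c \in A -> deg G c = deg G' c + (c == y).
Proof.
move=> cA; rewrite /G deg_add_edge ?setU11 ?setU1r // deg_setU1 //.
by rewrite x_neq // addn0.
Qed.

Lemma deg_leaf_new : deg G x = 1.
Proof.
rewrite /G deg_add_edge ?setU11 ?setU1r // deg_setU1 // deg_new //.
by rewrite eqxx eq_sym x_neq.
Qed.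

Let aW a b : adj G' a b -> connect (adj G) a b.
Proof. by move=> ab; apply: connect1; rewrite adj_add_edge ?setU11 // adj_setU1 ?ab. Qed.

Let aR a b : adj G a b -> connect (adj G') (retract x y a) (retract x y b).
Proof.
rewrite adj_add_edge ?setU11 // adj_setU1 // => /orP [ab|].
  have [aA bA] : a \in A /\ b \in A by case/and3P: ab.
  by rewrite /retract !x_neq // connect1.
by case/orP=> /andP [/eqP-> /eqP->]; rewrite /retract eqxx x_neq // connect0.
Qed.

Let cxy : connect (adj G) x y.
Proof. by apply: connect1; rewrite adj_add_edge ?setU11 // /is_edge !eqxx orbT. Qed.

Let sG : symmetric_mx (mult G). Proof. exact: add_edge_sym. Qed.

Lemma component_leaf a : component G a =
  if y \in component G' (retract x y a) then x |: component G' (retract x y a)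
  else component G' (retract x y a).
Proof. exact: (component_retract aW aR cxy sG symM xA yA). Qed.

Lemma leaf_status a : a \in x |: A -> same_status G G' x y a.
Proof.
have d1 : deg G x + 1 = 2 by rewrite deg_leaf_new.
have d2 c : c \in vset G' -> deg G c = deg G' c + 1 * (c == y).
  by rewrite mul1n; apply: deg_leaf.
move=> aA; split.
- exact: (is_uni_retract aW aR cxy sG symM xA yA d1 d2 aA).
- exact: (is_complex_retract aW aR cxy sG symM xA yA d1 d2 aA).
- exact: (is_cyclic_retract aW aR cxy sG symM xA yA d1 d2 aA).
Qed.

End Leaf.

Section Splice.
Variables y z : 'I_n.
Hypotheses (yA : y \in A) (zA : z \in A).
Let G := Multigraph (x |: A) (add_edge (add_edge M x y) x z).
Let G' := Multigraph A (add_edge M y z).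

Let yA' : y \in x |: A. Proof. exact: setU1r. Qed.
Let zA' : z \in x |: A. Proof. exact: setU1r. Qed.

Lemma deg_subdivide c : c \in A -> deg G c = deg G' c.
Proof.
move=> cA; rewrite /G /G' !deg_add_edge ?setU11 ?setU1r // deg_setU1 //.
by rewrite x_neq // !addn0.
Qed.

Lemma deg_subdivide_new : deg G x = 2.
Proof.
rewrite /G !deg_add_edge ?setU11 ?setU1r // deg_setU1 // deg_new //.
by rewrite eqxx ![x == _]eq_sym !x_neq.
Qed.

(** The case [y = z] is included: a self-loop at [y] is then subdivided into a double edge.
    Retracting [x] to [y] turns the edge from [x] to [z] into the edge from [y] to [z]. *)
Lemma subdivide_status a : a \in x |: A -> same_status G G' x y a.
Proof.
have adjG b c : adj G b c = [|| adj (Multigraph A M) b c, is_edge x y b c | is_edge x z b c].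
  by rewrite !adj_add_edge ?setU11 // adj_setU1 // orbA.
have adjG' b c : adj G' b c = adj (Multigraph A M) b c || is_edge y z b c.
  by rewrite adj_add_edge.
have sG : symmetric_mx (mult G) by do 2!apply: add_edge_sym.
have sG' : symmetric_mx (mult G') by apply: add_edge_sym.
have cxy : connect (adj G) x y.
  by apply: connect1; rewrite adjG /is_edge !eqxx /= orbT.
have cxz : connect (adj G) x z.
  by apply: connect1; rewrite adjG /is_edge !eqxx /= !orbT.
have cyz : connect (adj G') y z.
  by apply: connect1; rewrite adjG' /is_edge !eqxx /= orbT.
have aW : forall a b, adj G' a b -> connect (adj G) a b.
  move=> c d; rewrite adjG' => /orP [cd|]; first by apply: connect1; rewrite adjG cd.
  case/orP=> /andP [/eqP-> /eqP->].
    by rewrite (connect_trans _ cxz) // (connect_adjC sG).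
  by rewrite (connect_trans _ cxy) // (connect_adjC sG).
have aR : forall a b, adj G a b -> connect (adj G') (retract x y a) (retract x y b).
  move=> c d; rewrite adjG => /or3P [cd||].
  - have [cA dA] : c \in A /\ d \in A by case/and3P: cd.
    by rewrite /retract !x_neq // connect1 // adjG' cd.
  - by case/orP=> /andP [/eqP-> /eqP->]; rewrite /retract eqxx x_neq // connect0.
  case/orP=> /andP [/eqP-> /eqP->]; rewrite /retract eqxx x_neq //.
  by rewrite (connect_adjC sG').
have d1 : deg G x + 0 = 2 by rewrite deg_subdivide_new.
have d2 c : c \in vset G' -> deg G c = deg G' c + 0 * (c == y).
  by rewrite mul0n addn0; apply: deg_subdivide.
move=> aA; split.
- exact: (is_uni_retract aW aR cxy sG sG' xA yA d1 d2 aA).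
- exact: (is_complex_retract aW aR cxy sG sG' xA yA d1 d2 aA).
- exact: (is_cyclic_retract aW aR cxy sG sG' xA yA d1 d2 aA).
Qed.

End Splice.

Section Loop.
Let G := Multigraph (x |: A) (add_edge M x x).
Let G' := Multigraph A M.

Lemma deg_loop c : c \in A -> deg G c = deg G' c.
Proof.
move=> cA; rewrite /G deg_add_edge ?setU11 ?setU1r // deg_setU1 //.
by rewrite x_neq // !addn0.
Qed.

Lemma deg_loop_new : deg G x = 2.
Proof.
rewrite /G deg_add_edge ?setU11 ?setU1r // deg_setU1 // deg_new //.
by rewrite eqxx.
Qed.

Let adjG b c : adj G b c = adj G' b c || is_edge x x b c.
Proof. by rewrite adj_add_edge ?setU11 // adj_setU1. Qed.

Let component_loop a : component G a = component G' a.
Proof.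
apply/setP=> b; rewrite !inE; apply/idP/idP.
  apply: (homo_connect (f := id)) => c d; rewrite adjG => /orP [|].
    exact: connect1.
  by case/orP=> /andP [/eqP-> /eqP->]; exact: connect0.
by apply: (homo_connect (f := id)) => c d cd; apply: connect1; rewrite adjG cd.
Qed.

Lemma is_uni_loop_new : is_uni G x.
Proof.
rewrite /is_uni /dsum component_loop (_ : component G' x = [set x]).
  by rewrite big_set1 cards1 deg_loop_new.
by apply/setP=> b; rewrite !inE; apply/idP/eqP=> [/(connect_notin (G := G') xA)|->].
Qed.

Let dsum_loop a : a \in A -> dsum G a = dsum G' a.
Proof.
move=> aA; rewrite /dsum component_loop; apply: eq_bigr => b ba.
exact/deg_loop/(subsetP (component_sub (G := G') aA)).
Qed.

Lemma is_uni_loop a : a \in A -> is_uni G a = is_uni G' a.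
Proof. by move=> aA; rewrite /is_uni component_loop dsum_loop. Qed.

End Loop.
End Vertex.

(** Takes one edge off a row of multiplicities: once for a leaf, twice for a vertex of degree 2. *)
Lemma sum_nat_pos A (f : 'I_n -> nat) k : \sum_(b in A) f b = k.+1 ->
  exists2 y, y \in A & exists2 g : 'I_n -> nat,
    forall b, f b = g b + (b == y) & \sum_(b in A) g b = k.
Proof.
move=> fk; have [y yA fy] : exists2 y, y \in A & 0 < f y.
  apply/exists_inP; apply: contraT; rewrite negb_exists_in => /forall_inP H.
  by move: fk; rewrite big1 // => b /H; case: (f b).
exists y => //; exists (fun b => f b - (b == y)).
  by move=> b; case: eqP => [->|_]; lia.
have : \sum_(b in A) f b = \sum_(b in A) (f b - (b == y)) + 1.
  rewrite (bigD1 y) //= [X in _ = X + _](bigD1 y) //= eqxx -addnA [_ + 1]addnC addnA.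
  rewrite subnK //; congr (_ + _); apply: eq_bigr => b /andP [_ /negPf->].
  by rewrite subn0.
by rewrite fk addn1 => /eqP; rewrite eqSS => /eqP.
Qed.

Section Split.
Variables (A : {set 'I_n}) (M : 'M[nat]_n) (x : 'I_n).
Hypotheses (xA : x \in A) (sM : supported A M) (symM : symmetric_mx M).
Let M0 := restrict (A :\ x) M.

Lemma row_determined M1 M2 : symmetric_mx M1 -> symmetric_mx M2 ->
  supported A M1 -> supported A M2 ->
  restrict (A :\ x) M1 = restrict (A :\ x) M2 -> {in A, M1 x =1 M2 x} -> M1 = M2.
Proof.
move=> s1 s2 /supportedP p1 /supportedP p2 /matrixP E R; apply/matrixP=> a b.
have [/andP [aA bA]|N] := boolP ((a \in A) && (b \in A)); last by rewrite p1 // p2.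
have [->|ax] := eqVneq a x; first exact: R.
have [->|bx] := eqVneq b x; first by rewrite s1 s2; apply: R.
by have := E a b; rewrite !mxE !inE ax bx aA bA.
Qed.

Let restrict_add M1 y : restrict (A :\ x) (add_edge M1 x y) = restrict (A :\ x) M1.
Proof.
apply/matrixP=> a b; rewrite !mxE !inE; case: ifP => // /andP [/andP [ax _] /andP [bx _]].
by rewrite /is_edge (negPf ax) (negPf bx) andbF addn0.
Qed.

Let sM0 : supported A M0.
Proof. by apply: supportedS (supported_restrict _ _); apply: subsetDl. Qed.

Let symM0 : symmetric_mx M0. Proof. exact: restrict_sym. Qed.

Let restrictM0 : restrict (A :\ x) M0 = restrict (A :\ x) M.
Proof. by apply: restrict_id; apply: supported_restrict. Qed.

Let M0x b : M0 x b = 0. Proof. by rewrite mxE !inE eqxx. Qed.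

Lemma leafP : deg (Multigraph A M) x = 1 ->
  exists2 y, y \in A :\ x & M = add_edge M0 x y.
Proof.
rewrite /deg /= => dx.
have Mxx : M x x = 0.
  by move: dx; rewrite (bigD1 x) //=; move: (\sum_(i in A | i != x) _) (M x x) => p q; lia.
move: dx; rewrite Mxx addn0 => /sum_nat_pos [y yA [g gE /eqP]].
rewrite sum_nat_eq0 => /forall_inP g0.
have yx : y != x by apply: contra_eqN Mxx => /eqP E; rewrite gE E eqxx addn1.
have yA' : y \in A :\ x by rewrite !inE yx.
exists y => //; apply: row_determined => //.
- exact: add_edge_sym.
- by apply: supported_add_edge => //.
- by rewrite restrict_add.
move=> b bA; rewrite mxE M0x gE (eqP (g0 b bA)) /is_edge eqxx [x == y]eq_sym (negPf yx).
by rewrite /= orbF.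
Qed.

(** A self-loop uses up the whole degree. Otherwise two edges leave [x], and [y = z] when they are
    parallel. *)
Lemma deg2P : deg (Multigraph A M) x = 2 ->
  if M x x == 0 then
    exists y z, [/\ y \in A :\ x, z \in A :\ x & M = add_edge (add_edge M0 x y) x z]
  else M = add_edge M0 x x.
Proof.
rewrite /deg /= => dx.
have [Mxx|Mxx] := eqVneq (M x x) 0; last first.
  have Mxx1 : M x x = 1 by move: dx Mxx; rewrite (bigD1 x) //=; move: (\sum_(i in A | i != x) _) (M x x) => p q; lia.
  move: dx; rewrite (bigD1 x) //= Mxx1 => d0.
  have {}d0 : \sum_(i in A | i != x) M x i = 0 by apply/eqP; rewrite -(eqn_add2l 1) -(eqn_add2r 1) d0.
  apply: row_determined => //; [exact: add_edge_sym|exact: supported_add_edge| |].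
    by rewrite restrict_add.
  move=> b bA; rewrite mxE M0x /is_edge eqxx /= orbb.
  have [->|bx] := eqVneq b x; first by rewrite Mxx1.
  move/eqP: d0; rewrite sum_nat_eq0 => /forallP /(_ b) /implyP /(_ _) /eqP-> //.
  by rewrite bA.
move: dx; rewrite Mxx addn0 => /sum_nat_pos [y yA [g gE]].
case/sum_nat_pos=> z zA [h hE /eqP]; rewrite sum_nat_eq0 => /forall_inP h0.
have gx : g x = 0 by move: Mxx; rewrite gE; lia.
have yx : y != x by apply: contra_eqN Mxx => /eqP E; rewrite gE E eqxx addn1.
have zx : z != x by apply: contra_eqN gx => /eqP E; rewrite hE E eqxx addn1.
exists y, z; split; rewrite ?inE ?yx ?zx //; apply: row_determined => //.
- by do 2!apply: add_edge_sym.
- by do 2!apply: supported_add_edge => //.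
- by rewrite !restrict_add.
move=> b bA; rewrite !mxE !inE eqxx /= gE hE (eqP (h0 b bA)) /is_edge eqxx.
rewrite ![x == _]eq_sym (negPf yx) (negPf zx) /= !orbF; lia.
Qed.

End Split.
End Surgery.

(** * Cycles and acyclic components *)

Section Cycles.
Variable n : nat.
Implicit Types (G : multigraph n) (M : 'M[nat]_n) (A C S : {set 'I_n}).

Lemma deg_pos_adj G x b : b \in vset G -> mult G x b <= deg G x.
Proof. by move=> bG; rewrite /deg (bigD1 b) //= -addnA leq_addr. Qed.

Lemma deg_two_neighbours G x a b : a \in vset G -> b \in vset G -> a != b ->
  mult G x a + mult G x b <= deg G x.
Proof.
move=> aG bG ab; rewrite /deg (bigD1 a) //= (bigD1 b) /=; last by rewrite bG eq_sym.
by rewrite addnA -addnA leq_addr.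
Qed.

Lemma deg_loop_le G x : x \in vset G -> 2 * mult G x x <= deg G x.
Proof. by move=> xG; rewrite /deg (bigD1 x) //=; lia. Qed.

Lemma has_cycle_sub G S (T : {set 'I_n}) : S \subset T -> has_cycle G S -> has_cycle G T.
Proof.
move=> /subsetP sST /or3P [/exists_inP [x xS Mx]|/exists_inP [x xS /exists_inP [y yS xy]]|].
- by apply/or3P/Or31/exists_inP; exists x => //; apply: sST.
- apply/or3P/Or32/exists_inP; exists x; first exact: sST.
  by apply/exists_inP; exists y => //; apply: sST.
move=> /existsP [k /existsP [c /and3P [k2 /allP cS uc]]].
apply/or3P/Or33/existsP; exists k; apply/existsP; exists c; rewrite k2 uc andbT /=.
by apply/allP=> x /cS /sST.
Qed.

Lemma eq_has_cycle G G' S : S \subset vset G -> S \subset vset G' ->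
  {in S &, mult G =2 mult G'} -> has_cycle G S -> has_cycle G' S.
Proof.
move=> /subsetP sG /subsetP sG' eM.
case/or3P=> [/exists_inP [x xS Mx]|/exists_inP [x xS /exists_inP [y yS xy]]|].
- by apply/or3P/Or31/exists_inP; exists x => //; rewrite -eM.
- apply/or3P/Or32/exists_inP; exists x => //.
  by apply/exists_inP; exists y => //; rewrite -eM.
move=> /existsP [k /existsP [c /and3P [k2 cS uc]]].
apply/or3P/Or33/existsP; exists k; apply/existsP; exists c; rewrite k2 cS /=.
move: uc; rewrite /ucycleb; case: (uniq c); rewrite ?andbF // !andbT.
rewrite (eq_in_cycle (P := [in S]) (e' := adj G')) //.
by move=> x y xS yS; rewrite /adj /= !sG ?sG' // eM.
Qed.

(** A cycle needs degree 2 at each of its vertices: a self-loop counts twice, parallel edges count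
    separately, and in a longer cycle rotated to start at [x] the second and the last vertex are
    distinct neighbours. So no cycle meets [x]. *)
Lemma has_cycle_leaf G S x : symmetric_mx (mult G) -> S \subset vset G -> x \in vset G ->
  deg G x <= 1 -> has_cycle G S -> has_cycle G (S :\ x).
Proof.
move=> sM /subsetP sS xG dx.
case/or3P=> [/exists_inP [y yS My]|/exists_inP [y yS /exists_inP [z zS /andP [yz Myz]]]|].
- apply/or3P/Or31/exists_inP; exists y => //; rewrite !inE yS andbT.
  by apply: contraTneq My => ->; have := deg_loop_le xG; lia.
- have yx : y != x.
    apply: contraTneq Myz => E; rewrite E.
    by have := deg_pos_adj x (sS _ zS); lia.
  have zx : z != x.
    apply: contraTneq Myz => E; rewrite E sM.
    by have := deg_pos_adj x (sS _ yS); lia.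
  apply/or3P/Or32/exists_inP; exists y; first by rewrite !inE yx.
  by apply/exists_inP; exists z; rewrite ?inE ?zx // yz.
move=> /existsP [k /existsP [c /and3P [k2 cS /andP [cc uc]]]].
apply/or3P/Or33/existsP; exists k; apply/existsP; exists c; rewrite k2 /ucycleb cc uc !andbT /=.
apply/allP=> y yc; rewrite !inE (allP cS _ yc) andbT; apply: contraTneq yc => -> {y}.
apply/negP=> xc; case: (rot_to xc) => i s E.
have := rot_uniq i c; rewrite E uc => us.
have : cycle (adj G) (x :: s) by rewrite -E rot_cycle.
have ss : 1 < size s by have := size_rot i c; rewrite E size_tuple /=; lia.
case/lastP: s ss us {E} => [|s b] //; rewrite size_rcons => ss us.
rewrite /= rcons_path last_rcons => /andP [sp /and3P [bG _ bx]].
case: s ss us sp => [|a s] //= _ /and3P [_ asb _] /andP [/and3P [_ aG xa] _].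
have ab : a != b by apply: contraNneq asb => ->; rewrite mem_rcons inE eqxx.
by have := deg_two_neighbours x aG bG ab; rewrite [_ x b]sM; lia.
Qed.

(** Without self-loops and parallel edges, degree at least 2 provides at each vertex a neighbour
    other than the one just visited. A path is prolonged at its head in this way until it meets
    itself, which must happen as there are only [n] vertices. *)
Lemma has_cycle_min_deg G S : symmetric_mx (mult G) -> S \subset vset G -> S != set0 ->
  (forall a b, a \in S -> adj G a b -> b \in S) ->
  (forall a, a \in S -> 1 < deg G a) -> has_cycle G S.
Proof.
move=> sM sS S0 clS d2; apply: contraT => /norP [/exists_inPn noloop /norP [nomulti nocyc]].
have M1 a b : a \in S -> mult G a b <= 1 \/ b \notin S.
  move=> aS; have [bS|] := boolP (b \in S); last by right.
  left; have [<-|ab] := eqVneq a b; first by move: (noloop a aS); rewrite -leqNgt; lia.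
  move/exists_inPn/(_ a aS)/exists_inPn/(_ b bS): nomulti.
  by rewrite ab -leqNgt.
have nb a y : a \in S -> exists b, [/\ adj G a b, b != a & b != y].
  move=> aS; have aG := subsetP sS _ aS.
  have [/exists_inP [b bG /and3P [ab ba by']]|] :=
    boolP [exists b in vset G, [&& 0 < mult G a b, b != a & b != y]].
    by exists b; split=> //; rewrite /adj /= aG bG.
  rewrite negb_exists_in => /forall_inP H; have := d2 a aS.
  have Maa : mult G a a = 0 by move: (noloop a aS); lia.
  rewrite /deg Maa addn0 (eq_bigr (fun b => (b == y) * mult G a y)); last first.
    move=> b /H; have [->|ba] := eqVneq b a.
      by rewrite Maa; case: eqP => // <-; rewrite Maa.
    case: eqP => [->|by']; rewrite ?mul1n //= ?andbT; lia.
  have [yG|yG] := boolP (y \in vset G); last first.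
    rewrite big1 // => b bG; case: eqP => // E; by rewrite -E bG in yG.
  rewrite (bigD1 y) //= eqxx mul1n big1 ?addn0; last by move=> b /andP [_ /negPf->].
  move=> May; have ay : adj G a y by rewrite /adj /= aG yG; lia.
  by case: (M1 a y aS) May => [|/negP []]; [lia | exact: clS ay].
(* [m] counts the prolongations still to be made; at 0 the path would have more than [n] distinct
   vertices. *)
suff : forall m x p, path (adj G) x p -> uniq (x :: p) -> all [in S] (x :: p) ->
    n < m + size (x :: p) -> False.
  case/set0Pn: S0 => x xS; move=> /(_ n x [::]) /=; rewrite xS addn1 ltnSn.
  by move=> /(_ isT isT isT isT).
elim=> [|m IH] x p xp up pS.
  rewrite add0n ltnNge; have := max_card (mem (x :: p)).
  by rewrite card_ord (card_uniqP up) => ->.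
move=> sz; have xS : x \in S by case/andP: pS.
have [b [xb bx bp]] := nb x (head x p) xS.
have [bp'|bp'] := boolP (b \in p); last first.
  apply: (IH b (x :: p)); rewrite /= ?(inE, negb_or) ?bx ?bp' //.
  - by rewrite (adj_sym sM) xb.
  - by rewrite (clS x b).
  - by move: sz; rewrite /= addSnnS.
(* [b] is not the head of [p], so at least [c] lies between [x] and [b] and the cycle has length at
   least 3. *)
case/splitPr: bp' xp up pS bp {sz} => [[|c p1] p2] /=; first by rewrite eqxx.
rewrite -cat_rcons; set q := rcons p1 b.
move=> /andP [xc cp] /and3P [xq cq uq] /and3P [xS' cS qS] _.
have us : uniq [:: x, c & q].
  rewrite /= in_cons negb_or; move: xq cq uq; rewrite !inE !mem_cat !negb_or cat_uniq.
  by move=> /and3P [-> -> _] /andP [-> _] /and3P [-> _].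
move/negP: nocyc; apply.
have sk : size [:: x, c & q] < n.+1.
  by have := max_card (mem [:: x, c & q]); rewrite card_ord (card_uniqP us) ltnS.
apply/existsP; exists (Ordinal sk); apply/existsP; exists (in_tuple [:: x, c & q]).
rewrite /= size_rcons /= xS' cS /ucycleb us andbT /=.
move: cp qS; rewrite cat_path all_cat => /andP [cp _] /andP [-> _] /=.
by rewrite xc rcons_path cp /q last_rcons; move: xb; rewrite (adj_sym sM).
Qed.

Lemma is_cyclic_deg G x : x \in vset G -> is_cyclic G x -> 0 < deg G x.
Proof.
move=> xG; apply: contraTltn; rewrite leqn0 => /eqP dx.
have C1 : component G x = [set x].
  apply/setP=> y; rewrite !inE; apply/idP/eqP=> [/connectP [[|z p] //=]|->]; last exact: connect0.
  move=> /andP [/and3P [_ zG xz] _].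
  by have := deg_pos_adj x zG; rewrite dx leqNgt xz.
by rewrite /is_cyclic /dsum C1 big_set1 cards1 dx.
Qed.

(* A component is a tree exactly when it has fewer edges than vertices: pruning
   leaves changes neither side, and without leaves all degrees are at least 2
   unless the component is a single vertex. *)
Lemma has_cycle_supported A M x : symmetric_mx M -> supported A M -> x \in A ->
  has_cycle (Multigraph A M) (component (Multigraph A M) x) = is_cyclic (Multigraph A M) x.
Proof.
move En: #|A| => m; elim: m A M x En => [|m IH] A M x An sM pM xA.
  by rewrite (cards0_eq An) inE in xA.
have [/exists_inP [l lA /eqP dl]|noleaf] := boolP [exists l in A, deg (Multigraph A M) l == 1].
  have [y yA eM] := leafP lA pM sM dl.
  have lA' : l \notin A :\ l by rewrite !inE eqxx.
  have pM0 := supported_restrict (A :\ l) M.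
  have sM0 : symmetric_mx (restrict (A :\ l) M) by apply: restrict_sym.
  have xA' : x \in l |: (A :\ l) by rewrite setD1K.
  have := leaf_status lA' pM0 sM0 yA xA'.
  have cE := component_leaf lA' pM0 sM0 yA x.
  rewrite -eM setD1K // in cE *; case=> _ _ ->.
  have rA : retract l y x \in A :\ l by apply: (@retract_vset _ (Multigraph (A :\ l) M)).
  rewrite -IH //; last by move: An; rewrite (cardsD1 l) lA => [[]].
  set G' := Multigraph (A :\ l) _ in cE *; set C := component G' _ in cE *.
  have CA' : C \subset A :\ l by apply: (component_sub (G := G')).
  have lC : l \notin C by apply/negP=> /(subsetP CA'); rewrite !inE eqxx.
  have CA : C \subset A by apply: subset_trans CA' (subsetDl _ _).
  have cMA : component (Multigraph A M) x \subset A by apply: (component_sub (G := Multigraph A M)).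
  have eq0 : {in C &, M =2 restrict (A :\ l) M}.
    by move=> a b aC bC; rewrite mxE !(subsetP CA').
  apply/idP/idP.
    move=> /(@has_cycle_leaf (Multigraph A M) _ l sM cMA lA); rewrite dl => /(_ isT).
    have -> : component (Multigraph A M) x :\ l = C.
      rewrite cE; case: ifP => _; first by rewrite setU1K.
      by apply/setDidPl; rewrite disjoint_sym disjoints1.
    exact: eq_has_cycle.
  move=> /(@eq_has_cycle G' (Multigraph A M)) H; apply: has_cycle_sub (H _ _ _) => //.
    by rewrite cE; case: ifP => _; rewrite ?subsetUr.
  by move=> a b aC bC; rewrite /= eq0.
set G := Multigraph A M; have sC : component G x \subset A by apply: (component_sub (G := G)).
have [c0|c0] := boolP [exists a in component G x, deg G a == 0]; last first.
  have d2 a : a \in component G x -> 1 < deg G a.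
    move=> aC; move: c0; rewrite negb_exists_in => /forall_inP /(_ a aC).
    move: noleaf; rewrite negb_exists_in => /forall_inP /(_ a (subsetP sC _ aC)) /=.
    by rewrite -/G; case: (deg G a) => [|[|]].
  rewrite (_ : is_cyclic G x); last first.
    rewrite /is_cyclic /dsum mulnC -sum_nat_const; apply: leq_sum => a aC; exact: d2.
  apply: has_cycle_min_deg => //; first by apply/set0Pn; exists x; apply: component_id.
  by move=> a b; rewrite !inE => xa ab; apply: connect_trans xa (connect1 ab).
case/exists_inP: c0 => a aC /eqP da.
have ncyc : ~~ is_cyclic G x.
  rewrite /is_cyclic /dsum -(component_eq (G := G) sM aC) -/(dsum G a) -/(is_cyclic G a).
  by apply/negP=> /(is_cyclic_deg (G := G) (subsetP sC _ aC)); rewrite da.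
rewrite (negPf ncyc); apply/negP=> /(has_cycle_leaf (G := G) (x := a) sM sC (subsetP sC _ aC)).
rewrite da => /(_ isT).
have -> : component G x :\ a = set0.
  apply/setP=> b; rewrite -(component_eq (G := G) sM aC) !inE; apply/negP=> /andP [ba].
  case/connectP=> [[|z p] /= ]; first by move=> _ E; rewrite E eqxx in ba.
  move=> /andP [/and3P [_ zG az] _] _.
  by have := deg_pos_adj (G := G) a zG; rewrite da leqNgt az.
case/or3P=> [/exists_inP [b]|/exists_inP [b]|]; rewrite ?inE //.
move=> /existsP [k /existsP [c /and3P [k2 cS _]]].
case: c cS k2 => [[|b s] sz] /=; last by rewrite inE.
by rewrite -(eqP sz).
Qed.

Lemma has_cycle_componentE G x : symmetric_mx (mult G) -> x \in vset G ->
  has_cycle G (component G x) = is_cyclic G x.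
Proof.
move=> sM xG; pose G' := Multigraph (vset G) (restrict (vset G) (mult G)).
have eM : {in vset G &, mult G =2 mult G'} by move=> a b aG bG; rewrite mxE aG bG.
rewrite (eq_is_cyclic (G1 := G) (G2 := G') erefl eM xG).
rewrite -has_cycle_supported //; [|exact: restrict_sym|exact: supported_restrict].
rewrite (eq_component (G1 := G) (G2 := G') erefl eM) -/G'.
have sC : component G' x \subset vset G by apply: (component_sub (G := G')).
have eC : {in component G' x &, mult G =2 mult G'}.
  by move=> a b aC bC; apply: eM; apply: (subsetP sC).
by apply/idP/idP; apply: eq_has_cycle => // a b aC bC; rewrite eC.
Qed.

Lemma nb_acyclic_eq0 G : symmetric_mx (mult G) ->
  (nb_acyclic G == 0) = [forall x in vset G, is_cyclic G x].
Proof.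
move=> sM; rewrite /nb_acyclic cards_eq0; apply/eqP/forall_inP => [H x xG|H].
  apply: contraT => ncx.
  have : component G x \in [set C in components G | acyclic_comp G C].
    rewrite inE /acyclic_comp has_cycle_componentE // ncx andbT.
    by apply/componentsP => //; exists x.
  by rewrite H inE.
apply/setP=> C; rewrite !inE; apply/negP=> /andP [/(componentsP _ sM) [x xG ->]].
by rewrite /acyclic_comp has_cycle_componentE // H.
Qed.

Lemma excess_cyclicE G r : symmetric_mx (mult G) -> nb_acyclic G = 0 ->
  (excess G == r%:Z)%R = (\sum_(x in vset G) deg G x == 2 * (#|vset G| + r)).
Proof.
move=> sM a0; rewrite /excess a0; have := handshake (vset G) sM.
have -> : Multigraph (vset G) (mult G) = G by case: (G).
by move=> ->; rewrite eqn_mul2l /=; lia.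
Qed.

End Cycles.

(** * Pruning, splicing and clean multigraphs *)

Section TwoCore.
Variable n : nat.
Implicit Types (G : multigraph n) (M : 'M[nat]_n) (A C S T : {set 'I_n}).

Lemma leq_deg_sub S T M a : T \subset S -> deg (Multigraph T M) a <= deg (Multigraph S M) a.
Proof.
move=> /subsetP sTS; rewrite /deg leq_add2r /= [leqRHS](bigID (mem T)) /=.
rewrite (_ : \sum_(b in S | b \in T) M a b = \sum_(b in T) M a b) ?leq_addr //.
by apply: eq_bigl => b; case bT: (b \in T); rewrite ?andbF // sTS.
Qed.

Definition min_deg2 M T := [forall a in T, 1 < deg (Multigraph T M) a].

(* Unlike the outcome of repeated pruning, this description of the 2-core does
   not depend on the order in which the leaves are removed. *)
Definition two_core S M : {set 'I_n} :=
  \bigcup_(T : {set 'I_n} | (T \subset S) && min_deg2 M T) T.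

Lemma two_core_sub S M : two_core S M \subset S.
Proof. by apply/bigcupsP => T /andP []. Qed.

Lemma two_core_max S M T : T \subset S -> min_deg2 M T -> T \subset two_core S M.
Proof. by move=> sT dT; apply: (bigcup_max T) => //; rewrite sT. Qed.

Lemma two_core_deg S M : min_deg2 M (two_core S M).
Proof.
apply/forall_inP=> a /bigcupP [T /andP [sT dT] aT].
apply: leq_trans (forall_inP dT a aT) (leq_deg_sub _ _ _).
exact: two_core_max.
Qed.

Lemma two_core_id S M : min_deg2 M S -> two_core S M = S.
Proof. by move=> d; apply/eqP; rewrite eqEsubset two_core_sub two_core_max. Qed.

(** Degrees only decrease on passing to a subset, so a vertex of degree at most 1 lies in no subset
    of minimum degree 2. *)
Lemma two_core_leaf S M x : deg (Multigraph S M) x <= 1 ->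
  two_core (S :\ x) M = two_core S M.
Proof.
move=> dx; apply/eqP; rewrite eqEsubset; apply/andP; split; apply: two_core_max.
- exact: subset_trans (two_core_sub _ _) (subsetDl _ _).
- exact: two_core_deg.
- apply/subsetD1P; split; first exact: two_core_sub.
  apply/negP=> /(forall_inP (two_core_deg S M)); rewrite ltnNge.
  by rewrite (leq_trans (leq_deg_sub _ _ (two_core_sub _ _))).
- exact: two_core_deg.
Qed.

Lemma eq_min_deg2 M M' T : {in T &, M =2 M'} -> min_deg2 M T = min_deg2 M' T.
Proof.
move=> eM; apply: eq_forallb_in => a aT; congr (_ < _); exact: eq_deg.
Qed.

Lemma eq_two_core S M M' : {in S &, M =2 M'} -> two_core S M = two_core S M'.
Proof.
move=> eM; apply: eq_bigl => T; case sT: (T \subset S) => //=.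
by apply: eq_min_deg2 => a b aT bT; apply: eM; apply: (subsetP sT).
Qed.

Definition all_complex G := forall x, x \in vset G -> is_complex G x.

Lemma is_complex_component G x y : symmetric_mx (mult G) -> y \in component G x ->
  is_complex G y = is_complex G x.
Proof. by move=> sM yx; rewrite /is_complex /dsum (component_eq sM yx). Qed.

Lemma all_complex_complex_part G : symmetric_mx (mult G) -> all_complex (complex_part G).
Proof.
move=> sM x; set Gc := complex_part G.
have Ec : vset Gc = [set x in vset G | is_complex G x] by apply: vset_complex_part.
have cl a b : a \in vset Gc -> adj G a b -> b \in vset Gc.
  rewrite Ec !inE => /andP [aG ca] ab; have := ab => /and3P [_ -> _] /=.
  by rewrite (is_complex_component (x := a)) // inE connect1.
move=> xc; have [xG cx] : x \in vset G /\ is_complex G x.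
  by move: xc; rewrite Ec inE => /andP [].
have cE : component Gc x = component G x.
  apply/setP=> y; rewrite !inE; apply/idP/idP.
    apply: (homo_connect (f := id)) => a b /and3P [].
    rewrite Ec !inE => /andP [aG _] /andP [bG _] ab; apply: connect1.
    by rewrite /adj /= aG bG.
  case/connectP=> p pP -> {y}; elim: p x xc pP {xG cx} => [|a p IH] x xc /=.
    by rewrite connect0.
  case/andP=> xa /(IH _ (cl _ _ xc xa)); apply: connect_trans; apply: connect1.
  by rewrite /adj /= xc (cl _ _ xc xa); case/and3P: xa.
rewrite /is_complex cE /dsum cE (eq_bigr (deg G)) //.
move=> a ax; have aGc : a \in vset Gc.
  by rewrite Ec inE (is_complex_component sM ax) cx (subsetP (component_sub xG)).
apply: deg_closed => //; last by move=> b; apply: cl.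
by change (vset Gc \subset vset G); rewrite Ec; apply/subsetP=> b; rewrite inE => /andP [].
Qed.

Section LeafDeletion.
Variables (G : multigraph n) (x : 'I_n).
Hypotheses (sM : symmetric_mx (mult G)) (xG : x \in vset G) (dx : deg G x = 1).
Let G' := Multigraph (vset G :\ x) (mult G).

Lemma leaf_deletion a : a \in vset G :\ x ->
  is_uni G a = is_uni G' a /\ is_complex G a = is_complex G' a.
Proof.
move=> aG'; pose M := restrict (vset G) (mult G).
have eM : {in vset G &, mult G =2 M} by move=> b c bG cG; rewrite mxE bG cG.
have pM : supported (vset G) M by apply: supported_restrict.
have sM1 : symmetric_mx M by apply: restrict_sym.
have d1 : deg (Multigraph (vset G) M) x = 1 by rewrite -dx; apply/esym/eq_deg.
have [y yA EM] := leafP xG pM sM1 d1.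
have aG : a \in vset G by move: aG'; rewrite inE => /andP [].
have xG' : x \notin vset G :\ x by rewrite !inE eqxx.
have := leaf_status xG' (supported_restrict (vset G :\ x) M) (restrict_sym _ sM1) yA (a := a).
rewrite -EM setD1K // => /(_ aG) [].
have -> : retract x y a = a by move: aG'; rewrite /retract !inE; case: eqP.
rewrite (eq_is_uni (G1 := G) (G2 := Multigraph (vset G) M)) // => ->.
rewrite (eq_is_complex (G1 := G) (G2 := Multigraph (vset G) M)) // => -> _.
have eM' : {in vset G' &, mult G' =2 restrict (vset G :\ x) M}.
  move=> b c bG cG; rewrite mxE bG cG -eM //.
    by move: bG; rewrite inE => /andP [].
  by move: cG; rewrite inE => /andP [].
split; [exact/esym/eq_is_uni|exact/esym/eq_is_complex].
Qed.

End LeafDeletion.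

Section SpliceVertex.
Variables (G : multigraph n) (x : 'I_n).
Hypotheses (sM : symmetric_mx (mult G)) (xG : x \in vset G).
Hypotheses (dx : deg G x = 2) (lx : mult G x x = 0).

Lemma splice_mult M y z : supported (vset G :\ x) M -> y != x -> z != x ->
  {in vset G &, mult G =2 add_edge (add_edge M x y) x z} ->
  {in vset G :\ x &, mult (splice G x) =2 add_edge M y z}.
Proof.
move=> pM yx zx eM a b; rewrite !inE => /andP [ax aG] /andP [bx bG].
have x0 := supported_row (negbT (setD11 _ _)) pM.
rewrite !mxE !eM // !mxE !x0 !add0n /is_edge.
rewrite !eqxx /= ![x == _]eq_sym (negPf yx) (negPf zx) (negPf ax) (negPf bx) /= !andbF !orbF !addn0.
congr (_ + _).
have [->|ab] := eqVneq a b; first by case: (b == y); case: (b == z).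
have [ay|ay] := eqVneq a y; have [bz|bz] := eqVneq b z;
  have [az|az] := eqVneq a z; have [b_y|b_y] := eqVneq b y => //=.
all: by move: ab; rewrite ?ay ?az -?bz -?b_y ?eqxx // => /eqP; congruence.
Qed.

Lemma splice_status a : a \in vset G :\ x ->
  is_complex G a = is_complex (splice G x) a /\ deg G a = deg (splice G x) a.
Proof.
move=> aG'; pose M := restrict (vset G) (mult G).
have eM : {in vset G &, mult G =2 M} by move=> b c bG cG; rewrite mxE bG cG.
have pM : supported (vset G) M by apply: supported_restrict.
have sM1 : symmetric_mx M by apply: restrict_sym.
have d1 : deg (Multigraph (vset G) M) x = 2 by rewrite -dx; apply/esym/eq_deg.
have := deg2P xG pM sM1 d1; rewrite mxE xG lx /= => - [y [z [yA zA EM]]].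
have aG : a \in vset G by move: aG'; rewrite inE => /andP [].
have xG' : x \notin vset G :\ x by rewrite !inE eqxx.
have pM0 := supported_restrict (vset G :\ x) M.
have sM0 : symmetric_mx (restrict (vset G :\ x) M) by apply: restrict_sym.
have yx : y != x by move: yA; rewrite !inE => /andP [].
have zx : z != x by move: zA; rewrite !inE => /andP [].
have eS := splice_mult pM0 yx zx; rewrite -EM in eS; move/(_ eM) in eS.
have dG := deg_subdivide xG' pM0 yA zA aG'.
have := subdivide_status xG' pM0 sM0 yA zA (a := a).
rewrite -EM setD1K // in dG * => /(_ aG) [_ + _].
have -> : retract x y a = a by move: aG'; rewrite /retract !inE; case: eqP.
rewrite (eq_is_complex (G1 := G) (G2 := Multigraph (vset G) M)) // => ->.
rewrite (eq_deg (G1 := G) (G2 := Multigraph (vset G) M)) // dG.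
split; [apply/esym/eq_is_complex|apply/esym/eq_deg] => //; exact: eS.
Qed.

End SpliceVertex.

End TwoCore.

(** * Cleanness in terms of the 2-core *)

Section Clean.
Variable n : nat.
Implicit Types (G : multigraph n) (M : 'M[nat]_n) (A C S T : {set 'I_n}).

Lemma eq_all_complex G G' : (forall a, a \in vset G' -> a \in vset G /\ is_complex G a = is_complex G' a) ->
  all_complex G -> all_complex G'.
Proof. by move=> H cG a /H [aG <-]; apply: cG. Qed.

Variant prune_spec G : multigraph n -> Prop :=
  | PruneLeaf x of x \in vset G & deg G x = 1 : prune_spec G (Multigraph (vset G :\ x) (mult G))
  | PruneNone of (forall x, x \in vset G -> deg G x != 1) : prune_spec G G.

Lemma prune1P G : prune_spec G (prune1 G).
Proof.
rewrite /prune1; case: pickP => [x /andP [xG /eqP dx]|H]; first exact: PruneLeaf.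
by apply: PruneNone => x xG; move: (H x); rewrite /= xG /= => ->.
Qed.

(** The final disjunction measures progress: either no leaf is left, or every round so far has
    removed a vertex. For [m = n] the second alternative leaves no vertex at all, so there is no
    leaf in that case either. *)
Lemma iter_prune1 G m (H := iter m (@prune1 n) G) :
  symmetric_mx (mult G) -> all_complex G ->
  [/\ mult H = mult G, all_complex H,
      two_core (vset H) (mult G) = two_core (vset G) (mult G)
    & (forall x, x \in vset H -> deg H x != 1) \/ #|vset H| + m <= #|vset G|].
Proof.
move=> sM cG; rewrite {}/H; elim: m => [|m [eM cH eK IH]]; first by split=> //; right; rewrite addn0.
rewrite iterS; set H := iter m _ G in eM cH eK IH *.
case: prune1P IH => [x xH dx IH|nl _]; last by split=> //; left.
split=> //=.
- apply: eq_all_complex cH => a /= aH; split; first by move: aH; rewrite inE => /andP [].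
  by rewrite -eM in sM; case: (leaf_deletion sM xH dx aH).
- rewrite -eK; apply: two_core_leaf; rewrite -eM.
  by rewrite (_ : Multigraph _ _ = H) ?dx //; case: (H).
case: IH => [/(_ x xH)|IH]; first by rewrite dx.
by right; rewrite addnS -addSn; move: IH; rewrite (cardsD1 x (vset H)) xH.
Qed.

Lemma splice_sym G x : symmetric_mx (mult G) -> symmetric_mx (mult (splice G x)).
Proof. by move=> sM a b; rewrite !mxE sM eq_sym; congr (_ + _); case: eqP => [->|_] //; rewrite andbC. Qed.

Variant splice_spec G : multigraph n -> Prop :=
  | SpliceSome x of x \in vset G & deg G x = 2 & mult G x x = 0 : splice_spec G (splice G x)
  | SpliceNone of (forall x, x \in vset G -> deg G x = 2 -> mult G x x != 0) : splice_spec G G.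

Lemma splice1P G : splice_spec G (splice1 G).
Proof.
rewrite /splice1; case: pickP => [x /and3P [xG /eqP dx /eqP lx]|H]; first exact: SpliceSome.
by apply: SpliceNone => x xG dx; move: (H x); rewrite /= xG dx /= => ->.
Qed.

Definition subcubic G := [forall x in vset G, deg G x <= 3].

Lemma subcubic_splice G x : symmetric_mx (mult G) -> x \in vset G -> deg G x = 2 ->
  mult G x x = 0 -> subcubic (splice G x) = subcubic G.
Proof.
move=> sM xG dx lx; apply/forall_inP/forall_inP => H a aG.
  have [->|ax] := eqVneq a x; first by rewrite dx.
  have aG' : a \in vset G :\ x by rewrite !inE ax.
  by have [_ ->] := splice_status sM xG dx lx aG'; apply: H.
have [_ <-] := splice_status sM xG dx lx aG; apply: H.
by move: aG; rewrite inE => /andP [].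
Qed.

Lemma iter_splice1 G m (H := iter m (@splice1 n) G) :
  symmetric_mx (mult G) -> all_complex G -> (forall x, x \in vset G -> 1 < deg G x) ->
  [/\ symmetric_mx (mult H), all_complex H, (forall x, x \in vset H -> 1 < deg H x),
      subcubic H = subcubic G
    & (forall x, x \in vset H -> deg H x = 2 -> mult H x x != 0) \/ #|vset H| + m <= #|vset G|].
Proof.
move=> sM cG dG; rewrite {}/H; elim: m => [|m [sH cH dH eH IH]]; first by split=> //; right; rewrite addn0.
rewrite iterS; set H := iter m _ G in sH cH dH eH IH *.
case: splice1P IH => [x xH dx lx IH|nl _]; last by split=> //; left.
split.
- exact: splice_sym.
- apply: eq_all_complex cH => a /= aH; split; first by move: aH; rewrite inE => /andP [].
  by case: (splice_status sH xH dx lx aH).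
- move=> a aH; have [_ <-] := splice_status sH xH dx lx aH; apply: dH.
  by move: aH; rewrite inE => /andP [].
- by rewrite subcubic_splice.
case: IH => [/(_ x xH dx)|IH]; first by rewrite lx.
by right; rewrite addnS -addSn; move: IH; rewrite (cardsD1 x (vset H)) xH.
Qed.

(** A self-loop at a vertex of degree 2 leaves no edge to other vertices, so the vertex alone would
    be a unicyclic component. Hence splicing never gets stuck in the complex part. *)
Lemma complex_deg2_loop G x : symmetric_mx (mult G) -> x \in vset G -> is_complex G x ->
  deg G x = 2 -> mult G x x = 0.
Proof.
move=> sM xG cx dx; apply/eqP; apply: contraTT cx => lx.
have C1 : component G x = [set x].
  apply/setP=> y; rewrite !inE; apply/idP/eqP=> [/connectP [p]|->]; last exact: connect0.
  elim: p => [_ -> //|z p IH] /= /andP [/and3P [_ zG xz] pP].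
  have zx : z = x.
    apply: contraTeq xz => zx; rewrite -leqNgt; move: dx lx; rewrite /deg.
    rewrite (bigD1 x) //= (bigD1 z) /= ?zG //.
    by set s := \sum_(i | _) _; move: s (mult G x x) (mult G x z) => a b c; lia.
  by subst z; apply: IH.
by rewrite /is_complex /dsum C1 big_set1 cards1 dx.
Qed.

Definition complex_vertices G := [set x in vset G | is_complex G x].
Definition kernel G := two_core (complex_vertices G) (mult G).

(** Splicing removes vertices of degree 2 and keeps all other degrees, so the bound 3 holds on the
    2-core exactly when it holds after reduction. There every degree exceeds 2, and at most 3 means
    equal to 3. *)
Lemma cleanE G : symmetric_mx (mult G) ->
  clean G = subcubic (Multigraph (kernel G) (mult G)).
Proof.
move=> sM; rewrite /clean /reduced.
have cc := all_complex_complex_part sM.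
have sc : symmetric_mx (mult (complex_part G)) by [].
have [] := iter_prune1 n sc cc; rewrite vset_complex_part //=.
set H := iter n (@prune1 n) _ => eM cH eK IH.
have nl x : x \in vset H -> deg H x != 1.
  case: IH x => // IH x xH; have := leq_trans IH (max_card _).
  by rewrite card_ord -[leqRHS]add0n leq_add2r leqn0 => /eqP/cards0_eq E; rewrite E inE in xH.
have sH : symmetric_mx (mult H) by rewrite eM.
have dH x : x \in vset H -> 1 < deg H x.
  move=> xH; have := nl x xH; have: 0 < deg H x.
    by apply: is_cyclic_deg => //; apply/ltnW/cH.
  by case: (deg H x) => [|[|]].
have HE : Multigraph (vset H) (mult H) = H by case: (H).
have KH : vset H = kernel G.
  rewrite -[RHS]eK -eM two_core_id //; apply/forall_inP=> x xH.
  by rewrite HE; apply: dH.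
rewrite -KH -[in RHS]eM HE.
have [sR cR dR <- IR] := iter_splice1 n sH cH dH.
set R := iter n _ H in sR cR dR IR *.
have d3 x : x \in vset R -> 2 < deg R x.
  move=> xR; have := dR x xR; rewrite leq_eqVlt => /predU1P [d2|//].
  have lx := complex_deg2_loop sR xR (cR x xR) (esym d2).
  case: IR => [/(_ x xR (esym d2))|IR]; first by rewrite lx.
  have := leq_trans IR (max_card _).
  by rewrite card_ord -[leqRHS]add0n leq_add2r leqn0 => /eqP/cards0_eq E; rewrite E inE in xR.
by apply: eq_forallb_in => x xR; rewrite eqn_leq d3 // andbT.
Qed.

End Clean.

(** * Weights *)

Section Weights.
Variable n : nat.
Implicit Types (G : multigraph n) (M : 'M[nat]_n) (A C S T : {set 'I_n}).

Definition kappa_den M : nat :=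
  \prod_(x < n) (2 ^ M x x * \prod_(y < n | x <= y) (M x y)`!).

Lemma kappa_den_pair M : kappa_den M =
  (\prod_(x < n) 2 ^ M x x) * \prod_(p : 'I_n * 'I_n | p.1 <= p.2) (M p.1 p.2)`!.
Proof. by rewrite /kappa_den big_split /= pair_big_dep. Qed.

Lemma kappa_den_gt0 M : 0 < kappa_den M.
Proof.
rewrite kappa_den_pair muln_gt0; apply/andP; split; apply: prodn_gt0 => x.
  by rewrite expn_gt0.
exact: fact_gt0.
Qed.

Lemma kappa_den_add_edge M y z : symmetric_mx M ->
  kappa_den (add_edge M y z) = kappa_den M * (M y z).+1 * 2 ^ (y == z).
Proof.
wlog yz : y z / y <= z.
  move=> H sM; have [/H->//|/ltnW/H E] := leqP y z.
  by rewrite add_edgeC E // sM eq_sym.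
move=> sM; rewrite !kappa_den_pair.
have -> : \prod_(x < n) 2 ^ add_edge M y z x x = \prod_(x < n) 2 ^ M x x * 2 ^ (y == z).
  rewrite (eq_bigr (fun x => 2 ^ M x x * 2 ^ ((x == y) && (x == z)))); last first.
    by move=> x _; rewrite mxE expnD /is_edge [(x == z) && _]andbC orbb.
  rewrite big_split /=; congr (_ * _).
  rewrite (bigD1 y) //= eqxx big1 ?muln1 // => x /negPf->//.
have -> : \prod_(p : 'I_n * 'I_n | p.1 <= p.2) (add_edge M y z p.1 p.2)`! =
    \prod_(p : 'I_n * 'I_n | p.1 <= p.2) (M p.1 p.2)`! * (M y z).+1.
  rewrite (bigD1 (y, z)) //= [in RHS](bigD1 (y, z)) //= mxE /is_edge !eqxx addn1 factS.
  rewrite [X in _ * X = _](_ : _ = \prod_(p : 'I_n * 'I_n | (p.1 <= p.2) && (p != (y, z))) (M p.1 p.2)`!).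
    by rewrite -mulnA [RHS]mulnC.
  apply: eq_bigr => -[a b] /= /andP [ab]; rewrite mxE xpair_eqE => /negPf N.
  rewrite /is_edge N /=; case: eqP => [ea|]; case: eqP => [eb|]; rewrite ?addn0 //=.
  subst; have E : y = z by apply/val_inj/eqP; rewrite eqn_leq yz.
  by move: N; rewrite E !eqxx.
by rewrite mulnACA mulnA mulnAC.
Qed.

Variable b : nat.
Definition nat_mx (M : 'M['I_b.+1]_n) : 'M[nat]_n := map_mx (@nat_of_ord b.+1) M.
Definition ord_mx (M : 'M[nat]_n) : 'M['I_b.+1]_n := map_mx (@inord b) M.
Definition bounded_mx M := forall x y, M x y <= b.

Lemma nat_mxK : cancel nat_mx ord_mx.
Proof. by move=> M; apply/matrixP=> x y; rewrite !mxE inord_val. Qed.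

Lemma ord_mxK M : bounded_mx M -> nat_mx (ord_mx M) = M.
Proof. by move=> bM; apply/matrixP=> x y; rewrite !mxE inordK // ltnS. Qed.

Local Open Scope ring_scope.

(** Predicates and operations live on matrices of natural numbers, an infinite type, while the sum
    runs over bounded ones; nothing is lost when [P] implies [bounded_mx b]. *)
Definition weight (P : pred 'M[nat]_n) (F : 'M[nat]_n -> rat) : rat :=
  \sum_(M : 'M['I_b.+1]_n | P (nat_mx M)) F (nat_mx M).

Lemma eq_weight (P Q : pred 'M[nat]_n) F F' : P =1 Q -> (forall M, P M -> F M = F' M) ->
  weight P F = weight Q F'.
Proof.
move=> PQ FF; rewrite /weight (eq_bigl (fun M : 'M['I_b.+1]_n => Q (nat_mx M))); last by move=> M; rewrite PQ.
by apply: eq_bigr => M; rewrite -PQ => /FF.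
Qed.

(** The sum over [P] is split into the fibres of the reduction [red]; the fibre over [M] is the
    injective image under [op M] of the admissible choices [R M]. Every recursion that removes a
    vertex is an instance. *)
Lemma weight_transfer (I : finType) (P Q : pred 'M[nat]_n)
    (R : 'M[nat]_n -> pred I) (red : 'M[nat]_n -> 'M[nat]_n)
    (op : 'M[nat]_n -> I -> 'M[nat]_n) (F : 'M[nat]_n -> rat) :
  (forall M, P M -> bounded_mx M) -> (forall M, Q M -> bounded_mx M) ->
  (forall M, P M -> Q (red M) /\ exists2 i, R (red M) i & op (red M) i = M) ->
  (forall M i, Q M -> R M i -> P (op M i) /\ red (op M i) = M) ->
  (forall M i j, Q M -> R M i -> R M j -> op M i = op M j -> i = j) ->
  weight P F = weight Q (fun M => \sum_(i | R M i) F (op M i)).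
Proof.
move=> bP bQ hP hQ inj; rewrite /weight.
rewrite (partition_big (fun N => ord_mx (red (nat_mx N))) (fun N => Q (nat_mx N))) /=; last first.
  by move=> M PM; have [QM _] := hP _ PM; rewrite ord_mxK //; apply: bQ.
apply: eq_bigr => N QM.
rewrite (eq_bigl (mem [set ord_mx (op (nat_mx N) i) | i in R (nat_mx N)])); last first.
  move=> M1 /=; apply/andP/imsetP => [[PM /eqP E]|[i Ri ->]].
    have [QM1 [i Ri oE]] := hP _ PM.
    have E' : red (nat_mx M1) = nat_mx N by rewrite -E ord_mxK //; apply: bQ.
    by exists i; rewrite -E' // oE nat_mxK.
  have [Po Eo] := hQ _ _ QM Ri.
  by rewrite ord_mxK; [rewrite Po Eo nat_mxK eqxx | exact: bP].
rewrite big_imset /=; last first.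
  move=> i j Ri Rj /(congr1 nat_mx); rewrite !ord_mxK; first exact: inj.
    by apply: bP; case: (hQ _ _ QM Rj).
  by apply: bP; case: (hQ _ _ QM Ri).
apply: eq_bigr => i Ri; rewrite ord_mxK //.
by apply: bP; case: (hQ _ _ QM Ri).
Qed.

End Weights.

(** * Clean multigraphs and their cores *)

Section Classes.
Variables (n r : nat).
Implicit Types (G : multigraph n) (M : 'M[nat]_n) (A B C S T : {set 'I_n}).

Definition uni_vertices G := [set x in vset G | is_uni G x].
Definition cubic_kernel G :=
  [set x in kernel G | deg (Multigraph (kernel G) (mult G)) x == 3].

(* [A] is the vertex set, [B] the set of vertices in unicyclic components, and
   [C] the vertex set of the cubic multigraph obtained by reduction. *)
Definition cyclic_class A B C M :=
  let G := Multigraph A M in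
  [&& supported A M, M^T%R == M, [forall x in A, is_cyclic G x],
      \sum_(x in A) deg G x == 2 * (#|A| + r),
      uni_vertices G == B, subcubic (Multigraph (kernel G) M)
    & cubic_kernel G == C].

(* The graphs of [cyclic_class A B C] without leaves, see [core_classE]. *)
Definition core_class A B C M :=
  let G := Multigraph A M in
  [&& supported A M, M^T%R == M, [forall x in A, 1 < deg G x <= 3],
      \sum_(x in A) deg G x == 2 * (#|A| + r),
      uni_vertices G == B & [set x in A | deg G x == 3] == C].

Lemma symmetric_mxP M : reflect (symmetric_mx M) (M^T%R == M).
Proof.
apply: (iffP eqP) => [/matrixP E x y|sM]; first by rewrite -[in RHS]E mxE.
by apply/matrixP=> x y; rewrite mxE sM.
Qed.

Section MinDeg2.
Variable G : multigraph n.
Hypotheses (sM : symmetric_mx (mult G)) (d2 : forall a, a \in vset G -> 1 < deg G a).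

Let d2C x a : x \in vset G -> a \in component G x -> 1 < deg G a.
Proof. by move=> xG ax; apply/d2/(subsetP (component_sub xG)). Qed.

Lemma is_cyclic_min_deg2 x : x \in vset G -> is_cyclic G x.
Proof.
move=> xG; rewrite /is_cyclic /dsum mulnC -sum_nat_const.
by apply: leq_sum => a; apply: d2C.
Qed.

(** The degrees in the component are at least 2 and average 2. *)
Lemma is_uni_min_deg2 x : x \in vset G -> is_uni G x -> deg G x = 2.
Proof.
move=> xG; rewrite /is_uni /dsum mulnC -sum_nat_const eq_sym.
have : \sum_(a in component G x) 2 <= \sum_(a in component G x) deg G a ?= iff
   [forall (a | a \in component G x), 2 == deg G a].
  by apply: leqif_sum => a ax; split; first exact: d2C xG ax.
move=> [_ ->] /forall_inP /(_ x (component_id G x)) /eqP //.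
Qed.

End MinDeg2.

Lemma is_complexE G x : is_complex G x = is_cyclic G x && ~~ is_uni G x.
Proof. by rewrite /is_complex /is_cyclic /is_uni; lia. Qed.

Lemma deg_complex_vertices G x : symmetric_mx (mult G) -> x \in complex_vertices G ->
  deg (Multigraph (complex_vertices G) (mult G)) x = deg G x.
Proof.
move=> sM xc; apply: deg_closed => //.
  by apply/subsetP=> y; rewrite inE => /andP [].
move=> y xy; move: xc; rewrite !inE => /andP [xG cx]; case/and3P: (xy) => _ -> _ /=.
by rewrite (is_complex_component (x := x)) // inE connect1.
Qed.

Lemma kernel_min_deg2 G : symmetric_mx (mult G) ->
  (forall a, a \in vset G -> 1 < deg G a) -> kernel G = complex_vertices G.
Proof.
move=> sM d2; apply: two_core_id; apply/forall_inP=> x xc.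
by rewrite deg_complex_vertices // d2 //; move: xc; rewrite inE => /andP [].
Qed.

(** A vertex of degree 0 would be a tree, so without leaves all degrees are at least 2. Then the
    2-core is the whole complex part, unicyclic vertices have degree 2, and the conditions on the
    kernel become conditions on plain degrees. *)
Lemma core_classE A B C M : core_class A B C M =
  cyclic_class A B C M && [forall x in A, deg (Multigraph A M) x != 1].
Proof.
rewrite /core_class /cyclic_class; set G := Multigraph A M.
case: (supported A M) => //=; case: symmetric_mxP => //= sM.
have E : (forall a, a \in A -> 1 < deg G a) ->
    [/\ subcubic (Multigraph (kernel G) M) = [forall x in A, deg G x <= 3]
      & cubic_kernel G = [set x in A | deg G x == 3]].
  move=> d2; have cG x : x \in A -> 2 < deg G x -> x \in complex_vertices G.
    move=> xA d3; rewrite inE /= xA is_complexE is_cyclic_min_deg2 //=.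
    by apply/negP=> /(is_uni_min_deg2 (G := G) d2 xA) E; rewrite E in d3.
  rewrite /cubic_kernel kernel_min_deg2 //; split.
    apply/forall_inP/forall_inP=> /= H x xA; last first.
      by rewrite (deg_complex_vertices (G := G)) //; apply: H; move: xA; rewrite inE => /andP [].
    rewrite leqNgt; apply/negP=> d4; have xc := cG x xA (ltnW d4).
    by have := H x xc; rewrite (deg_complex_vertices (G := G)) // leqNgt d4.
  apply/setP=> x; rewrite [in LHS]inE [in RHS]inE; apply/andP/andP => [[xc]|[xA d3]].
    rewrite (deg_complex_vertices (G := G)) // => ->; split=> //.
    by move: xc; rewrite inE => /andP [].
  have xc : x \in complex_vertices G by apply: cG => //; rewrite (eqP d3).
  by rewrite (deg_complex_vertices (G := G)).
apply/and4P/andP.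
  case=> /forall_inP d /eqP sd uB dC; have d2 a : a \in A -> 1 < deg G a by case/d/andP.
  have [E1 E2] := E d2; split; last first.
    by apply/forall_inP=> a /d2; case: (deg G a) => [|[]].
  apply/and5P; split=> //; first by apply/forall_inP=> a aA; apply: is_cyclic_min_deg2.
  - by rewrite sd.
  - by rewrite E1; apply/forall_inP=> a /d /andP [].
  - by rewrite E2.
case=> /and5P [/forall_inP cG sd uB sk ck] /forall_inP d1.
have d2 a : a \in A -> 1 < deg G a.
  move=> aA; have := d1 a aA; have := is_cyclic_deg (G := G) aA (cG a aA).
  by case: (deg G a) => [|[|]].
have [E1 E2] := E d2; rewrite -E2; split => //.
by apply/forall_inP=> a aA; rewrite d2 //; move: sk; rewrite E1 => /forall_inP /(_ a aA).
Qed.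

(** No multiplicity exceeds the number of edges, which is [#|A| + r]. *)
Lemma cyclic_class_bounded A B C M : cyclic_class A B C M -> bounded_mx (n + r) M.
Proof.
case/and3P=> pM /symmetric_mxP sM /and3P [_ /eqP sd _] a b.
have [/andP [aA bA]|N] := boolP ((a \in A) && (b \in A)); last first.
  by rewrite (supportedP _ _ pM).
have Ar : #|A| + r <= n + r by rewrite leq_add2r -[leqRHS]card_ord max_card.
apply: leq_trans Ar; rewrite -(@leq_pmul2l 2) // -sd.
have [<-|ab] := eqVneq a b.
  by apply: leq_trans (deg_loop_le (G := Multigraph A M) aA) _; rewrite (bigD1 a) //= leq_addr.
rewrite (bigD1 a) //= (bigD1 b) /=; last by rewrite bA eq_sym.
have := deg_pos_adj (G := Multigraph A M) a bA.
have := deg_pos_adj (G := Multigraph A M) b aA; rewrite /= sM => h1 h2.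
by rewrite mul2n -addnn addnA (leq_trans (leq_add h2 h1)) // leq_addr.
Qed.

Lemma core_class_bounded A B C M : core_class A B C M -> bounded_mx (n + r) M.
Proof. by rewrite core_classE => /andP [/cyclic_class_bounded]. Qed.

Section NewVertex.
Variables (A B C : {set 'I_n}) (M : 'M[nat]_n) (x : 'I_n).
Hypotheses (xA : x \notin A) (pM : supported A M) (sM : symmetric_mx M) (xC : x \notin C).

Let rE y a : a \in A -> retract x y a = a.
Proof. by rewrite /retract; case: eqP => // ->; rewrite (negPf xA). Qed.

Let rx y : retract x y x = y. Proof. by rewrite /retract eqxx. Qed.

Let split_x (U : {set 'I_n}) y : y \in A -> U \subset A ->
  ((if y \in U then x |: U else U) == B) = (U == B :\ x) && ((x \in B) == (y \in B)).
Proof.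
move=> yA /subsetP sU; have xU : x \notin U by apply: contra xA => /sU.
have xy : y != x by apply: contraNneq xA => <-.
apply/eqP/andP => [<-|[/eqP-> /eqP xB]].
  case: ifP => yU; first by rewrite setU1K ?xU //; split=> //; rewrite !inE eqxx yU orbT.
  rewrite (negPf xU) yU; split=> //.
  by apply/eqP/setP=> a; rewrite !inE; case: eqP => // ->; rewrite (negPf xU).
rewrite !inE xy /= -xB; case: ifP => xB'; first by rewrite setD1K.
by apply/setP=> a; rewrite !inE; case: eqP => // ->; rewrite xB'.
Qed.

Let supp_x N : supported A N -> supported (x |: A) N.
Proof. by apply: supportedS; apply: subsetUr. Qed.

(** A leaf inherits the status of its neighbour and lies outside the 2-core, so only membership in
    [B] is affected: [x] and [y] must be on the same side. *)
Lemma cyclic_class_leaf y : y \in A ->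
  cyclic_class (x |: A) B C (add_edge M x y) =
  cyclic_class A (B :\ x) C M && ((x \in B) == (y \in B)).
Proof.
move=> yA; rewrite /cyclic_class.
set G := Multigraph (x |: A) _; set G' := Multigraph A M.
have st a aA : same_status G G' x y a := leaf_status xA pM sM yA aA.
have yA' : y \in x |: A by rewrite setU1r.
have xA' : x \in x |: A by rewrite setU11.
have pG : supported (x |: A) (add_edge M x y) by apply: supported_add_edge => //; apply: supp_x.
have sG : symmetric_mx (add_edge M x y) by apply: add_edge_sym.
rewrite pG pM; have -> : ((add_edge M x y)^T%R == add_edge M x y) by apply/symmetric_mxP.
have -> : (M^T%R == M) by apply/symmetric_mxP.
have -> : [forall a in x |: A, is_cyclic G a] = [forall a in A, is_cyclic G' a].
  apply/forall_inP/forall_inP=> H a aA.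
    by have [_ _] := st a (setU1r x aA); rewrite rE // => <-; apply/H/setU1r.
  have [_ _ ->] := st a aA; apply: H; move: aA; rewrite in_setU1 => /predU1P [->|aA].
    by rewrite rx.
  by rewrite rE.
have -> : \sum_(a in x |: A) deg G a = \sum_(a in A) deg G' a + 2.
  rewrite big_setU1 //= deg_leaf_new // (eq_bigr (fun a => deg G' a + (a == y))); last first.
    by move=> a aA; apply: deg_leaf.
  rewrite big_split /= (_ : \sum_(a in A) (a == y) = 1); first by rewrite addnCA addnA.
  by rewrite (bigD1 y) //= eqxx big1 // => a /andP [_ /negPf->].
rewrite cardsU1 xA.
have -> : (\sum_(a in A) deg G' a + 2 == 2 * (~~ false + #|A| + r)) =
   (\sum_(a in A) deg G' a == 2 * (#|A| + r)).
  by move: (\sum_(a in A) deg G' a) #|A| => s a /=; lia.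
have eset (p : multigraph n -> 'I_n -> bool) :
    (forall a, a \in x |: A -> p G a = p G' (retract x y a)) ->
    [set a in x |: A | p G a] =
    if y \in [set a in A | p G' a] then x |: [set a in A | p G' a] else [set a in A | p G' a].
  move=> H; apply/setP=> a; rewrite [y \in _]inE yA /=.
  have [aA|aA] := boolP (a \in A); last first.
    have [->|ax] := eqVneq a x.
      by rewrite inE xA' H // rx /=; case: ifP; rewrite !inE ?eqxx ?(negPf xA).
    by case: ifP; rewrite !inE (negPf ax) (negPf aA).
  have ax : a != x by apply: contraNneq xA => <-.
  have E : p G a = p G' a by rewrite H ?setU1r // rE.
  by case: ifP; rewrite !inE E (negPf ax) aA.
have -> : (uni_vertices G == B) = (uni_vertices G' == B :\ x) && ((x \in B) == (y \in B)).
  rewrite -split_x //; last by apply/subsetP=> a; rewrite inE => /andP [].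
  by rewrite /uni_vertices (eset (@is_uni n)) // => a /st [].
have kE : kernel G = kernel G'.
  rewrite /kernel -(two_core_leaf (x := x)); last first.
    rewrite -(deg_leaf_new xA pM yA) -/G; apply: leq_deg_sub.
    by apply/subsetP=> a; rewrite inE => /andP [].
  have -> : complex_vertices G :\ x = complex_vertices G'.
    rewrite /complex_vertices (eset (@is_complex n)); last by move=> a /st [].
    case: ifP => _; first by rewrite setU1K // inE negb_and xA.
    by apply/setP=> a; rewrite !inE; case: eqP => // ->; rewrite (negPf xA).
  apply: eq_two_core => a b; rewrite !inE => /andP [aA _] /andP [bA _].
  rewrite /= mxE /is_edge; have [ax|ax] := eqVneq a x; first by move: xA; rewrite -ax aA.
  by have [bx|bx] := eqVneq b x; [move: xA; rewrite -bx bA | rewrite andbF addn0].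
have kA : kernel G' \subset A.
  by apply: subset_trans (two_core_sub _ _) _; apply/subsetP=> a; rewrite inE => /andP [].
have dk a : a \in kernel G' ->
    deg (Multigraph (kernel G') (add_edge M x y)) a = deg (Multigraph (kernel G') M) a.
  move=> ak; apply: eq_deg => // c d /(subsetP kA) cA /(subsetP kA) dA.
  rewrite /= mxE /is_edge; have [cx|cx] := eqVneq c x; first by move: xA; rewrite -cx cA.
  by have [dx|dx] := eqVneq d x; [move: xA; rewrite -dx dA | rewrite andbF addn0].
have -> : subcubic (Multigraph (kernel G) (add_edge M x y)) = subcubic (Multigraph (kernel G') M).
  by rewrite kE; apply: eq_forallb_in => a ak; rewrite dk.
have -> : cubic_kernel G = cubic_kernel G'.
  rewrite /cubic_kernel kE; apply/setP=> a; rewrite inE [RHS]inE.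
  by case ak: (a \in kernel G') => //=; rewrite dk.
by rewrite -!andbA; do !bool_congr; rewrite andbC -andbA.
Qed.

Lemma core_class_subdivide y z : y \in A -> z \in A ->
  core_class (x |: A) B C (add_edge (add_edge M x y) x z) =
  core_class A (B :\ x) C (add_edge M y z) && ((x \in B) == (y \in B)).
Proof.
move=> yA zA; rewrite /core_class.
set G := Multigraph (x |: A) _; set G' := Multigraph A (add_edge M y z).
have st a aA : same_status G G' x y a := subdivide_status xA pM sM yA zA aA.
have xA' : x \in x |: A by rewrite setU11.
have pG : supported (x |: A) (add_edge (add_edge M x y) x z).
  by do 2!(apply: supported_add_edge; rewrite ?setU11 ?setU1r //); apply: supp_x.
have pG' : supported A (add_edge M y z) by apply: supported_add_edge.
rewrite pG pG'.
have -> : ((add_edge (add_edge M x y) x z)^T%R == add_edge (add_edge M x y) x z).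
  by apply/symmetric_mxP; do 2!apply: add_edge_sym.
have -> : ((add_edge M y z)^T%R == add_edge M y z) by apply/symmetric_mxP/add_edge_sym.
have dG a : a \in A -> deg G a = deg G' a by apply: deg_subdivide.
have dx : deg G x = 2 by apply: deg_subdivide_new.
have -> : [forall a in x |: A, 1 < deg G a <= 3] = [forall a in A, 1 < deg G' a <= 3].
  apply/forall_inP/forall_inP=> H a aA; first by rewrite -dG //; apply/H/setU1r.
  move: aA; rewrite in_setU1 => /predU1P [->|aA]; first by rewrite dx.
  by rewrite dG //; apply: H.
have -> : \sum_(a in x |: A) deg G a = \sum_(a in A) deg G' a + 2.
  by rewrite big_setU1 //= dx addnC; congr (_ + _); apply: eq_bigr.
rewrite cardsU1 xA.
have -> : (\sum_(a in A) deg G' a + 2 == 2 * (~~ false + #|A| + r)) =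
   (\sum_(a in A) deg G' a == 2 * (#|A| + r)).
  by move: (\sum_(a in A) deg G' a) #|A| => s a /=; lia.
have -> : (uni_vertices G == B) = (uni_vertices G' == B :\ x) && ((x \in B) == (y \in B)).
  rewrite -split_x //; last by apply/subsetP=> a; rewrite inE => /andP [].
  congr (_ == _); apply/setP=> a; rewrite [y \in _]inE yA /= [LHS]inE /=.
  have [aA|aA] := boolP (a \in A); last first.
    have [->|ax] := eqVneq a x.
      have [-> _ _] := st x xA'; rewrite xA' rx /=.
      by case: ifP; rewrite !inE ?eqxx ?(negPf xA).
    by case: ifP; rewrite !inE (negPf ax) (negPf aA).
  have [-> _ _] := st a (setU1r x aA); rewrite setU1r // rE //.
  have ax : a != x by apply: contraNneq xA => <-.
  by case: ifP; rewrite !inE /= ?(negPf ax) aA.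
have -> : [set a in x |: A | deg G a == 3] = [set a in A | deg G' a == 3].
  apply/setP=> a; rewrite !inE; have [->|ax] /= := eqVneq a x; first by rewrite dx (negPf xA).
  by case aA: (a \in A) => //=; rewrite dG.
by rewrite -!andbA; do !bool_congr; rewrite andbC.
Qed.

(** The new vertex forms a unicyclic component by itself, whence [x \in B]. *)
Lemma core_class_loop : x \in B ->
  core_class (x |: A) B C (add_edge M x x) = core_class A (B :\ x) C M.
Proof.
move=> xB; rewrite /core_class.
set G := Multigraph (x |: A) _; set G' := Multigraph A M.
have xA' : x \in x |: A by rewrite setU11.
have pG : supported (x |: A) (add_edge M x x).
  by apply: supported_add_edge; rewrite ?setU11 //; apply: supp_x.
rewrite pG pM; have -> : ((add_edge M x x)^T%R == add_edge M x x) by apply/symmetric_mxP/add_edge_sym.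
have -> : (M^T%R == M) by apply/symmetric_mxP.
have dG a : a \in A -> deg G a = deg G' a by apply: deg_loop.
have dx : deg G x = 2 by apply: deg_loop_new.
have -> : [forall a in x |: A, 1 < deg G a <= 3] = [forall a in A, 1 < deg G' a <= 3].
  apply/forall_inP/forall_inP=> H a aA; first by rewrite -dG //; apply/H/setU1r.
  move: aA; rewrite in_setU1 => /predU1P [->|aA]; first by rewrite dx.
  by rewrite dG //; apply: H.
have -> : \sum_(a in x |: A) deg G a = \sum_(a in A) deg G' a + 2.
  by rewrite big_setU1 //= dx addnC; congr (_ + _); apply: eq_bigr.
rewrite cardsU1 xA.
have -> : (\sum_(a in A) deg G' a + 2 == 2 * (~~ false + #|A| + r)) =
   (\sum_(a in A) deg G' a == 2 * (#|A| + r)).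
  by move: (\sum_(a in A) deg G' a) #|A| => s a /=; lia.
have -> : uni_vertices G = x |: uni_vertices G'.
  apply/setP=> a; rewrite !inE; have [->|ax] /= := eqVneq a x; first exact: is_uni_loop_new.
  by case aA: (a \in A) => //=; apply: is_uni_loop.
have -> : (x |: uni_vertices G' == B) = (uni_vertices G' == B :\ x).
  apply/eqP/eqP=> [<-|->]; last by rewrite setD1K.
  by rewrite setU1K // inE negb_and xA.
have -> : [set a in x |: A | deg G a == 3] = [set a in A | deg G' a == 3].
  apply/setP=> a; rewrite !inE; have [->|ax] /= := eqVneq a x; first by rewrite dx (negPf xA).
  by case aA: (a \in A) => //=; rewrite dG.
by [].
Qed.

End NewVertex.
End Classes.

(** * Recursions for the weights: removing one vertex *)

Section Recursions.
Variables (n r : nat).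
Implicit Types (G : multigraph n) (M : 'M[nat]_n) (A B C L S T : {set 'I_n}).

Local Open Scope ring_scope.

Definition kap M : rat := (kappa_den M)%:R^-1.

Definition leaves A M := [set l in A | deg (Multigraph A M) l == 1%N].

(** The vertices of [L] are prescribed leaves, but others may be leaves too: this is the form needed
    for inclusion-exclusion. *)
Definition cyclic_weight A B C L :=
  weight (n + r) [pred M | cyclic_class r A B C M && (L \subset leaves A M)] kap.

Definition core_weight A B C := weight (n + r) (core_class r A B C) kap.

Lemma kap_add_edge M y z : symmetric_mx M ->
  kap (add_edge M y z) = kap M / (M y z).+1%:R / (2 ^ (y == z))%:R.
Proof.
by move=> sM; rewrite /kap kappa_den_add_edge // !natrM !invfM.
Qed.

Lemma weightZ b (P : pred 'M[nat]_n) F c :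
  weight b P (fun M => c * F M) = c * weight b P F.
Proof. by rewrite /weight mulr_sumr. Qed.

Section Vertex.
Variables (A B C : {set 'I_n}) (x : 'I_n).
Hypotheses (xA : x \in A) (BA : B \subset A) (xC : x \notin C).

Let xA' : x \notin A :\ x. Proof. by rewrite !inE eqxx. Qed.

Let Ax : x |: (A :\ x) = A. Proof. by rewrite setD1K. Qed.

Let x_neq i : i \in A :\ x -> (x == i) = false.
Proof. by rewrite !inE eq_sym => /andP [/negPf]. Qed.

(* Two leaves are never adjacent, since they would form a tree; hence [x] can be
   attached exactly to the vertices outside [L] on its own side. *)
Lemma cyclic_weight_leaf L : x \in L -> L \subset A ->
  cyclic_weight A B C L =
  #|if x \in B then B :\: L else A :\: B :\: L|%:R * cyclic_weight (A :\ x) (B :\ x) C (L :\ x).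
Proof.
move=> xL LA; set D := if _ then _ else _.
have DP y : y \in D -> [/\ y \in A :\ x, y \notin L & (x \in B) == (y \in B)].
  rewrite /D; case: ifP => xB; rewrite !inE.
    case/andP=> yL yB; rewrite yL yB (subsetP BA) // andbT; split=> //.
    by apply: contraNneq yL => ->.
  case/and3P=> yL yB yA; rewrite yL yA (negPf yB) andbT; split=> //.
  by apply: contraNneq yL => ->.
have lvP M y : y \in A :\ x -> supported (A :\ x) M ->
    y \notin L -> (L \subset leaves A (add_edge M x y)) = (L :\ x \subset leaves (A :\ x) M).
  move=> yA pM yL; have dl l : l \in L -> l != x ->
     deg (Multigraph A (add_edge M x y)) l = deg (Multigraph (A :\ x) M) l.
    move=> lL lx; have lA : l \in A :\ x by rewrite !inE lx (subsetP LA).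
    have := deg_leaf xA' pM yA lA; rewrite Ax => ->.
    by case: eqP => [E|]; rewrite ?addn0 //; rewrite -E lL in yL.
  apply/subsetP/subsetP => H l.
    rewrite !inE => /andP [lx lL]; have := H l lL.
    by rewrite !inE lx -dl.
  move=> lL; have [->|lx] := eqVneq l x.
    by have := deg_leaf_new xA' pM yA; rewrite Ax !inE xA => ->.
  have := H l; rewrite !inE lx lL => /(_ isT) /andP [_].
  by rewrite -dl // => ->; rewrite (subsetP LA).
rewrite /cyclic_weight (weight_transfer (I := 'I_n)
  (Q := [pred M | cyclic_class r (A :\ x) (B :\ x) C M && (L :\ x \subset leaves (A :\ x) M)])
  (R := fun _ => mem D)
  (red := restrict (A :\ x)) (op := fun M i => add_edge M x i)).
- rewrite -weightZ; apply: eq_weight => // M /= /andP [/and3P [pM /symmetric_mxP sM _] _].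
  rewrite (eq_bigr (fun _ => kap M)) ?sumr_const ?mulr_natl // => i /DP [iA _ _].
  rewrite kap_add_edge // (supported_row xA' pM) divr1.
  by rewrite (x_neq iA) divr1.
- by move=> M /andP [/cyclic_class_bounded].
- by move=> M /andP [/cyclic_class_bounded].
- move=> M /andP [cM lM]; have [pM /symmetric_mxP sM _] := and3P cM.
  have dx : deg (Multigraph A M) x = 1%N by have := subsetP lM x xL; rewrite inE => /andP [_ /eqP].
  have [y yA EM] := leafP xA pM sM dx.
  have pM0 := supported_restrict (A :\ x) M.
  have sM0 : symmetric_mx (restrict (A :\ x) M) by apply: restrict_sym.
  move: cM; rewrite EM -{1}Ax cyclic_class_leaf // -EM => /andP [cM0 xyB].
  have yL : y \notin L.
    apply/negP=> /(subsetP lM); rewrite inE => /andP [_ /eqP dy].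
    have [_ _ /and3P [/forall_inP /(_ y yA) cy _ _]] := and3P cM0.
    have := is_cyclic_deg (G := Multigraph (A :\ x) (restrict (A :\ x) M)) yA cy.
    have := deg_leaf xA' pM0 yA yA; rewrite -EM Ax dy eqxx addn1 => -[<-].
    by [].
  rewrite /= cM0 -(lvP _ y) // -EM lM; split=> //; exists y => //.
  move: yA; rewrite /D !inE => /andP [_ yA].
  by case: ifP => xB; rewrite !inE yL /= -(eqP xyB) xB ?yA.
- move=> M y /andP [cM lM] /DP [yA yL xyB]; have [pM /symmetric_mxP sM _] := and3P cM.
  rewrite /= lvP // lM -{1}Ax cyclic_class_leaf // cM xyB; split=> //.
  exact: restrict_add_edge.
move=> M y y' /andP [/and3P [pM _ _] _] /DP [yA _ _] _ /matrixP /(_ x y).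
rewrite !mxE !(supported_row xA' pM) /is_edge !eqxx /= => /eqP.
by rewrite [y == x]eq_sym (x_neq yA) andbF orbF; case: (y =P y').
Qed.


Definition sub_edge M y z : 'M[nat]_n := \matrix_(a, b) (M a b - is_edge y z a b)%N.

Lemma sub_edgeK M y z : symmetric_mx M -> (0 < M y z)%N -> add_edge (sub_edge M y z) y z = M.
Proof.
move=> sM Myz; apply/matrixP=> a b; rewrite !mxE subnK //.
case E: (is_edge y z a b) => //.
by case/orP: E => /andP [/eqP-> /eqP->] //; rewrite sM.
Qed.

Lemma add_edgeK M y z : sub_edge (add_edge M y z) y z = M.
Proof. by apply/matrixP=> a b; rewrite !mxE addnK. Qed.

Lemma sub_edge_sym M y z : symmetric_mx M -> symmetric_mx (sub_edge M y z).
Proof. by move=> sM a b; rewrite !mxE sM is_edge_sym. Qed.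

Lemma supported_sub_edge S M y z : supported S M -> supported S (sub_edge M y z).
Proof. by move=> /supportedP pM; apply/supportedP=> a b N; rewrite mxE pM. Qed.

Lemma add_edgeAC M y z y' z' :
  add_edge (add_edge M y z) y' z' = add_edge (add_edge M y' z') y z.
Proof. by apply/matrixP=> a b; rewrite !mxE addnAC. Qed.

(** [splice] leaves junk in row and column [x]; clearing it makes this an exact inverse of
    subdivision on matrices. *)
Definition splice_mx M := restrict (A :\ x) (mult (splice (Multigraph A M) x)).

Lemma splice_mx_subdivide M y z : supported (A :\ x) M -> y \in A :\ x -> z \in A :\ x ->
  splice_mx (add_edge (add_edge M x y) x z) = add_edge M y z.
Proof.
move=> pM yA zA; have pM' : supported (A :\ x) (add_edge M y z) by apply: supported_add_edge.
have yx : y != x by rewrite eq_sym x_neq.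
have zx : z != x by rewrite eq_sym x_neq.
rewrite -[RHS](restrict_id pM'); apply/matrixP=> a b; rewrite mxE [RHS]mxE.
case: ifP => // /andP [aA bA].
by apply: (splice_mult (G := Multigraph A _) (x := x)) => // c d _ _.
Qed.

Lemma is_uni_adj G a b : symmetric_mx (mult G) -> adj G a b -> is_uni G a = is_uni G b.
Proof.
move=> sM ab; have bC : b \in component G a by rewrite inE connect1.
by rewrite /is_uni /dsum (component_eq sM bC).
Qed.

(** Unicyclic components have as many edges as vertices, so the surplus [r] of edges falls entirely
    on the complex side. Testing [p.1] alone is enough because adjacent vertices lie on the same
    side. *)
Lemma core_edges M (A' B' : {set 'I_n}) (u : bool) : core_class r A' B' C M ->
  let D := if u then B' else A' :\: B' in
  (\sum_(p : 'I_n * 'I_n | [&& p.1 <= p.2, 0 < M p.1 p.2 & p.1 \in D]) M p.1 p.2)%N =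
  (#|D| + (~~ u) * r)%N.
Proof.
case/and5P=> pM /symmetric_mxP sM /forall_inP dA /eqP sd /andP [/eqP uB _] D.
set G := Multigraph A' M.
have BA' : B' \subset A' by rewrite -uB; apply/subsetP=> a; rewrite inE => /andP [].
have DA : D \subset A' by rewrite /D; case: (u) => //; apply: subsetDl.
have d2 a : a \in A' -> (1 < deg G a)%N by case/dA/andP.
have uni a : a \in A' -> (a \in B') = is_uni G a by move=> aA; rewrite -uB inE /= aA.
have clD a b : a \in D -> adj G a b -> b \in D.
  move=> aD ab; have aA := subsetP DA a aD; have bA : b \in A' by case/and3P: ab.
  move: aD; rewrite /D; case: (u); rewrite ?inE !uni // (is_uni_adj _ ab) //.
  by rewrite aA bA.
have -> : (\sum_(p : 'I_n * 'I_n | [&& p.1 <= p.2, 0 < M p.1 p.2 & p.1 \in D]) M p.1 p.2 =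
    nb_edges (Multigraph D M) D)%N.
  rewrite /nb_edges pair_big_dep /= [RHS](bigID (fun p : 'I_n * 'I_n => (0 < M p.1 p.2)%N)) /=.
  rewrite [X in _ = (_ + X)%N]big1 ?addn0; last by move=> p /andP [_]; case: (M _ _).
  apply: eq_bigl => -[a b] /=; case Mab: (0 < M a b)%N; rewrite ?andbF //= !andbT.
  case aD: (a \in D); rewrite ?andbF // andbT /=.
  rewrite (clD a b) //= /adj /= Mab andbT.
  by have := supportedP _ _ pM a b; case: (_ && _) => // /(_ isT) E; rewrite E in Mab.
have hs : (\sum_(a in D) deg G a = 2 * nb_edges (Multigraph D M) D)%N.
  rewrite -handshake //; apply: eq_bigr => a aD; apply/esym.
  by apply: (deg_closed (G := G)) => // b; apply: clD.
apply/eqP; rewrite -(eqn_pmul2l (m := 2)) // -hs.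
have sB : (\sum_(a in B') deg G a = 2 * #|B'|)%N.
  rewrite mulnC -sum_nat_const; apply: eq_bigr => a aB; have aA := subsetP BA' a aB.
  by apply: is_uni_min_deg2 => //; rewrite -uni.
rewrite /D; case: (u) => /=; first by rewrite sB addn0.
move: sd; rewrite (big_setID B') /= (setIidPr BA') sB cardsD (setIidPr BA').
have := subset_leq_card BA'; rewrite -/G mul1n; set s := (\sum_(a in A' :\: B') deg G a)%N.
by move: s #|A'| #|B'| => s p q; lia.
Qed.

Let D := if x \in B then B :\ x else A :\: B :\ x.

Let DP y : y \in A :\ x -> (y \in D) = ((x \in B) == (y \in B)).
Proof.
rewrite /D !inE => /andP [yx yA]; case: ifP => xB; rewrite !inE yx /= ?yA ?andbT.
  by case: (y \in B).
by case: (y \in B).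
Qed.

Lemma core_deg M : core_class r A B C M -> deg (Multigraph A M) x = 2%N.
Proof.
case/and5P=> _ _ /forall_inP /(_ x xA) dx _ /andP [_ /eqP CE].
have : deg (Multigraph A M) x != 3%N by move: xC; rewrite -CE inE xA.
by move: dx; case: (deg _ x) => [|[|[|[|]]]].
Qed.

Lemma core_weight_subdivide :
  weight (n + r) [pred M | core_class r A B C M && (M x x == 0%N)] kap =
  (#|D| + (x \notin B) * r)%N%:R * core_weight (A :\ x) (B :\ x) C.
Proof.
have DA y : y \in D -> y \in A.
  by rewrite /D; case: ifP; rewrite !inE => _ /andP [_]; [exact: (subsetP BA)|case/andP].
rewrite /core_weight (weight_transfer (I := ('I_n * 'I_n)%type)
  (Q := core_class r (A :\ x) (B :\ x) C)
  (R := fun M p => [&& p.1 <= p.2, 0 < M p.1 p.2 & p.1 \in D]%N)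
  (red := splice_mx)
  (op := fun M p => add_edge (add_edge (sub_edge M p.1 p.2) x p.1) x p.2)).
- rewrite -weightZ; apply: eq_weight => // M cM; have [pM /symmetric_mxP sM _] := and3P cM.
  have DE : D = if x \in B then B :\ x else (A :\ x) :\: (B :\ x).
    rewrite /D; case: ifP => // xB; apply/setP=> a; rewrite !inE.
    by case: (a == x); rewrite ?andbF.
  have := core_edges (x \in B) cM; rewrite /= -DE => <-.
  rewrite natr_sum mulr_suml; apply: eq_bigr => -[y z] /= /and3P [yz Myz _].
  have [yA zA] : y \in A :\ x /\ z \in A :\ x.
    have := supportedP _ _ pM y z; case: (y \in _); case: (z \in _) => //= /(_ isT) E; by rewrite E in Myz.
  set M0 := sub_edge M y z; have EM : M = add_edge M0 y z by rewrite sub_edgeK.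
  have sM0 : symmetric_mx M0 by apply: sub_edge_sym.
  have pM0 : supported (A :\ x) M0 by apply: supported_sub_edge.
  clearbody M0; rewrite !kap_add_edge //; last exact: add_edge_sym.
  rewrite !(x_neq yA) !(x_neq zA) !divr1 [in RHS]EM kap_add_edge //.
  rewrite !mxE !(supported_row xA' pM0) /is_edge !eqxx /= [z == x]eq_sym (x_neq zA) andbF orbF.
  have p1 : ((M0 y z).+1%:R : rat) != 0 by rewrite pnatr_eq0.
  rewrite [z == y]eq_sym addn1; move: ((M0 y z).+1%:R : rat) p1 => c c0.
  (* Subdividing multiplies [kap] by the multiplicity [M y z] in both cases: when [y = z], the
     factor 1/2 of the self-loop turns into the factor 1/2! of the double edge. *)
  by case: (y == z) => /=; field.
- by move=> M /andP [/core_class_bounded].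
- by move=> M /core_class_bounded.
- move=> M /andP [cM /eqP lx]; have [pM /symmetric_mxP sM _] := and3P cM.
  have := deg2P xA pM sM (core_deg cM); rewrite lx eqxx => -[y0 [z0 [yA0 zA0 EM0]]].
  have pM0 := supported_restrict (A :\ x) M.
  have sM0 : symmetric_mx (restrict (A :\ x) M) by apply: restrict_sym.
  have [y [z [yA zA EM yz]]] : exists y z, [/\ y \in A :\ x, z \in A :\ x,
      M = add_edge (add_edge (restrict (A :\ x) M) x y) x z & (y <= z)%N].
    have [yz|/ltnW yz] := leqP y0 z0; first by exists y0, z0; split.
    by exists z0, y0; split=> //; rewrite add_edgeAC.
  rewrite {1 2 3}EM splice_mx_subdivide //.
  move: cM; rewrite EM -{1}Ax core_class_subdivide // -EM => /andP [cM xy].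
  split=> //; exists (y, z); last by rewrite /= add_edgeK -EM.
  by rewrite /= yz DP // xy mxE /is_edge !eqxx addn1.
- move=> M [y z] cM /and3P [/= yz Myz yD]; have [pM /symmetric_mxP sM _] := and3P cM.
  have [yA zA] : y \in A :\ x /\ z \in A :\ x.
    have := supportedP _ _ pM y z; case: (y \in _); case: (z \in _) => //= /(_ isT) E; by rewrite E in Myz.
  have pM0 : supported (A :\ x) (sub_edge M y z) by apply: supported_sub_edge.
  have sM0 : symmetric_mx (sub_edge M y z) by apply: sub_edge_sym.
  rewrite splice_mx_subdivide // sub_edgeK // -{1}Ax core_class_subdivide // sub_edgeK // cM.
  rewrite -DP // yD; split=> //=.
  by rewrite !mxE !(supported_row xA' pM) /is_edge !eqxx /= (x_neq yA) (x_neq zA).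
move=> M [y z] [y' z'] cM /and3P [/= yz Myz yD] /and3P [/= yz' Myz' yD'] E.
have [pM _ _] := and3P cM.
have [yA zA] : y \in A :\ x /\ z \in A :\ x.
  have := supportedP _ _ pM y z; case: (y \in _); case: (z \in _) => //= /(_ isT) E'; by rewrite E' in Myz.
have [yA' zA'] : y' \in A :\ x /\ z' \in A :\ x.
  have := supportedP _ _ pM y' z'; case: (y' \in _); case: (z' \in _) => //= /(_ isT) E'; by rewrite E' in Myz'.
(* Row [x] records the multiset of the two ends; the condition [p.1 <= p.2] then determines the
   pair. *)
have f a : a \in A :\ x -> ((a == y) + (a == z) = (a == y') + (a == z'))%N.
  move=> aA; move/matrixP: E => /(_ x a); rewrite !mxE !(supported_row xA' pM) /is_edge !eqxx /=.
  by rewrite [a == x]eq_sym (x_neq aA) !andbF !orbF.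
have Ey : y = y'.
  apply/eqP; apply: contraT => ny; have := f y yA; have := f y' yA'.
  rewrite !eqxx [y' == y]eq_sym (negPf ny) /=.
  case: (y' =P z) => // E1 _; case: (y =P z') => // E2 _.
  by move: ny; rewrite -(inj_eq val_inj) eqn_leq /= {1}E1 yz /= E2 yz'.
by have := f z zA; rewrite -Ey eqxx => /addnI; case: (z =P z') => // <-.
Qed.

Lemma core_weight_loop : x \in B ->
  weight (n + r) [pred M | core_class r A B C M && (M x x != 0%N)] kap =
  2^-1 * core_weight (A :\ x) (B :\ x) C.
Proof.
move=> xB; rewrite /core_weight (weight_transfer (I := unit)
  (Q := core_class r (A :\ x) (B :\ x) C) (R := fun _ _ => true)
  (red := restrict (A :\ x)) (op := fun M _ => add_edge M x x)).
- rewrite -weightZ; apply: eq_weight => // M cM; have [pM /symmetric_mxP sM _] := and3P cM.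
  rewrite (big_pred1 tt) => [|[]] //; rewrite kap_add_edge // (supported_row xA' pM) eqxx.
  by rewrite divr1 mulrC.
- by move=> M /andP [/core_class_bounded].
- by move=> M /core_class_bounded.
- move=> M /andP [cM lx]; have [pM /symmetric_mxP sM _] := and3P cM.
  have := deg2P xA pM sM (core_deg cM); rewrite (negPf lx) => EM.
  have pM0 := supported_restrict (A :\ x) M.
  have sM0 : symmetric_mx (restrict (A :\ x) M) by apply: restrict_sym.
  move: cM; rewrite EM -{1}Ax core_class_loop // -EM => cM.
  by split=> //; exists tt.
- move=> M [] cM _; have [pM /symmetric_mxP sM _] := and3P cM.
  rewrite restrict_add_edge //= -{1}Ax core_class_loop // cM; split=> //=.
  by rewrite mxE /is_edge !eqxx addn1.
by move=> M [] [].
Qed.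

Lemma core_weight_noloop : x \notin B ->
  weight (n + r) [pred M | core_class r A B C M && (M x x != 0%N)] kap = 0.
Proof.
move=> xB; rewrite /weight big_pred0 // => N; apply/negP => /andP [cM lx].
have [pM /symmetric_mxP sM /and4P [/forall_inP dA _ /eqP uB _]] := and3P cM.
have d2 a : a \in A -> (1 < deg (Multigraph A (nat_mx N)) a)%N by case/dA/andP.
have cx : is_complex (Multigraph A (nat_mx N)) x.
  rewrite is_complexE is_cyclic_min_deg2 //=.
  by move: xB; rewrite -uB inE /= xA.
by have := complex_deg2_loop (G := Multigraph A (nat_mx N)) sM xA cx (core_deg cM); move/eqP; rewrite (negPf lx).
Qed.

(* A vertex of degree 2 is either isolated with a self-loop, which contributes
   the factor 1/2, or it subdivides an edge of a smaller core on the same side;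
   an edge of multiplicity [m] counts [m] times, in agreement with [kappa]. *)
Lemma core_weight_rec :
  core_weight A B C = ((if x \in B then #|B|%:R - 2^-1 else #|A :\: B|%:R - 1 + r%:R) : rat) *
    core_weight (A :\ x) (B :\ x) C.
Proof.
have -> : core_weight A B C =
    weight (n + r) [pred M | core_class r A B C M && (M x x == 0%N)] kap +
    weight (n + r) [pred M | core_class r A B C M && (M x x != 0%N)] kap.
  by rewrite /core_weight /weight (bigID (fun N => nat_mx N x x == 0%N)).
rewrite core_weight_subdivide /D; case: ifP => xB.
  rewrite core_weight_loop // -mulrDl (cardsD1 x B) xB /= mul0n addn0 natrD; congr (_ * _).
  by field.
rewrite core_weight_noloop ?xB // addr0 mul1n (cardsD1 x (A :\: B)) !inE xB xA /= !natrD.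
by congr (_ * _); ring.
Qed.

End Vertex.
End Recursions.

(** * Power series and the tree function *)

Section TreeSubstitution.
Local Open Scope ring_scope.

(** [rising a m / m!] is the coefficient of X^m in (1 - X)^(-a). *)
Definition rising (a : rat) m : rat := \prod_(i < m) (a + i%:R).

Variable N : nat.
Implicit Types (p q F : {poly rat}) (a b : rat).

(** Divisibility of a difference by X^N stands for equality of power series up to that order. *)
Lemma dvdXnP p : reflect (forall i, (i < N)%N -> p`_i = 0) ('X^N %| p).
Proof.
apply: (iffP idP) => [/dvdpP [q ->] i iN|H]; first by rewrite coefMXn iN.
rewrite -[p](poly_take_drop N) (_ : take_poly N p = 0) ?add0r ?dvdp_mull //.
by apply/polyP=> i; rewrite coef_take_poly coef0; case: ifP => // /H.
Qed.

Lemma dvdXn_coef p q i : 'X^N %| p - q -> (i < N)%N -> p`_i = q`_i.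
Proof. by move=> /dvdXnP H iN; apply/eqP; rewrite -subr_eq0 -coefB H. Qed.

(** The derivative alone would lose one order of precision; the factor X restores it. *)
Lemma dvdXn_deriv p : 'X^N %| p -> 'X^N %| 'X * p^`().
Proof.
move=> /dvdXnP H; apply/dvdXnP=> i iN; rewrite coefXM.
by case: i iN => //= i iN; rewrite coef_deriv H // mul0rn.
Qed.

Lemma dvdXn_cancel p : 'X^N %| (1 - 'X) * p -> 'X^N %| p.
Proof.
move=> /dvdXnP H; apply/dvdXnP; elim=> [|i IH] iN; have := H _ iN;
  rewrite mulrBl mul1r coefB coefXM /= ?subr0 // => /eqP; rewrite subr_eq0 => /eqP->.
exact/IH/ltnW.
Qed.

(* The truncation of [exp (a X)]. *)
Definition exp_poly a : {poly rat} := \poly_(i < N) (a ^+ i / i`!%:R).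

Lemma exp_poly0 : 'X^N %| exp_poly 0 - 1.
Proof.
apply/dvdXnP=> i iN; rewrite coefB coef_poly iN coef1.
by case: i iN => [|i] _; rewrite ?expr0 ?fact0 ?divr1 ?subrr // exprS mul0r mul0r subrr.
Qed.

Lemma exp_polyD a b : 'X^N %| exp_poly a * exp_poly b - exp_poly (a + b).
Proof.
apply/dvdXnP=> i iN; rewrite coefB coefM coef_poly iN exprDn mulr_suml; apply/eqP; rewrite subr_eq0.
apply/eqP; rewrite [RHS](reindex_inj rev_ord_inj) /=; apply: eq_bigr => -[j ji] _ /=.
have jN : (j < N)%N by apply: leq_ltn_trans iN; rewrite -ltnS.
have ijN : (i - j < N)%N by apply: leq_ltn_trans iN; rewrite leq_subr.
rewrite !coef_poly jN ijN subSS subKn // bin_sub //.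
have := bin_fact (ji : (j <= i)%N) => E; rewrite -[_ *+ 'C(_, _)]mulr_natl.
have f1 : (j`!%:R : rat) != 0 by rewrite pnatr_eq0 -lt0n fact_gt0.
have f2 : ((i - j)`!%:R : rat) != 0 by rewrite pnatr_eq0 -lt0n fact_gt0.
have f3 : ('C(i, j)%:R : rat) != 0 by rewrite pnatr_eq0 -lt0n bin_gt0.
rewrite -E !natrM; move: (j`!%:R : rat) ((i - j)`!%:R : rat) ('C(i, j)%:R : rat) f1 f2 f3.
by move=> f g c ff fg fc; field; rewrite ff fg fc.
Qed.

(* [X exp (-X)], the functional inverse of the tree function. *)
Definition tree_inv : {poly rat} := 'X * exp_poly (-1).

Lemma tree_inv_exp k : 'X^N %| tree_inv ^+ k - 'X^k * exp_poly (- k%:R).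
Proof.
elim: k => [|k IH]; first by rewrite !expr0 mul1r oppr0 -dvdpNr opprB; exact: exp_poly0.
have -> : tree_inv ^+ k.+1 - 'X^(k.+1) * exp_poly (- k.+1%:R) =
    tree_inv * (tree_inv ^+ k - 'X^k * exp_poly (- k%:R)) +
    'X^(k.+1) * (exp_poly (-1) * exp_poly (- k%:R) - exp_poly (-1 + - k%:R)).
  rewrite -opprD nat1r !exprS /tree_inv; ring.
by rewrite dvdp_add ?dvdp_mull ?exp_polyD.
Qed.

(** Applied to X exp (-X), X d/dX yields the factor 1 - X, which the chain rule then puts in front
    of every substituted [theta]. *)
Lemma tree_inv_deriv : 'X^N %| 'X * tree_inv^`() - (1 - 'X) * tree_inv.
Proof.
rewrite /tree_inv derivM derivX mul1r.
have -> : 'X * (exp_poly (-1) + 'X * (exp_poly (-1))^`()) - (1 - 'X) * ('X * exp_poly (-1)) =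
  'X * ('X * ((exp_poly (-1))^`() + exp_poly (-1))) by ring.
apply/dvdXnP=> i iN; rewrite coefXM; case: i iN => //= i iN; rewrite coefXM.
case: i iN => //= i iN; rewrite coefD coef_deriv !coef_poly (ltnW iN) (ltnW (ltnW iN)).
rewrite factS natrM -[_ *+ i.+1]mulr_natr exprS.
have f1 : (i`!%:R : rat) != 0 by rewrite pnatr_eq0 -lt0n fact_gt0.
have f2 : (i.+1%:R : rat) != 0 by rewrite pnatr_eq0.
move: (i`!%:R : rat) (i.+1%:R : rat) ((-1) ^+ i : rat) f1 f2 => c d g fc fd.
by field; rewrite fc fd.
Qed.

Definition theta p := 'X * p^`().

Lemma coef_theta p i : (theta p)`_i = i%:R * p`_i.
Proof. by rewrite coefXM; case: i => [|i] /=; rewrite ?mul0r // coef_deriv mulr_natl. Qed.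

Lemma theta_comp p :
  'X^N %| 'X * (p \Po tree_inv)^`() - (1 - 'X) * (theta p \Po tree_inv).
Proof.
rewrite deriv_comp /theta comp_polyM comp_polyX.
have -> : 'X * ((p^`() \Po tree_inv) * tree_inv^`()) - (1 - 'X) * (tree_inv * (p^`() \Po tree_inv)) =
  (p^`() \Po tree_inv) * ('X * tree_inv^`() - (1 - 'X) * tree_inv) by ring.
by rewrite dvdp_mull // tree_inv_deriv.
Qed.

(* The tree substitution turns [theta] into [X / (1 - X) d/dX]. *)
Lemma theta2_comp p l (F := p \Po tree_inv) :
  'X^N %| (1 - 'X) * ('X * F^`()) - l * F ->
  'X^N %| (1 - 'X) ^+ 4 * (theta (theta p) \Po tree_inv)
        - ('X * l *+ 2 + (1 - 'X) * 'X * l^`() + l ^+ 2) * F.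
Proof.
move=> h0; have hB := theta_comp p; have hB2 := theta_comp (theta p).
rewrite -/F in hB; move: hB hB2; set B := theta p \Po _; set B2 := theta (theta p) \Po _ => hB hB2.
(* Modulo X^N, (1 - X)^2 B = l F. Differentiating this and multiplying by X (1 - X) makes it
   possible to eliminate both derivatives, by [hB2] and by the hypothesis on [F]. *)
have h1 : 'X^N %| (1 - 'X) ^+ 2 * B - l * F.
  have -> : (1 - 'X) ^+ 2 * B - l * F =
    - (1 - 'X) * ('X * F^`() - (1 - 'X) * B) + ((1 - 'X) * ('X * F^`()) - l * F) by ring.
  by rewrite dvdp_add ?dvdp_mull.
have h2 := dvdXn_deriv h1.
have E : ((1 - 'X) ^+ 2 * B - l * F)^`() =
    (1 - 'X) ^+ 2 * B^`() - (1 - 'X) * B *+ 2 - l^`() * F - l * F^`().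
  by rewrite derivB expr2 !derivM derivB derivX -polyC1 derivC; ring.
rewrite E in h2.
have -> : (1 - 'X) ^+ 4 * B2 - ('X * l *+ 2 + (1 - 'X) * 'X * l^`() + l ^+ 2) * F =
  - (1 - 'X) ^+ 3 * ('X * B^`() - (1 - 'X) * B2)
  + (1 - 'X) * ('X * ((1 - 'X) ^+ 2 * B^`() - (1 - 'X) * B *+ 2 - l^`() * F - l * F^`()))
  + 'X *+ 2 * ((1 - 'X) ^+ 2 * B - l * F)
  + l * ((1 - 'X) * ('X * F^`()) - l * F) by ring.
by do 3?[apply: dvdp_add]; apply: dvdp_mull.
Qed.

(* Lagrange inversion for the tree function. *)
Lemma lagrange_inversion q m : (0 < m)%N -> (m < N)%N ->
  m%:R * q`_m = \sum_(i < m.+1) i%:R * (q \Po tree_inv)`_i * (m%:R ^+ (m - i) / (m - i)`!%:R).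
Proof.
move=> m0 mN; set H := q \Po _.
have -> : \sum_(i < m.+1) i%:R * H`_i * (m%:R ^+ (m - i) / (m - i)`!%:R) =
    (theta H * exp_poly m%:R)`_m.
  rewrite coefM; apply: eq_bigr => -[i im] _ /=; rewrite coef_theta coef_poly.
  by rewrite (leq_ltn_trans (leq_subr _ _) mN).
have h := theta_comp q; rewrite -/H -/(theta H) in h.
have h' : 'X^N %| theta H * exp_poly m%:R - (1 - 'X) * (theta q \Po tree_inv) * exp_poly m%:R.
  by rewrite -mulrBl dvdp_mulr.
rewrite (dvdXn_coef h' mN) comp_polyE mulr_sumr mulr_suml coef_sum.
(* By linearity only powers of [tree_inv] matter. For d = m - k positive the coefficient is d^d / d!
   - d^(d-1) / (d-1)! = 0, so only k = m survives. *)
have term k : ((1 - 'X) * ((theta q)`_k *: tree_inv ^+ k) * exp_poly m%:R)`_m =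
   k%:R * q`_k * (m == k)%:R.
  rewrite -scalerAr -scalerAl coefZ coef_theta; congr (_ * _).
  have hk : 'X^N %| (1 - 'X) * tree_inv ^+ k * exp_poly m%:R - (1 - 'X) * ('X^k * exp_poly (m%:R - k%:R)).
    have -> : (1 - 'X) * tree_inv ^+ k * exp_poly m%:R - (1 - 'X) * ('X^k * exp_poly (m%:R - k%:R)) =
      (1 - 'X) * exp_poly m%:R * (tree_inv ^+ k - 'X^k * exp_poly (- k%:R)) +
      (1 - 'X) * 'X^k * (exp_poly m%:R * exp_poly (- k%:R) - exp_poly (m%:R - k%:R)) by ring.
    by rewrite dvdp_add ?dvdp_mull ?tree_inv_exp ?exp_polyD.
  rewrite (dvdXn_coef hk mN) mulrBl mul1r coefB coefXM -[m == 0%N]negbK -lt0n m0 /= !coefXnM.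
  case: (ltngtP m k) => [mk|km|<-].
  - by rewrite (leq_ltn_trans (leq_pred _) mk) subrr.
  - rewrite !coef_poly (leq_ltn_trans (leq_subr _ _) mN).
    have -> : (m.-1 < k)%N = false by lia.
    have -> : (m.-1 - k < N)%N by lia.
    have -> : (m.-1 - k = (m - k).-1)%N by lia.
    rewrite -natrB ?(ltnW km) //; have : (0 < m - k)%N by lia.
    case: (m - k)%N => // d _ /=; rewrite factS natrM exprS.
    have f1 : (d`!%:R : rat) != 0 by rewrite pnatr_eq0 -lt0n fact_gt0.
    have f2 : (d.+1%:R : rat) != 0 by rewrite pnatr_eq0.
    move: (d`!%:R : rat) (d.+1%:R : rat) f1 f2 => a b fa fb.
    by field; rewrite fa fb.
  have -> : (m.-1 < m)%N by lia.
  rewrite subnn subrr coef_poly (leq_ltn_trans _ mN) // expr0 fact0 divr1 subr0 //.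
under eq_bigr => i _ do rewrite term.
have [mq|mq] := ltnP m (size (theta q)).
  rewrite (bigD1 (Ordinal mq)) //= eqxx mulr1 big1 ?addr0 // => -[i iq] ni /=.
  by rewrite (_ : m == i = false) ?mulr0 //; apply: contraNF ni => /eqP E; apply/eqP/val_inj.
rewrite big1; first by rewrite -coef_theta nth_default.
by move=> -[i iq] _ /=; rewrite (_ : m == i = false) ?mulr0 //; lia.
Qed.

End TreeSubstitution.

(** * Exponential generating functions and positivity of coefficients *)

Section Positivity.
Local Open Scope ring_scope.
Variable N : nat.
Implicit Types (p q F : {poly rat}) (a : rat) (e g : nat -> rat).

Lemma fact_neq0 k : (k`!%:R : rat) != 0.
Proof. by rewrite pnatr_eq0 -lt0n fact_gt0. Qed.

(** Exponential only in the vertices outside a fixed set of [c] vertices: X^c carries no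
    factorial. *)
Definition egf c e : {poly rat} := 'X^c * \poly_(k < N) (e k / k`!%:R).

(* Inclusion-exclusion over the leaves amounts to substituting [X exp (-X)] in
   the exponential generating function. *)
Lemma egf_comp c e g :
  (forall v, \sum_(i < v.+1) 'C(v, i)%:R * ((-1) ^+ i * ((v - i + c) ^ i)%:R * e (v - i)%N) = g v) ->
  'X^N %| (egf c e \Po tree_inv N) - egf c g.
Proof.
(* tree_inv^(c+k) is replaced by X^(c+k) exp (-(c+k) X), whose coefficients (-(c+k))^i / i! count,
   with sign, the ways of hanging i leaves on c + k vertices. *)
move=> H; pose S := \sum_(k < N) (e k / k`!%:R) *: ('X^k * exp_poly N (- (c + k)%:R)).
have -> : (egf c e \Po tree_inv N) - egf c g =
    \sum_(k < N) (e k / k`!%:R) *: (tree_inv N ^+ (c + k) - 'X^(c + k) * exp_poly N (- (c + k)%:R))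
    + 'X^c * (S - \poly_(k < N) (g k / k`!%:R)).
  rewrite /egf comp_polyM comp_Xn_poly poly_def raddf_sum mulrBr addrA; congr (_ - _).
  rewrite /S !mulr_sumr -big_split; apply: eq_bigr => k _ /=.
  rewrite comp_polyZ comp_Xn_poly scalerBr -scalerAr -exprD addrC !scalerAr.
  by rewrite mulrA -exprD addrC subrK.
apply: dvdp_add; last apply: dvdp_mull.
  apply: (big_ind (fun p => 'X^N %| p)) => [|p q|k _]; [exact: dvdp0|exact: dvdp_add|].
  by rewrite -mul_polyC; apply: dvdp_mull; apply: tree_inv_exp.
apply/dvdXnP=> v vN; rewrite coefB coef_poly vN -H coef_sum; apply/eqP; rewrite subr_eq0; apply/eqP.
rewrite (bigID (fun k : 'I_N => (k <= v)%N)) /= [X in _ + X]big1 ?addr0; last first.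
  by move=> k; rewrite -ltnNge coefZ coefXnM => ->; rewrite mulr0.
rewrite -(big_ord_widen N
  (fun k => ((e k / k`!%:R) *: ('X^k * exp_poly N (- (c + k)%:R)))`_v) vN).
rewrite mulr_suml [RHS](reindex_inj rev_ord_inj) /=; apply: eq_bigr => -[k kv] _ /=.
rewrite subSS subKn // coefZ coefXnM ltnNge -ltnS kv /= coef_poly (leq_ltn_trans (leq_subr _ _) vN).
have := bin_fact (kv : (k <= v)%N) => <-; rewrite bin_sub // !natrM.
rewrite [(- (c + k)%:R) ^+ _]exprNn natrX [(k + c)%N]addnC.
have f1 := fact_neq0 k; have f2 := fact_neq0 (v - k).
have f3 : ('C(v, k)%:R : rat) != 0 by rewrite pnatr_eq0 -lt0n bin_gt0.
move: (k`!%:R : rat) ((v - k)`!%:R : rat) ('C(v, k)%:R : rat) ((-1) ^+ _ : rat) (_%:R ^+ _ : rat) f1 f2 f3.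
by move=> f1 f2 b s t h1 h2 h3; field; rewrite h1 h2 h3.
Qed.

Lemma risingS a k : rising a k.+1 = rising a k * (a + k%:R).
Proof. by rewrite /rising big_ord_recr. Qed.

Lemma rising_gt0 a k : 0 < a -> 0 < rising a k.
Proof. by move=> a0; apply: prodr_gt0 => i _; rewrite ltr_wpDr. Qed.

(** For F = X^c (1 - X)^(-a) the quotient X F' / F is c + a X / (1 - X); this is its product with 1
    - X. It stands in for the fractional power. *)
Definition log_ode a c : {poly rat} := (1 - 'X) * c%:R + 'X * a%:P.

Lemma egf_rising_ode a c (F := egf c (rising a)) :
  'X^N %| (1 - 'X) * ('X * F^`()) - log_ode a c * F.
Proof.
rewrite /F /egf /log_ode; set G := \poly_(k < N) _.
have -> : (1 - 'X) * ('X * ('X^c * G)^`()) - ((1 - 'X) * c%:R + 'X * a%:P) * ('X^c * G) =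
  'X^c * ((1 - 'X) * ('X * G^`()) - 'X * a%:P * G).
  have -> : 'X * ('X^c * G)^`() = c%:R * ('X^c * G) + 'X^c * ('X * G^`()).
    rewrite derivM derivXn; case: c {F} => [|c] /=; first by rewrite !mulr0n expr0; ring.
    by rewrite exprS -['X^c *+ c.+1]mulr_natl; ring.
  by ring.
apply: dvdp_mull; apply/dvdXnP=> i iN.
rewrite coefB mulrBl mul1r coefB -mulrA -/(theta G) coef_theta ![('X * _)`_i]coefXM.
case: i iN => [|i] iN /=; first by rewrite mul0r !subrr.
rewrite coef_theta coefCM !coef_poly iN (ltnW iN) risingS factS natrM -[i.+1%:R]natr1.
have f1 := fact_neq0 i; have f2 : (i%:R + 1 : rat) != 0 by rewrite natr1 pnatr_eq0.
move: (i`!%:R : rat) (i%:R : rat) f1 f2 => f t h1 h2.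
by field; rewrite h1 h2.
Qed.

Lemma ode_congr F F' l : 'X^N %| F - F' ->
  'X^N %| (1 - 'X) * ('X * F'^`()) - l * F' -> 'X^N %| (1 - 'X) * ('X * F^`()) - l * F.
Proof.
move=> h h'; have h2 := dvdXn_deriv h; rewrite derivB in h2.
have -> : (1 - 'X) * ('X * F^`()) - l * F =
  (1 - 'X) * ('X * (F^`() - F'^`())) - l * (F - F') + ((1 - 'X) * ('X * F'^`()) - l * F') by ring.
by apply: dvdp_add => //; apply: dvdp_sub; apply: dvdp_mull.
Qed.

(** Dividing by 1 - X takes partial sums: signs are kept, and one positive coefficient makes all
    later ones positive. *)
Lemma coef_div_1X p q m : 'X^N %| (1 - 'X) * p - q -> (forall i, (i < N)%N -> 0 <= q`_i) ->
  (forall i, (i < N)%N -> 0 <= p`_i) /\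
  ((m < N)%N -> 0 < q`_m -> forall i, (m <= i < N)%N -> 0 < p`_i).
Proof.
move=> h q0.
have pE i : (i < N)%N -> p`_i = q`_i + (if i is j.+1 then p`_j else 0).
  move=> iN; rewrite -(dvdXn_coef h iN) mulrBl mul1r coefB coefXM.
  by case: i iN => [|i] _ /=; rewrite ?subr0 ?addr0 ?subrK.
have p0 i : (i < N)%N -> 0 <= p`_i.
  elim: i => [|i IH] iN; rewrite pE //; apply: addr_ge0 => //; try exact: q0.
  exact/IH/ltnW.
split=> // mN qm; elim=> [|i IH] /andP [mi iN]; rewrite pE //.
  by move: mi qm; rewrite leqn0 => /eqP->; rewrite addr0.
move: mi; rewrite leq_eqVlt => /predU1P [<-|mi].
  by rewrite ltr_wpDr // p0 // ltnW.
by apply: ltr_wpDl; [exact: q0 | apply: IH; rewrite -ltnS mi ltnW].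
Qed.

End Positivity.

(** * The inequality between coefficients *)

Section Inequality.
Local Open Scope ring_scope.

Lemma log_odeE a c : log_ode a c = (c%:R)%:P + (a - c%:R)%:P * 'X.
Proof. by rewrite /log_ode polyCB polyC_natr; ring. Qed.

Lemma theta2_quadratic (c0 c1 : rat) (l := c0%:P + c1%:P * 'X) :
  'X * l *+ 2 + (1 - 'X) * 'X * l^`() + l ^+ 2 =
  (c0 ^+ 2)%:P + (2 * c0 + c1 + 2 * c0 * c1)%:P * 'X + (c1 + c1 ^+ 2)%:P * 'X ^+ 2.
Proof.
by rewrite /l derivD derivC deriv_mulC derivX !polyCD !rmorphXn /= !polyCM -[2]/(2%:R) polyC_natr; ring.
Qed.

Lemma quadratic_comb (k a b c b2 c2 : rat) :
  k%:P * (a%:P + b%:P * 'X + c%:P * 'X ^+ 2) - (b2%:P * 'X + c2%:P * 'X ^+ 2) =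
  (k * a)%:P + (k * b - b2)%:P * 'X + (k * c - c2)%:P * 'X ^+ 2.
Proof. by rewrite !polyCB !polyCM; ring. Qed.

Lemma coef_egf N c g i : (i < N)%N ->
  (egf N c g)`_i = if (i < c)%N then 0 else g (i - c)%N / ((i - c)`!)%:R.
Proof.
by move=> iN; rewrite coefXnM; case: ifP => // _; rewrite coef_poly (leq_ltn_trans (leq_subr _ _) iN).
Qed.

Section Coefficient.
Variables (r n : nat) (e u : nat -> rat).
Hypotheses (r0 : (1 <= r)%N) (rn : (2 * r <= n)%N).
Hypothesis eE : forall v,
  \sum_(i < v.+1) 'C(v, i)%:R * ((-1) ^+ i * ((v - i + 2 * r) ^ i)%:R * e (v - i)%N) = rising (3 * r)%:R v.
Hypothesis uE : forall v,
  \sum_(i < v.+1) 'C(v, i)%:R * ((-1) ^+ i * ((v - i) ^ i)%:R * u (v - i)%N) = rising 2^-1 v.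

(* [1 - r (r + 1) / ((r + 1/6) (r + 5/6))] *)
Definition both_uni_limit : rat := 5 / ((6 * r%:R + 1) * (6 * r%:R + 5)).

Let N := n.+1.
Let K := both_uni_limit.
Let p1 := egf N (2 * r) e.
Let p2 := egf N 0 u.
Let D := p1 \Po tree_inv N.
Let C := p2 \Po tree_inv N.
Let D0 := egf N (2 * r) (rising (3 * r)%:R).
Let C0 := egf N 0 (rising 2^-1).
(** The quadratic polynomial attached to [H] has constant coefficient [a'] and leading coefficient
    [- b']; as it vanishes at 1, it is (1 - X) (a' + b' X). *)
Let a' : rat := K * (2 * r%:R) ^+ 2.
Let b' : rat := 3 / 4 - K * (r%:R + 2^-1) * (r%:R + 3 / 2).
Let q := K%:P * theta (theta (p1 * p2)) - p1 * theta (theta p2).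
Let H := q \Po tree_inv N.

Let rR : (1 : rat) <= r%:R. Proof. by rewrite ler1n. Qed.

Let K0 : 0 < K.
Proof.
by apply: divr_gt0 => //; apply: mulr_gt0; move: rR; move: (r%:R : rat) => x; lra.
Qed.

Let KE : K * ((6 * r%:R + 1) * (6 * r%:R + 5)) = 5.
Proof.
rewrite /K /both_uni_limit divfK //; apply: mulf_neq0; apply: lt0r_neq0; move: rR;
  move: (r%:R : rat) => x; lra.
Qed.

Let a'0 : 0 < a'. Proof. by rewrite mulr_gt0 // exprn_gt0 // mulr_gt0 // (lt_le_trans _ rR). Qed.

Let b'0 : 0 <= b'.
Proof.
move: K0 KE rR; rewrite /b'; move: (r%:R : rat) => x.
move: K => k k0 kE x1.
(* Writing 3/4 as [k (6x + 1) (6x + 5) * 3 / 20] lets [k] be factored out, and leaves a polynomial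
   inequality in [x]. *)
have : k * ((6 * x + 1) * (6 * x + 5)) * 3 / 20 - k * (x + 2^-1) * (x + 3 / 2) =
  k * ((6 * x + 1) * (6 * x + 5) * 3 / 20 - (x + 2^-1) * (x + 3 / 2)) by field.
rewrite kE => E; have -> : (3 / 4 : rat) = 5 * 3 / 20 by field.
rewrite E mulr_ge0 ?ltW //; nra.
Qed.

Let hD : 'X^N %| D - D0. Proof. exact: egf_comp. Qed.

Let hC : 'X^N %| C - C0.
Proof. by apply: egf_comp => v; rewrite -uE; apply: eq_bigr => i _; rewrite addn0. Qed.

Let l1 := log_ode (3 * r)%:R (2 * r).
Let l2 := log_ode 2^-1 0.

Let odeD : 'X^N %| (1 - 'X) * ('X * D^`()) - l1 * D.
Proof. by apply: ode_congr hD _; apply: egf_rising_ode. Qed.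

Let odeC : 'X^N %| (1 - 'X) * ('X * C^`()) - l2 * C.
Proof. by apply: ode_congr hC _; apply: egf_rising_ode. Qed.

(* The value [both_uni_limit] of [K] is the one for which the quadratic polynomial
   arising from [theta2_quadratic] vanishes at 1, which frees a factor [1 - X]. *)
Let HV : 'X^N %| (1 - 'X) ^+ 3 * H - D * C * (a'%:P + b'%:P * 'X).
Proof.
have FE : p1 * p2 \Po tree_inv N = D * C by rewrite comp_polyM.
have odeF : 'X^N %| (1 - 'X) * ('X * (p1 * p2 \Po tree_inv N)^`()) - (l1 + l2) * (p1 * p2 \Po tree_inv N).
  rewrite FE derivM.
  have -> : (1 - 'X) * ('X * (D^`() * C + D * C^`())) - (l1 + l2) * (D * C) =
    C * ((1 - 'X) * ('X * D^`()) - l1 * D) + D * ((1 - 'X) * ('X * C^`()) - l2 * C) by ring.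
  by apply: dvdp_add; apply: dvdp_mull.
have := theta2_comp odeF; have := theta2_comp odeC; rewrite FE -/C.
set A2 := _ \Po _; set B2 := theta (theta (p1 * p2)) \Po _.
have -> : l2 = (0 : rat)%:P + (2^-1)%:P * 'X by rewrite /l2 log_odeE subr0.
have -> : l1 + ((0 : rat)%:P + (2^-1)%:P * 'X) = (2 * r%:R)%:P + (r%:R + 2^-1)%:P * 'X.
  rewrite /l1 log_odeE !natrM polyC0 add0r -addrA -mulrDl -polyCD; congr (_ + _%:P * _); ring.
rewrite !theta2_quadratic => h2 h1; apply: dvdXn_cancel.
have HE : H = K%:P * B2 - D * A2 
  by rewrite /H /q comp_polyB (comp_polyM K%:P) (comp_polyM p1) comp_polyC.
set W1 := (X in _ - X * (D * C)) in h1; set W2 := (X in _ - X * C) in h2.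
have WE : K%:P * W1 - W2 = (1 - 'X) * (a'%:P + b'%:P * 'X).
  transitivity (a'%:P +
    (K * (2 * (2 * r%:R) + (r%:R + 2^-1) + 2 * (2 * r%:R) * (r%:R + 2^-1)) - 2^-1)%:P * 'X +
    (K * ((r%:R + 2^-1) + (r%:R + 2^-1) ^+ 2) - 3 / 4)%:P * 'X ^+ 2).
    rewrite /W1 /W2 /a'.
    have -> : (2 * 0 + 2^-1 + 2 * 0 * 2^-1 : rat) = 2^-1 by field.
    have -> : (2^-1 + 2^-1 ^+ 2 : rat) = 3 / 4 by field.
    by rewrite expr0n polyC0 add0r; apply: quadratic_comb.
  have -> : K * ((r%:R + 2^-1) + (r%:R + 2^-1) ^+ 2) - 3 / 4 = - b' by rewrite /b'; field.
  have -> : K * (2 * (2 * r%:R) + (r%:R + 2^-1) + 2 * (2 * r%:R) * (r%:R + 2^-1)) - 2^-1 = b' - a'.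
    apply/eqP; rewrite -subr_eq0; apply/eqP.
    (* At X = 1 the quadratic of [theta2_quadratic] is l(1) (l(1) + 2), with l(1) = 3r + 1/2 for the
       product and 1/2 for the unicyclic factor. The weighted difference is this multiple of the
       defining equation of [K]. *)
    transitivity ((K * ((6 * r%:R + 1) * (6 * r%:R + 5)) - 5) / 4); last by rewrite KE subrr mul0r.
    by rewrite /b' /a'; field.
  by move: a' b' => a b; rewrite polyCN polyCB; ring.
move: h1 h2 HE WE; move: H D C A2 B2 W1 W2 a' b' => H0 D1 C1 A2 B2 W1 W2 a b h1 h2 HE WE.
have -> : (1 - 'X) * ((1 - 'X) ^+ 3 * H0 - D1 * C1 * (a%:P + b%:P * 'X)) =
  K%:P * ((1 - 'X) ^+ 4 * B2 - W1 * (D1 * C1)) - D1 * ((1 - 'X) ^+ 4 * A2 - W2 * C1).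
  transitivity ((1 - 'X) ^+ 4 * H0 - D1 * C1 * ((1 - 'X) * (a%:P + b%:P * 'X))); first by ring.
  by rewrite -WE HE; ring.
by apply: dvdp_sub; apply: dvdp_mull.
Qed.

Let coefDC i : (i < N)%N -> (D * C)`_i = (D0 * C0)`_i.
Proof.
apply: dvdXn_coef.
have -> : D * C - D0 * C0 = C * (D - D0) + D0 * (C - C0) by ring.
by apply: dvdp_add; apply: dvdp_mull.
Qed.

Let half0 : (0 : rat) < 2^-1. Proof. by rewrite invr_gt0. Qed.
Let r30 : (0 : rat) < (3 * r)%:R. Proof. by rewrite ltr0n muln_gt0. Qed.

Let egf_rising_ge0 a c i : 0 < a -> (i < N)%N -> 0 <= (egf N c (rising a))`_i.
Proof.
move=> a0 iN; rewrite coef_egf //; case: ifP => // _.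
by rewrite divr_ge0 ?ler0n // ltW // rising_gt0.
Qed.

Let coefDC_ge0 i : (i < N)%N -> 0 <= (D * C)`_i.
Proof.
move=> iN; rewrite coefDC // coefM; apply: sumr_ge0 => -[j ji] _ /=.
apply: mulr_ge0; apply: egf_rising_ge0 => //; apply: leq_ltn_trans iN; first by rewrite -ltnS.
exact: leq_subr.
Qed.

Let coefDC_gt0 : 0 < (D * C)`_(2 * r).
Proof.
rewrite coefDC // coefM (bigD1 ord_max) //= subnn; apply: ltr_wpDr.
  apply: sumr_ge0 => -[j ji] _ /=.
  apply: mulr_ge0; apply: egf_rising_ge0 => //; apply: leq_ltn_trans (_ : (2 * r < N)%N) => //.
    exact: leq_subr.
apply: mulr_gt0; rewrite coef_egf ?ltnn //= ?subnn; apply: divr_gt0; rewrite ?rising_gt0 ?ltr0n ?fact_gt0 //.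
by rewrite muln_gt0.
Qed.

Let V := D * C * (a'%:P + b'%:P * 'X).

Let coefV i : V`_i = a' * (D * C)`_i + b' * (if i is j.+1 then (D * C)`_j else 0).
Proof.
rewrite /V; move: (D * C) a' b' => F a b.
have -> : F * (a%:P + b%:P * 'X) = a%:P * F + b%:P * ('X * F) by ring.
by rewrite coefD !coefCM coefXM; case: i.
Qed.

Let V_ge0 i : (i < N)%N -> 0 <= V`_i.
Proof.
move=> iN; rewrite coefV; apply: addr_ge0; apply: mulr_ge0; [exact: ltW|exact: coefDC_ge0|exact: b'0|].
by case: i iN => // i /ltnW iN; apply: coefDC_ge0.
Qed.

Let V_gt0 : 0 < V`_(2 * r).
Proof.
rewrite coefV; apply: ltr_wpDr; last exact: mulr_gt0.
apply: mulr_ge0; first exact: b'0.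
case E : (2 * r)%N => [|i]; first by [].
by apply: coefDC_ge0; rewrite ltnS; apply: leq_trans rn; rewrite E ltnW.
Qed.

Let H_pos : (forall i, (i < N)%N -> 0 <= H`_i) /\ 0 < H`_n.
Proof.
have rN : (2 * r < N)%N by [].
have n1 : (2 * r <= n < N)%N by rewrite rn ltnSn.
have h3 : 'X^N %| (1 - 'X) * ((1 - 'X) * ((1 - 'X) * H)) - V.
  by have := HV; rewrite -/V !exprS expr0 mulr1 -!mulrA.
have h2 : 'X^N %| (1 - 'X) * ((1 - 'X) * H) - (1 - 'X) * ((1 - 'X) * H) by rewrite subrr dvdp0.
have h1 : 'X^N %| (1 - 'X) * H - (1 - 'X) * H by rewrite subrr dvdp0.
(* Since (1 - X)^3 H = V, three successive partial sums carry the positive coefficient of X^(2r) up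
   to X^n. *)
have [g3 s3] := coef_div_1X (2 * r) h3 V_ge0.
have [g2 s2] := coef_div_1X (2 * r) h2 g3.
have [g1 s1] := coef_div_1X (2 * r) h1 g2.
have rr : (2 * r <= 2 * r < N)%N by rewrite leqnn.
by split=> //; exact: (s1 rN (s2 rN (s3 rN V_gt0 _ rr) _ rr) _ n1).
Qed.

Lemma egf_coef_gt0 :
  0 < (both_uni_limit%:P * theta (theta (egf n.+1 (2 * r) e * egf n.+1 0 u)) -
       egf n.+1 (2 * r) e * theta (theta (egf n.+1 0 u)))`_n.
Proof.
rewrite -/K -/N -/p1 -/p2 -/q.
have n0 : (0 < n)%N by apply: leq_trans rn; rewrite muln_gt0.
have nR : (0 : rat) < n%:R by rewrite ltr0n.
(* Lagrange inversion expresses the coefficient by those of [H] with nonnegative factors; the last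
   summand is n times a positive coefficient. *)
rewrite -(pmulr_rgt0 _ nR) (@lagrange_inversion N) // -/H big_ord_recr /= subnn.
have [g s] := H_pos; apply: ltr_wpDl; last by rewrite expr0 fact0 invr1 !mulr1; exact: mulr_gt0.
apply: sumr_ge0 => -[i iN] _ /=; rewrite !mulr_ge0 ?invr_ge0 ?exprn_ge0 ?ler0n ?g //.
exact: ltnW.
Qed.

End Coefficient.

(** The coefficient of X^n times (n - 2r)!, with [k] the number of unicyclic vertices. Two
    applications of [theta] produce n^2 on the product and k^2 on the unicyclic factor, that is, the
    numbers of all vertex pairs and of unicyclic ones. *)
Lemma weighted_sum_gt0 (r n : nat) (e u : nat -> rat) :
  (1 <= r)%N -> (2 * r <= n)%N ->
  (forall v, \sum_(i < v.+1) 'C(v, i)%:R *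
     ((-1) ^+ i * ((v - i + 2 * r) ^ i)%:R * e (v - i)%N) = rising (3 * r)%:R v) ->
  (forall v, \sum_(i < v.+1) 'C(v, i)%:R *
     ((-1) ^+ i * ((v - i) ^ i)%:R * u (v - i)%N) = rising 2^-1 v) ->
  0 < \sum_(k < (n - 2 * r).+1) 'C(n - 2 * r, k)%:R *
        ((both_uni_limit r * n%:R ^+ 2 - k%:R ^+ 2) * (e (n - 2 * r - k)%N * u k)).
Proof.
move=> r0 rn eE uE; have := egf_coef_gt0 r0 rn eE uE.
move: (both_uni_limit r) => K; rewrite coefB coefCM !coef_theta !coefMr.
rewrite !mulr_sumr -sumrB /= => q0.
have f0 : (0 : rat) < (n - 2 * r)`!%:R by rewrite ltr0n fact_gt0.
rewrite -(pmulr_rgt0 _ f0) (bigID (fun k : 'I_n.+1 => (k < (n - 2 * r).+1)%N)) /= in q0.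
(* For k > n - 2r the complex factor vanishes, since it is divisible by X^(2r). *)
rewrite [X in _ + X]big1 ?addr0 in q0; last first.
  move=> -[k kn] /=; rewrite -leqNgt => kr.
  rewrite (@coef_egf _ (2 * r)) ?ltnS ?leq_subr // ifT; last by lia.
  by rewrite !mul0r !mulr0 subrr.
rewrite -(big_ord_widen n.+1 (fun i => K * (n%:R * (n%:R * ((egf n.+1 (2 * r) e)`_(n - i) * (egf n.+1 0 u)`_i))) -
     (egf n.+1 (2 * r) e)`_(n - i) * (theta (theta (egf n.+1 0 u)))`_i)) in q0; last by rewrite ltnS leq_subr.
rewrite mulr_sumr in q0; apply: (lt_le_trans q0); rewrite le_eqVlt; apply/orP; left; apply/eqP.
apply: eq_bigr => -[k kr] _ /=.
rewrite !coef_theta !coef_egf ?ltnS ?leq_subr //; last by lia.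
rewrite ltn0 subn0 ifF; last by lia.
have -> : (n - k - 2 * r = n - 2 * r - k)%N by lia.
have := bin_fact (kr : (k <= n - 2 * r)%N) => <-; rewrite !natrM.
have f1 := fact_neq0 k; have f2 := fact_neq0 (n - 2 * r - k).
move: (k`!%:R : rat) ((n - 2 * r - k)`!%:R : rat) f1 f2 => f1 f2 h1 h2.
by field; rewrite h1 h2.
Qed.

End Inequality.

(** * Inclusion-exclusion over leaves *)

Section SubsetSums.
Local Open Scope ring_scope.
Variables (R : comNzRingType) (T : finType).
Implicit Types (S L B : {set T}).

Lemma sum_subsets S (f : nat -> R) :
  \sum_(L : {set T} | L \subset S) f #|L| = \sum_(i < #|S|.+1) 'C(#|S|, i)%:R * f i.
Proof.
rewrite (partition_big (fun L : {set T} => inord #|L| : 'I_(#|S|.+1)) xpredT) //=.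
apply: eq_bigr => i _; rewrite [X in X%:R * _](_ : _ =
  #|[set L : {set T} | L \subset S & #|L| == i]|); last by rewrite cards_draws.
rewrite -[X in X%:R * _]sum1_card natr_sum mulr_suml.
have E L : (L \in [set L : {set T} | L \subset S & #|L| == i]) =
   (L \subset S) && (inord #|L| == i :> 'I_(#|S|.+1)).
  rewrite inE; case LS: (L \subset S) => //=.
  by rewrite -(inj_eq val_inj) /= inordK // ltnS subset_leq_card.
rewrite [RHS](eq_bigl _ _ E); apply: eq_bigr => L /andP [LS /eqP Li].
by rewrite mul1r -Li inordK // ltnS subset_leq_card.
Qed.

Lemma sum_subsets_sign S :
  \sum_(L : {set T} | L \subset S) (-1) ^+ #|L| = (S == set0)%:R :> R.
Proof.
rewrite (sum_subsets S (fun i => (-1) ^+ i)) -cards_eq0 -expr0n -[X in _ = X ^+ _](subrr 1) exprDn.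
by apply: eq_bigr => i _; rewrite expr1n mul1r mulr_natl.
Qed.

Lemma sum_subsets2 S B (f : nat -> nat -> R) :
  \sum_(L : {set T} | L \subset S) f #|L :&: B| #|L :\: B| =
  \sum_(i < #|S :&: B|.+1) \sum_(j < #|S :\: B|.+1)
     'C(#|S :&: B|, i)%:R * 'C(#|S :\: B|, j)%:R * f i j.
Proof.
transitivity (\sum_(L1 : {set T} | L1 \subset S :&: B)
                \sum_(L2 : {set T} | L2 \subset S :\: B) f #|L1| #|L2|).
  rewrite pair_big_dep /= (reindex_onto (fun p : {set T} * {set T} => p.1 :|: p.2)
    (fun L => (L :&: B, L :\: B))) /=; last by move=> L _; rewrite setID.
  have key (p : {set T} * {set T}) : p.1 \subset S :&: B -> p.2 \subset S :\: B ->
      (p.1 :|: p.2) :&: B = p.1 /\ (p.1 :|: p.2) :\: B = p.2.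
    move=> /subsetP s1 /subsetP s2; split; apply/setP=> a; rewrite !inE.
      have := s1 a; have := s2 a; rewrite !inE.
      by case: (a \in p.1); case: (a \in p.2); case: (a \in B) => //= h2 h1;
        first [by have := h1 isT; rewrite ?andbF | by have := h2 isT; rewrite ?andbF].
    have := s1 a; have := s2 a; rewrite !inE.
    by case: (a \in p.1); case: (a \in p.2); case: (a \in B) => //= h2 h1;
        first [by have := h1 isT; rewrite ?andbF | by have := h2 isT; rewrite ?andbF].
  apply: eq_big => [p|p /andP [_ /eqP E]].
    apply/andP/andP => [[US /eqP E]|[s1 s2]].
      move: E; rewrite [in X in _ = X -> _](surjective_pairing p) => -[E1 E2].
      by split; [rewrite -E1 setSI | rewrite -E2 setSD].
    have [-> ->] := key p s1 s2; split; last by case: (p).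
    by rewrite subUset (subset_trans s1 (subsetIl _ _)) (subset_trans s2 (subsetDl _ _)).
  by rewrite -[in RHS]E.
rewrite (sum_subsets (S :&: B)
  (fun i => \sum_(L2 : {set T} | L2 \subset S :\: B) f i #|L2|)).
apply: eq_bigr => i _; rewrite (sum_subsets (S :\: B) (f i)) mulr_sumr.
by apply: eq_bigr => j _; rewrite mulrA.
Qed.

End SubsetSums.

Section InclusionExclusion.
Variables (n r : nat).
Implicit Types (G : multigraph n) (M : 'M[nat]_n) (A B C L S T : {set 'I_n}).

Local Open Scope ring_scope.

(** Vertices of [L] attach only to vertices outside [L] on their own side. That set stays the same
    while the leaves are removed one by one, so each leaf contributes the same factor. *)
Lemma cyclic_weight_leaves A B C L : B \subset A -> L \subset A :\: C ->
  cyclic_weight r A B C L =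
  (#|B :\: L| ^ #|L :&: B| * #|A :\: B :\: L| ^ #|L :\: B|)%N%:R *
  cyclic_weight r (A :\: L) (B :\: L) C set0.
Proof.
move En : #|L| => m; elim: m A B L En => [|m IH] A B L Lm BA LA.
  by rewrite (cards0_eq Lm) !set0I !set0D !setD0 cards0 mul1r.
have [x xL] : exists x, x \in L by apply/set0Pn; rewrite -cards_eq0 Lm.
have := subsetP LA x xL; rewrite inE => /andP [xC xA].
have LA' : L \subset A by apply: subset_trans LA (subsetDl _ _).
rewrite (cyclic_weight_leaf _ xA BA xC xL LA') IH; first last.
- apply/subsetP=> a; rewrite !inE => /andP [-> aL].
  by have := subsetP LA a aL; rewrite inE.
- exact: setSD.
- by move: Lm; rewrite (cardsD1 x L) xL => [[]].
have DD S : S :\ x :\: (L :\ x) = S :\: L.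
  by apply/setP=> a; rewrite !inE; have [->|] := eqVneq a x; rewrite ?xL ?andbF.
rewrite !DD mulrA -natrM; congr (_%:R * _).
have -> : (A :\ x) :\: (B :\ x) :\: (L :\ x) = A :\: B :\: L.
  by apply/setP=> a; rewrite !inE; have [->|] := eqVneq a x; rewrite ?xL ?andbF.
case: ifP => xB.
  have -> : (L :\ x) :\: (B :\ x) = L :\: B.
    by apply/setP=> a; rewrite !inE; have [->|] := eqVneq a x; rewrite ?xB ?andbF.
  have -> : #|L :&: B| = #|(L :\ x) :&: (B :\ x)|.+1.
    rewrite (cardsD1 x) inE xL xB; congr (_.+1); congr #|pred_of_set _|.
    by apply/setP=> a; rewrite !inE; have [->|] := eqVneq a x.
  by rewrite expnS mulnA.
have -> : (L :\ x) :&: (B :\ x) = L :&: B.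
  by apply/setP=> a; rewrite !inE; have [->|] := eqVneq a x; rewrite ?xB ?andbF.
have -> : #|L :\: B| = #|(L :\ x) :\: (B :\ x)|.+1.
  rewrite (cardsD1 x) inE xL xB; congr (_.+1); congr #|pred_of_set _|.
  by apply/setP=> a; rewrite !inE; have [->|] := eqVneq a x.
by rewrite expnS mulnCA mulnA.
Qed.

Lemma leaves_sub A B C M : cyclic_class r A B C M -> leaves A M \subset A :\: C.
Proof.
move=> cM; apply/subsetP=> l; rewrite !inE => /andP [lA /eqP dl]; rewrite lA andbT.
have [_ _ /and4P [_ _ _ /andP [_ /eqP CE]]] := and3P cM.
rewrite -CE; apply: contraTN isT; rewrite inE => /andP [lk /eqP dk].
have : (deg (Multigraph (kernel (Multigraph A M)) M) l <= deg (Multigraph A M) l)%N.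
  apply: leq_deg_sub; apply: subset_trans (two_core_sub _ _) _.
  by apply/subsetP=> a; rewrite inE => /andP [].
by rewrite dk dl.
Qed.

Lemma inclusion_exclusion A B C :
  \sum_(L : {set 'I_n} | L \subset A :\: C) (-1) ^+ #|L| * cyclic_weight r A B C L =
  core_weight r A B C.
Proof.
pose P (N : 'M['I_(n + r).+1]_n) := cyclic_class r A B C (nat_mx N).
have cwE L : cyclic_weight r A B C L =
    \sum_(N | P N) if L \subset leaves A (nat_mx N) then kap (nat_mx N) else 0.
  exact: (big_mkcondr _ _ P).
under eq_bigr => L _ do rewrite cwE mulr_sumr.
rewrite exchange_big /core_weight /weight.
rewrite [RHS](eq_bigl _ _ (fun N => core_classE r A B C (nat_mx N))) [RHS](big_mkcondr _ _ P) /=.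
apply: eq_bigr => N cM; set M := nat_mx N in cM *.
have lC := leaves_sub cM.
(* For a fixed [M] the signed sum over the subsets of its leaves vanishes unless there are none. *)
transitivity (\sum_(L : {set 'I_n} | L \subset leaves A M) (-1) ^+ #|L| * kap M).
  rewrite [RHS]big_mkcond [LHS]big_mkcond; apply: eq_bigr => L _.
  case: (boolP (L \subset leaves A M)) => Ll; last by rewrite mulr0 if_same.
  by rewrite (subset_trans Ll lC).
rewrite -mulr_suml sum_subsets_sign.
have -> : (leaves A M == set0) = [forall x in A, deg (Multigraph A M) x != 1%N].
  apply/eqP/forall_inP => [E x xA|H].
    apply/negP=> dx; have : x \in leaves A M by rewrite inE xA.
    by rewrite E inE.
  by apply/setP=> x; rewrite !inE; apply/negP=> /andP [/H /negPf ->].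
by case: ifP => _; rewrite ?mul1r ?mul0r.
Qed.

(** The recursion factors become rising factorials: |B| - 1/2 is 1/2 + (|B| - 1), and on the complex
    side, with v vertices besides the 2r of [C], (v + 2r) - 1 + r is 3r + (v - 1). *)
Lemma core_weightE A B C : B \subset A -> C \subset A :\: B -> #|C| = (2 * r)%N ->
  core_weight r A B C =
  rising (3 * r)%:R #|A :\: B :\: C| * rising 2^-1 #|B| * core_weight r C set0 C.
Proof.
move=> + + cC; move En : #|A| => m; elim: m A B En => [|m IH] A B Am BA CA.
  move: BA CA; rewrite (cards0_eq Am) subset0 => /eqP->; rewrite set0D subset0 => /eqP->.
  by rewrite !set0D /rising cards0 !big_ord0 !mul1r.
have [AC0|[x xAC]] := set_0Vmem (A :\: C).
  have AE : A = C.
    apply/eqP; rewrite eqEsubset -setD_eq0 AC0 eqxx (subset_trans CA (subsetDl _ _)) //.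
  have B0 : B = set0.
    apply/setP=> a; rewrite inE; apply/negP=> aB; have := subsetP BA a aB.
    by rewrite AE => /(subsetP CA); rewrite inE aB.
  by rewrite AE B0 setD0 setDv /rising cards0 !big_ord0 !mul1r.
move: xAC; rewrite inE => /andP [xC xA].
have Am' : #|A :\ x| = m by move: Am; rewrite (cardsD1 x A) xA => [[]].
have CA' : C \subset (A :\ x) :\: (B :\ x).
  apply/subsetP=> a aC; have := subsetP CA a aC; rewrite !inE.
  by have [E|] := eqVneq a x; [rewrite -E aC in xC | case: (a \in B)].
rewrite (core_weight_rec r xA BA xC) (IH _ _ Am' (setSD _ BA) CA'); case: ifP => xB.
  have -> : (A :\ x) :\: (B :\ x) :\: C = A :\: B :\: C.
    by apply/setP=> a; rewrite !inE; have [->|] := eqVneq a x; rewrite ?xB ?andbF.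
  by rewrite (cardsD1 x B) xB /rising big_ord_recr /= natrD; field.
have -> : B :\ x = B.
  by apply/setP=> a; rewrite !inE; case: eqP => // ->; rewrite xB.
have vE : #|A :\: B :\: C| = #|(A :\ x) :\: B :\: C|.+1.
  rewrite (cardsD1 x) !inE xB xA xC /=; congr (_.+1); congr #|pred_of_set _|.
  by apply/setP=> a; rewrite !inE; have [->|] := eqVneq a x; rewrite ?andbF.
have ABE : #|A :\: B| = (#|A :\: B :\: C| + 2 * r)%N.
  by rewrite -(cardsID C (A :\: B)) (setIidPr CA) cC addnC.
by rewrite ABE vE /rising big_ord_recr /= !natrD -natr1; ring.
Qed.

Section Product.
Variables e u : nat -> rat.
Hypothesis eE : forall v,
  \sum_(i < v.+1) 'C(v, i)%:R * ((-1) ^+ i * ((v - i + 2 * r) ^ i)%:R * e (v - i)%N) = rising (3 * r)%:R v.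
Hypothesis uE : forall v,
  \sum_(i < v.+1) 'C(v, i)%:R * ((-1) ^+ i * ((v - i) ^ i)%:R * u (v - i)%N) = rising 2^-1 v.

(** The inclusion-exclusion sum of the claimed products equals the core weight, as does that of the
    true weights. The terms with [L] nonempty agree by induction on [#|A|], hence so do the terms at
    [set0]. *)
Lemma cyclic_weightE A B C : B \subset A -> C \subset A :\: B -> #|C| = (2 * r)%N ->
  cyclic_weight r A B C set0 = e #|A :\: B :\: C| * u #|B| * core_weight r C set0 C.
Proof.
move=> + + cC; have [m] := ubnP #|A|; elim: m A B => // m IH A B Am BA CA.
pose D := core_weight r C set0 C.
pose F (L : {set 'I_n}) := (-1) ^+ #|L| *
  ((#|B :\: L| ^ #|L :&: B| * #|A :\: B :\: L| ^ #|L :\: B|)%N%:R *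
  (e #|(A :\: L) :\: (B :\: L) :\: C| * u #|B :\: L| * D)).
have FE : \sum_(L : {set 'I_n} | L \subset A :\: C) F L = core_weight r A B C.
  rewrite core_weightE //; set k := #|B|; set v := #|A :\: B :\: C|.
  pose f i j := (-1) ^+ (i + j) * (((k - i) ^ i * (v - j + 2 * r) ^ j)%N%:R *
     (e (v - j)%N * u (k - i)%N * D)) : rat.
  transitivity (\sum_(L : {set 'I_n} | L \subset A :\: C) f #|L :&: B| #|L :\: B|).
    apply: eq_bigr => L LA; rewrite /F /f cardsID.
    have e1 : #|B :\: L| = (k - #|L :&: B|)%N by rewrite cardsD setIC.
    have e2 : #|(A :\: L) :\: (B :\: L) :\: C| = (v - #|L :\: B|)%N.
      have -> : (A :\: L) :\: (B :\: L) :\: C = (A :\: B :\: C) :\: L.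
        apply/setP=> a; rewrite !inE; case: (a \in L); rewrite ?andbF //=.
      rewrite cardsD; congr (_ - #|pred_of_set _|)%N; apply/setP=> a; rewrite !inE.
      have := subsetP LA a; rewrite !inE.
      by case: (a \in L) => [/(_ isT) /andP [-> ->]|_]; rewrite ?andbF ?andbT.
    have e3 : #|A :\: B :\: L| = (v - #|L :\: B| + 2 * r)%N.
      rewrite -e2 -cC -(cardsID C (A :\: B :\: L)) addnC; congr (_ + _)%N.
        congr #|pred_of_set _|; apply/setP=> a; rewrite !inE.
        by case: (a \in L); rewrite ?andbF //=.
      congr #|pred_of_set _|; apply/setP=> a; rewrite !inE.
      have := subsetP LA a; have := subsetP CA a; rewrite !inE.
      case: (a \in C) => [/(_ isT) /andP [-> ->]|_]; last by rewrite andbF.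
      by case: (a \in L) => // /(_ isT).
    by rewrite e1 e2 e3.
  rewrite sum_subsets2.
  have -> : (A :\: C) :&: B = B.
    apply/setP=> a; rewrite !inE; have := subsetP BA a; have := subsetP CA a; rewrite !inE.
    by case: (a \in B); rewrite ?andbF //= andbT; case: (a \in C) => [/(_ isT)|_ /(_ isT)->].
  have -> : (A :\: C) :\: B = A :\: B :\: C by rewrite setDDl setUC -setDDl.
  rewrite -/k -/v -(eE v) -(uE k) [X in _ = X * _]mulrC mulr_suml mulr_suml.
  apply: eq_bigr => i _; rewrite mulrAC mulr_sumr; apply: eq_bigr => j _.
  by rewrite /f exprD natrM -/D; ring.
have := inclusion_exclusion A B C; rewrite -FE.
rewrite (bigD1 set0) ?sub0set //= [RHS](bigD1 set0) ?sub0set //=.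
have -> : \sum_(L : {set 'I_n} | (L \subset A :\: C) && (L != set0)) (-1) ^+ #|L| * cyclic_weight r A B C L =
   \sum_(L : {set 'I_n} | (L \subset A :\: C) && (L != set0)) F L.
  apply: eq_bigr => L /andP [LA L0]; rewrite (cyclic_weight_leaves BA LA) IH //.
  - have : (#|A :\: L| < #|A|)%N.
      rewrite proper_card // properE subsetDl /=; apply: contra L0 => /subsetP sA.
      apply/eqP/setP=> a; rewrite inE; apply/negP=> aL.
      have := subsetP LA a aL; rewrite inE => /andP [_ /sA].
      by rewrite inE aL.
    by move=> /leq_trans; apply; rewrite -ltnS.
  - exact: setSD.
  apply/subsetP=> a aC; have := subsetP CA a aC; rewrite !inE => /andP [aB aA].
  have aL : a \notin L by apply/negP=> /(subsetP LA); rewrite inE aC.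
  by rewrite aL aA (negPf aB).
move/addIr; rewrite /F !set0I !set0D !setD0 !cards0 !expn0 !mul1r => ->.
by [].
Qed.

End Product.
End InclusionExclusion.

(** * The total weight of clean multigraphs *)

Section Inverse.
Local Open Scope ring_scope.
Variables (c : nat) (g : nat -> rat).

(** The term i = 0 of the system is [e v] itself, so each value is determined by the earlier ones;
    they are kept in a list for course-of-values recursion. *)
Fixpoint inverse_seq m : seq rat :=
  if m is k.+1 then
    rcons (inverse_seq k) (g k - \sum_(i < k) 'C(k, i.+1)%:R *
      ((-1) ^+ i.+1 * ((k - i.+1 + c) ^ i.+1)%:R * nth 0 (inverse_seq k) (k - i.+1)%N))
  else [::].

Lemma size_inverse_seq m : size (inverse_seq m) = m.
Proof. by elim: m => //= m IH; rewrite size_rcons IH. Qed.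

Lemma nth_inverse_seq m k : (k < m)%N -> nth 0 (inverse_seq m) k = nth 0 (inverse_seq k.+1) k.
Proof.
elim: m => // m IH; rewrite ltnS leq_eqVlt => /predU1P [->//|km].
by rewrite [in LHS]/= nth_rcons size_inverse_seq km IH.
Qed.

Lemma inclusion_exclusion_inverse : exists e : nat -> rat, forall v,
  \sum_(i < v.+1) 'C(v, i)%:R * ((-1) ^+ i * ((v - i + c) ^ i)%:R * e (v - i)%N) = g v.
Proof.
exists (fun k => nth 0 (inverse_seq k.+1) k) => v.
rewrite big_ord_recl bin0 expr0 expn0 !mul1r subn0 /= nth_rcons size_inverse_seq ltnn eqxx.
rewrite [X in _ + X](_ : _ = \sum_(i < v) 'C(v, i.+1)%:R *
      ((-1) ^+ i.+1 * ((v - i.+1 + c) ^ i.+1)%:R * nth 0 (inverse_seq v) (v - i.+1)%N)) ?subrK //.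
apply: eq_bigr => -[i iv] _; rewrite /bump /= add1n; congr (_ * (_ * _)).
by rewrite (@nth_inverse_seq v) // ltn_subrL (leq_ltn_trans _ iv).
Qed.

End Inverse.

(** * A cubic multigraph of positive weight *)

Section CubicGraph.
Variables (n r : nat).
Hypotheses (r0 : 0 < r) (rn : 2 * r <= n).

Let C := [set x : 'I_n | x < 2 * r].
Let partner (x y : 'I_n) := [&& x \in C, y \in C, x != y & x./2 == y./2].
(** Disjoint triple edges joining 2i and 2i + 1 for i < r; this witness shows that the constant
    attached to [C] is not 0. *)
Let M : 'M[nat]_n := \matrix_(x, y) (3 * partner x y).

Lemma card_initial_segment : #|C| = 2 * r.
Proof.
have wI : injective (widen_ord rn) by move=> a b /(congr1 val) /= /val_inj.
rewrite -[RHS]card_ord -(card_imset predT wI); congr #|pred_of_set _|.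
apply/setP=> x; rewrite inE; apply/idP/imsetP => [xr|[y _ ->]]; last exact: (ltn_ord y).
by exists (Ordinal xr) => //; apply: val_inj.
Qed.

Let deg_theta x : x \in C -> deg (Multigraph C M) x = 3.
Proof.
move=> xC; rewrite /deg /= mxE /partner eqxx !andbF muln0 addn0.
have xr : x < 2 * r by move: xC; rewrite inE.
pose k := if odd x then x.-1 else x.+1.
have kr : k < 2 * r by rewrite /k; case: ifP => ox; lia.
have kx : (k./2 == x./2) && (k != x) by rewrite /k; case: ifP => ox; lia.
pose y := Ordinal (leq_trans kr rn); have yC : y \in C by rewrite inE.
rewrite (bigD1 y) //= mxE /partner xC yC.
have -> : (x != y) && (x./2 == y./2).
  by case/andP: kx => k1 k2; rewrite -(inj_eq val_inj) /= eq_sym k2 eq_sym k1.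
rewrite big1 // => z /andP [zC zy]; rewrite mxE /partner xC zC /=.
have [xz|xz] := eqVneq x z => //=; case: eqP => // E.
move: zy xz E; rewrite -!(inj_eq val_inj) /= /k; case: ifP => ox; lia.
Qed.

Let core_theta : core_class r C set0 C M.
Proof.
have sM : symmetric_mx M.
  move=> x y; rewrite !mxE /partner; congr (_ * nat_of_bool _).
  by rewrite [y == x]eq_sym [y./2 == _]eq_sym; case: (x \in C); case: (y \in C).
apply/and5P; split; [| exact/symmetric_mxP | | |].
- by apply/supportedP=> x y; rewrite mxE /partner; case: (x \in C); case: (y \in C); rewrite //= muln0.
- by apply/forall_inP=> x xC; rewrite deg_theta.
- rewrite (eq_bigr (fun _ => 3)) ?sum_nat_const ?card_initial_segment; last by move=> x; apply: deg_theta.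
  by lia.
apply/andP; split; apply/eqP/setP=> x; rewrite !inE.
  apply/negP=> /andP [xr ux]; have xC : x \in C by rewrite inE.
  have d2 a : a \in C -> 1 < deg (Multigraph C M) a by move=> aC; rewrite deg_theta.
  by have := is_uni_min_deg2 (G := Multigraph C M) d2 xC ux; rewrite deg_theta.
by have [xr|//] := boolP (x < 2 * r); rewrite deg_theta // inE.
Qed.

Lemma core_weight_ge0 (A B C' : {set 'I_n}) : (0 <= core_weight r A B C')%R.
Proof. by apply: Num.Theory.sumr_ge0 => N _; rewrite invr_ge0 ler0n. Qed.

Lemma core_weight_gt0 : (0 < core_weight r C set0 C)%R.
Proof.
have bM : bounded_mx (n + r) M by apply: core_class_bounded core_theta.
rewrite /core_weight /weight (bigD1 (ord_mx (n + r) M)) ?ord_mxK //= ?core_theta //.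
apply: ltr_wpDr; last by rewrite invr_gt0 ltr0n kappa_den_gt0.
by apply: Num.Theory.sumr_ge0 => N _; rewrite invr_ge0 ler0n.
Qed.

End CubicGraph.

(** * Summation over clean multigraphs and the probability *)

Section Total.
Variables (n r : nat).
Implicit Types (A B C : {set 'I_n}).

Lemma cyclic_class_parts A B C (M : 'M[nat]_n) : cyclic_class r A B C M ->
  B \subset A /\ C \subset A :\: B.
Proof.
case/and5P=> _ _ _ _ /and3P [/eqP <- _ /eqP <-]; split.
  by apply/subsetP=> a; rewrite inE => /andP [].
apply/subsetP=> a; rewrite inE => /andP [/(subsetP (two_core_sub _ _)) + _].
by rewrite !inE is_complexE => /and3P [-> _ ->].
Qed.

(** Deleting a leaf preserves [C]. Without leaves all degrees are 2 or 3, and their sum 2 (|A| + r)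
    leaves exactly 2r vertices of degree 3. *)
Lemma cyclic_class_card A B C (M : 'M[nat]_n) : cyclic_class r A B C M -> #|C| = 2 * r.
Proof.
move Em : #|A| => m; elim: m A B M Em => [|m IH] A B M Am cM.
  have [_ CA] := cyclic_class_parts cM.
  have A0 := cards0_eq Am; have C0 : C = set0.
    by apply/eqP; rewrite -subset0 (subset_trans CA) // A0 set0D.
  by move: cM => /and5P [_ _ _ /eqP + _]; rewrite A0 C0 big_set0 cards0; lia.
have [lv|[x xl]] := set_0Vmem (leaves A M).
  have : core_class r A B C M.
    rewrite core_classE cM; apply/forall_inP=> x xA; apply/negP=> dx.
    have : x \in leaves A M by rewrite inE xA.
    by rewrite lv inE.
  case/and5P=> _ _ /forall_inP dA /eqP sd /andP [_ /eqP CE].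
  have CA : C \subset A by rewrite -CE; apply/subsetP=> a; rewrite inE => /andP [].
  move: sd; rewrite (eq_bigr (fun a => 2 + (a \in C))); last first.
    move=> a aA; have := dA a aA; rewrite -CE inE aA /=.
    by case: (deg _ a) => [|[|[|[|]]]].
  rewrite big_split /= sum_nat_const -sum1_card.
  have -> : \sum_(a in A) (a \in C) = \sum_(a in C) 1.
    rewrite (big_setID C) /= (setIidPr CA) [X in _ + X]big1 ?addn0; last by move=> a; rewrite inE => /andP [/negPf->].
    by apply: eq_bigr => a ->.
  by rewrite !sum1_card; move: #|A| #|C| => a c; lia.
have := subsetP (leaves_sub cM) x xl; rewrite inE => /andP [xC xA].
have dx : deg (Multigraph A M) x = 1 by move: xl; rewrite inE => /andP [_ /eqP].
have [pM /symmetric_mxP sM _] := and3P cM.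
have [y yA EM] := leafP xA pM sM dx.
have xA' : x \notin A :\ x by rewrite !inE eqxx.
move: cM; rewrite EM -{1}(setD1K xA) cyclic_class_leaf //.
- by move=> /andP [cM _]; apply: IH cM; move: Am; rewrite (cardsD1 x A) xA => [[]].
- exact: supported_restrict.
exact: restrict_sym.
Qed.

Local Open Scope ring_scope.

Let uni_set (M : 'M['I_(n + r).+1]_n) := uni_vertices (graph_of M).

Lemma clean_graphsE (M : 'M['I_(n + r).+1]_n) : (M \in clean_graphs n r) =
  cyclic_class r [set: 'I_n] (uni_set M) (cubic_kernel (graph_of M)) (nat_mx M).
Proof.
have symE : (M^T == M) = ((nat_mx M)^T == nat_mx M).
  apply/eqP/eqP => /matrixP E; apply/matrixP=> a b; have := E a b; rewrite !mxE.
    by move=> ->.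
  exact: ord_inj.
rewrite inE /cyclic_class symE; have -> : supported [set: 'I_n] (nat_mx M).
  by apply/supportedP=> a b; rewrite !inE.
case: symmetric_mxP => //= sM; rewrite -!/(graph_of M) !eqxx andbT.
have sG : symmetric_mx (mult (graph_of M)) by [].
rewrite cleanE // nb_acyclic_eq0 //=; rewrite andbA andbC.
have [cG|] := boolP [forall x in [set: 'I_n], is_cyclic (graph_of M) x]; last by [].
have a0 : nb_acyclic (graph_of M) = 0%N by apply/eqP; rewrite nb_acyclic_eq0.
by rewrite excess_cyclicE // !andTb; exact: andbC.
Qed.

(** Multigraphs are grouped by [C] and then by [B]. The weight depends on [B] only through its size,
    so each [C] contributes the same positive number [T] times its own constant. *)
Lemma sum_clean_gt0 : (1 <= r)%N -> (2 * r <= n)%N ->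
  0 < \sum_(M in clean_graphs n r)
        kappa (graph_of M) * (both_uni_limit r * n%:R ^+ 2 - #|uni_set M|%:R ^+ 2).
Proof.
move=> r0 rn.
have [e eE] := inclusion_exclusion_inverse (2 * r) (rising (3 * r)%:R).
have [u uE'] := inclusion_exclusion_inverse 0 (rising 2^-1).
have uE v : \sum_(i < v.+1) 'C(v, i)%:R * ((-1) ^+ i * ((v - i) ^ i)%:R * u (v - i)%N) = rising 2^-1 v.
  by rewrite -uE'; apply: eq_bigr => i _; rewrite addn0.
pose T : rat := \sum_(k < (n - 2 * r).+1) 'C(n - 2 * r, k)%:R *
        ((both_uni_limit r * n%:R ^+ 2 - k%:R ^+ 2) * (e (n - 2 * r - k)%N * u k)).
have T0 : 0 < T by apply: weighted_sum_gt0.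
have -> : \sum_(M in clean_graphs n r)
        kappa (graph_of M) * (both_uni_limit r * n%:R ^+ 2 - #|uni_set M|%:R ^+ 2) =
    \sum_(C : {set 'I_n} | #|C| == (2 * r)%N) T * core_weight r C set0 C.
  rewrite (partition_big (fun M => cubic_kernel (graph_of M)) (fun C => #|C| == (2 * r)%N)) /=; last first.
    by move=> M; rewrite clean_graphsE => /cyclic_class_card /eqP.
  apply: eq_bigr => C /eqP cC.
  rewrite (partition_big uni_set (fun B => B \subset [set: 'I_n] :\: C)) /=; last first.
    move=> M /andP [+ /eqP E]; rewrite clean_graphsE E => /cyclic_class_parts [_ CB].
    by apply/subsetP=> a aB; rewrite !inE andbT; apply/negP=> /(subsetP CB); rewrite inE aB.
  transitivity (\sum_(B : {set 'I_n} | B \subset [set: 'I_n] :\: C)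
     ((both_uni_limit r * n%:R ^+ 2 - #|B|%:R ^+ 2) * (e (n - 2 * r - #|B|)%N * u #|B|)) * core_weight r C set0 C).
    apply: eq_bigr => B BC.
    have CB : C \subset [set: 'I_n] :\: B.
      by apply/subsetP=> a aC; rewrite !inE andbT; apply/negP=> /(subsetP BC); rewrite inE aC.
    have vE : #|[set: 'I_n] :\: B :\: C| = (n - 2 * r - #|B|)%N.
      by rewrite cardsD (setIidPr CB) cC cardsD setTI cardsT card_ord subnAC.
    rewrite -vE -mulrA -(cyclic_weightE eE uE (subsetT B) CB cC) /cyclic_weight -weightZ /weight.
    apply: eq_big => M; last by move=> /andP [/andP [_ _] /eqP ->]; rewrite mulrC.
    rewrite /= clean_graphsE sub0set andbT; apply/andP/idP => [[/andP [cM /eqP <-] /eqP <-] //|cM].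
    have [_ _ /and5P [_ _ /eqP EB _ /eqP EC]] := and3P cM.
    by rewrite /uni_set EB EC cM !eqxx.
  rewrite -mulr_suml; congr (_ * _).
  rewrite (sum_subsets ([set: 'I_n] :\: C)
    (fun k => (both_uni_limit r * n%:R ^+ 2 - k%:R ^+ 2) * (e (n - 2 * r - k)%N * u k))).
  have -> : #|[set: 'I_n] :\: C| = (n - 2 * r)%N by rewrite cardsD setTI cardsT card_ord cC.
  by [].
rewrite (bigD1 [set x : 'I_n | (x < 2 * r)%N]) /=; last by rewrite card_initial_segment.
apply: ltr_wpDr; last by rewrite mulr_gt0 // core_weight_gt0.
by apply: sumr_ge0 => C _; rewrite mulr_ge0 ?core_weight_ge0 // ltW.
Qed.

Lemma Pr_not_both_unicyclic :
  Pr r (fun (M : multigraph n) x y => ~~ (in_unicyclic M x && in_unicyclic M y)) =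
  (\sum_(M in clean_graphs n r) kappa (graph_of M) * (n%:R ^+ 2 - #|uni_set M|%:R ^+ 2))
  / (\sum_(M in clean_graphs n r) kappa (graph_of M)) / n%:R ^+ 2.
Proof.
rewrite /Pr /law; set Z := \sum_(M in clean_graphs n r) kappa (graph_of M).
rewrite -(pair_big_dep xpredT (fun M p => ~~ (in_unicyclic (graph_of M) p.1 && in_unicyclic (graph_of M) p.2))
   (fun M p => if M \in clean_graphs n r then kappa (graph_of M) / Z * ((n ^ 2)%:R)^-1 else 0)) /=.
rewrite !mulr_suml [RHS]big_mkcond; apply: eq_bigr => M _.
case: ifP => cM; last by rewrite big1.
have sM : symmetric_mx (mult (graph_of M)).
  by move: cM; rewrite clean_graphsE => /and3P [_ /symmetric_mxP].
rewrite sumr_const natrX -[LHS]mulr_natr.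
rewrite [X in _ * X = _](_ : _ = n%:R ^+ 2 - #|uni_set M|%:R ^+ 2); last first.
  rewrite (eq_card (B := mem (~: setX (uni_set M) (uni_set M)))); last first.
    by move=> p; rewrite [LHS]unfold_in /= !in_unicyclicE // !inE.
  rewrite -!natrX -!mulnn -natrB; last by rewrite leq_mul // -[leqRHS]card_ord max_card.
  have := cardsC (setX (uni_set M) (uni_set M)).
  by rewrite cardsX card_prod card_ord => <-; rewrite addKn.
by rewrite mulrAC; congr (_ / _); rewrite mulrAC.
Qed.

End Total.

Local Open Scope ring_scope.

Theorem theorem11 (n r : nat) (hr : (1 <= r)%N) (hn : (2 * r <= n)%N) :
  r%:R * (r%:R + 1) / ((r%:R + 1 / 6%:R) * (r%:R + 5%:R / 6%:R))
    < Pr r (fun (M : multigraph n) x y =>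
              ~~ (in_unicyclic M x && in_unicyclic M y)).
Proof.
rewrite Pr_not_both_unicyclic; have := sum_clean_gt0 hr hn.
set Z := \sum_(M in clean_graphs n r) kappa (graph_of M).
pose U := \sum_(M in clean_graphs n r) kappa (graph_of M) * #|uni_vertices (graph_of M)|%:R ^+ 2.
have lin (t : rat) : \sum_(M in clean_graphs n r) kappa (graph_of M) *
    (t - #|uni_vertices (graph_of M)|%:R ^+ 2) = Z * t - U.
  by rewrite /Z /U mulr_suml -sumrB; apply: eq_bigr => M _; rewrite mulrBr.
rewrite !lin => pos.
have kappa0 (M : 'M['I_(n + r).+1]_n) : 0 <= kappa (graph_of M) by rewrite invr_ge0 ler0n.
have U0 : 0 <= U by apply: sumr_ge0 => M _; rewrite mulr_ge0 ?exprn_ge0 ?ler0n.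
have Z0 : 0 <= Z by apply: sumr_ge0 => M _.
have n0 : (0 : rat) < n%:R ^+ 2.
  by rewrite exprn_gt0 // ltr0n; apply: leq_trans hn; rewrite muln_gt0.
have rR : (1 : rat) <= r%:R by rewrite ler1n.
(* Were [Z] zero, the positive quantity in [pos] would be [- U]. *)
have Zpos : 0 < Z.
  rewrite lt_neqAle Z0 andbT eq_sym; apply: contraTneq pos => ->.
  by rewrite mul0r sub0r -leNgt oppr_le0.
rewrite !ltr_pdivlMr // mulrAC -subr_gt0; apply: lt_le_trans pos _.
(* The two sides are equal, because 1 - [both_uni_limit r] is the stated bound. *)
rewrite le_eqVlt; apply/orP; left; apply/eqP; rewrite /both_uni_limit.
move: (n%:R ^+ 2 : rat) (r%:R : rat) rR => N2 x x1.
have d1 : x * 6 + 1 != 0 by apply: lt0r_neq0; lra.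
have d2 : x * 6 + 5 != 0 by apply: lt0r_neq0; lra.
by field; rewrite d1 d2.
Qed.
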